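(* Let $\mathbb{H}:=\{z\in\mathbb{C}\colon\operatorname{Re}z>0\}$. A function $\phi\in\mathsf{Hol}(\mathbb{H},\mathbb{C})$ is a Bernstein generator if and only if it satisfies the following three conditions: (i) $\phi\big((0,+\infty)\big)\subset\mathbb{R}$; (ii) the limit $\phi(0):=\lim_{\mathbb{R}\ni x\to0^+}\phi(x)$ exists and belongs to $(-\infty,0]$; (iii) $\phi''$ is completely monotone in $(0,+\infty)$.
   Context: $\mathsf{Hol}(D,E)$ is the set of holomorphic functions $f$ in the domain $D$ with $f(D)\subset E$, with the topology of locally uniform convergence. A Bernstein function is a non-negative $C^\infty$ function $f$ on $(0,+\infty)$ such that $(-1)^{n+1}f^{(n)}(x)\ge0$ for all $x>0$ and all $n\in\mathbb{N}=\{1,2,\dots\}$. $\mathfrak{BF}$ denotes the class of all $v\in\mathsf{Hol}(\mathbb{H},\mathbb{C})$ such that $v|_{(0,+\infty)}$ is a Bernstein function that is not identically zero; it is known that every Bernstein function extends holomorphically to $\mathbb{H}$ and that $\mathfrak{BF}$ is a subset of $\mathsf{Hol}(\mathbb{H},\mathbb{H})$ which is closed under composition and relatively closed in $\mathsf{Hol}(\mathbb{H},\mathbb{H})$. A one-parameter semigroup in $\mathfrak{BF}$ is a family $(v_t)_{t\ge0}\subset\mathfrak{BF}$ with $v_0=\mathrm{id}_{\mathbb{H}}$, $v_s\circ v_t=v_{s+t}$ for all $s,t\ge0$, and $v_t\to\mathrm{id}_{\mathbb{H}}$ locally uniformly in $\mathbb{H}$ as $t\to0^+$. Its infinitesimal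 generator is $\phi:=\lim_{t\to0^+}(\mathrm{id}_{\mathbb{H}}-v_t)/t$ (the limit always exists in $\mathsf{Hol}(\mathbb{H},\mathbb{C})$). A Bernstein generator is the infinitesimal generator of a one-parameter semigroup in $\mathfrak{BF}$. A function $\varphi$ is completely monotone in an open interval $J\subset\mathbb{R}$ if it is real-valued and $C^\infty$ on $J$ and $(-1)^k\varphi^{(k)}(x)\ge0$ for all $x\in J$ and all $k=0,1,2,\ldots$ *)

(* Defs.v *)
From Stdlib Require Import Reals.
From Coquelicot Require Import Coquelicot.
Open Scope R_scope.

Definition HP (z : C) : Prop := 0 < Re z.

(* Functions on a domain D are total functions C -> C whose values outside D
   play no role. Differentiability is complex: the scalars are C_AbsRing. *)
Definition Hol (D E : C -> Prop) (f : C -> C) : Prop :=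
  (forall z, D z -> @ex_derive C_AbsRing C_NormedModule f z) /\
  (forall z, D z -> E (f z)).

Definition allC (_ : C) : Prop := True.

Definition loc_unif_lim {T : Type} (F : (T -> Prop) -> Prop) (D : C -> Prop)
    (f : T -> C -> C) (g : C -> C) : Prop :=
  forall z, D z ->
  exists delta : posreal, forall eps : posreal,
    F (fun t => forall w, D w -> Cmod (w - z) < delta ->
                          Cmod (f t w - g w) < eps).

Definition Bernstein (f : R -> R) : Prop :=
  (forall x, 0 < x -> 0 <= f x) /\
  (forall (n : nat) x, 0 < x -> ex_derive_n f n x) /\
  (forall (n : nat) x, (1 <= n)%nat -> 0 < x ->
     0 <= (-1) ^ (n + 1) * Derive_n f n x).

Definition real_valued (J : R -> Prop) (g : R -> C) : Prop :=
  forall x, J x -> Im (g x) = 0.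

Definition BF (v : C -> C) : Prop :=
  Hol HP allC v /\
  real_valued (fun x => 0 < x) (fun x => v (RtoC x)) /\
  Bernstein (fun x => Re (v (RtoC x))) /\
  (exists x, 0 < x /\ v (RtoC x) <> RtoC 0).

(* The family is indexed by t >= 0; its values at t < 0 play no role. *)
Definition BF_semigroup (v : R -> C -> C) : Prop :=
  (forall t, 0 <= t -> BF (v t)) /\
  (forall z, HP z -> v 0 z = z) /\
  (forall s t, 0 <= s -> 0 <= t ->
     forall z, HP z -> v s (v t z) = v (s + t) z) /\
  loc_unif_lim (at_right 0) HP v (fun z => z).

Definition infinitesimal_generator (v : R -> C -> C) (phi : C -> C) : Prop :=
  loc_unif_lim (at_right 0) HP (fun t z => ((z - v t z) / RtoC t)%C) phi.

Definition Bernstein_generator (phi : C -> C) : Prop :=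
  exists v, BF_semigroup v /\ infinitesimal_generator v phi.

Definition completely_monotone (a b : Rbar) (g : R -> C) : Prop :=
  let J := fun x : R => Rbar_lt a x /\ Rbar_lt x b in
  real_valued J g /\
  (forall (k : nat) x, J x -> ex_derive_n (fun y => Re (g y)) k x) /\
  (forall (k : nat) x, J x ->
     0 <= (-1) ^ k * Derive_n (fun y => Re (g y)) k x).

(* Main.v *)
(* Let p be the restriction of phi to (0,+oo).

   Necessity: the difference quotients f(x) = (x - v_t(x)) / t have completely monotone second
   derivatives and f(x) / x is nondecreasing; pointwise limits inherit both properties, and all
   derivatives converge along.

   Sufficiency: for small h the resolvent g = (id + h p)^-1 is a Bernstein function, because
   g' = (1 / (1 + h p')) o g, where 1 / (1 + h p') is completely monotone.  The iterates of the
   resolvents (implicit Euler scheme) converge to the flow of x' = - p(x), whose time-t maps are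
   thus limits of Bernstein functions.  A Bernstein function v extends to the half-plane by its
   Taylor series on the discs |z - c| < c, and the signs of the coefficients give
   Re v(z) >= v(c - |z - c|) > 0.  The semigroup law and the limits are carried over from the
   axis by the Cauchy-Taylor theorem, which is proved from Goursat's lemma. *)
Require Import Defs.
From Stdlib Require Import ZArith Reals Ranalysis5 Lra Lia ClassicalEpsilon.
From Coquelicot Require Import Coquelicot.
Open Scope R_scope.

(** * Pointwise limits *)

(** Signs are prescribed only from order 2 on because the identity in [(x - v_t(x)) / t] spoils
    orders 0 and 1. Derivatives of pointwise limits are therefore controlled through second
    differences. The upper bound 0 at [0+] does not pass to pointwise limits, since the two limits
    cannot be exchanged. The inequality [x * p y <= y * p x], which expresses the same bound for
    convex functions, does pass. The Euler scheme must be implicit: [p'] may be unbounded at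
    infinity ([p(x) = x^2]), so [1 - h p'] can become negative and explicit steps need not be
    Bernstein functions. As [p'] may also tend to minus infinity at 0 ([p(x) = - sqrt x]), no
    Lipschitz bound holds on the whole half-line. Orbits are first confined to a compact interval,
    where a discrete Gronwall argument gives convergence and the semigroup law. In the half-plane,
    each disc [|z - c| < c] meets the axis in [(0, 2c)], so the Taylor series at [c] carries
    identities and limits from the axis to the disc, and these discs exhaust the half-plane. *)

Ltac rmin := first [apply Rmin_l | apply Rmin_r | eapply Rle_trans; [apply Rmin_r | rmin]].
Ltac rmin_lt H := eapply Rlt_le_trans; [exact H | rmin].

Definition smooth (f : R -> R) : Prop :=
  forall (n : nat) x, 0 < x -> ex_derive_n f n x.

(* Satisfied by Bernstein generators, and by -f for f a Bernstein function. *)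
Definition alternating (f : R -> R) : Prop :=
  smooth f /\
  forall (n : nat) x, (2 <= n)%nat -> 0 < x -> 0 <= (-1) ^ n * Derive_n f n x.

Lemma locally_pos (x : R) : 0 < x -> locally x (fun y => 0 < y).
Proof. intros Hx. apply (open_gt 0 x Hx). Qed.

Lemma smooth_is_derive (f : R -> R) (n : nat) (x : R) :
  smooth f -> 0 < x -> is_derive (Derive_n f n) x (Derive_n f (S n) x).
Proof. intros H Hx. apply Derive_correct. exact (H (S n) x Hx). Qed.

(** Serves to compute all derivatives of a difference quotient from an explicit list of
    candidates. *)
Lemma Derive_n_tower (d : nat -> R -> R) :
  (forall n x, 0 < x -> is_derive (d n) x (d (S n) x)) ->
  smooth (d 0%nat) /\ forall n x, 0 < x -> Derive_n (d 0%nat) n x = d n x.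
Proof.
  intros H.
  assert (E : forall n x, 0 < x -> Derive_n (d 0%nat) n x = d n x).
  { induction n as [|n IH]; intros x Hx; [reflexivity|]. simpl.
    rewrite (Derive_ext_loc _ (d n)).
    - apply is_derive_unique, H, Hx.
    - refine (filter_imp _ _ _ (locally_pos x Hx)). exact IH. }
  split; [|exact E].
  intros [|n] x Hx; simpl; [exact I|].
  apply ex_derive_ext_loc with (d n).
  - refine (filter_imp _ _ _ (locally_pos x Hx)). intros y Hy. symmetry. exact (E n y Hy).
  - eexists. exact (H n x Hx).
Qed.

Lemma mvt_between (f df : R -> R) (a b : R) :
  (forall x, Rmin a b <= x <= Rmax a b -> is_derive f x (df x)) ->
  exists c, Rmin a b <= c <= Rmax a b /\ f b - f a = df c * (b - a).
Proof.
  intros H. apply MVT_gen.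
  - intros x Hx. apply H. lra.
  - intros x Hx. apply derivable_continuous_pt. exists (df x).
    apply is_derive_Reals, H, Hx.
Qed.

(** A quadratic error bound with fixed constants is preserved by pointwise limits, which is how
    differentiability of a limit is obtained below. *)
Lemma is_derive_quadratic (p : R -> R) (x l r K : R) :
  0 < r ->
  (forall y, Rabs (y - x) <= r -> Rabs (p y - p x - (y - x) * l) <= K * (y - x)²) ->
  is_derive p x l.
Proof.
  intros Hr H. apply is_derive_Reals. intros eps Heps.
  set (k := Rabs K + 1).
  assert (Hk : 0 < k) by (unfold k; pose proof (Rabs_pos K); lra).
  assert (Hd : 0 < Rmin r (eps / (2 * k))).
  { apply Rmin_pos; auto. apply Rdiv_lt_0_compat; lra. }
  exists (mkposreal _ Hd). intros h Hh0 Hh. simpl in Hh.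
  assert (Hh1 := Rmin_l r (eps / (2 * k))). assert (Hh2 := Rmin_r r (eps / (2 * k))).
  specialize (H (x + h)). replace (x + h - x) with h in H by ring.
  assert (Ha : 0 < Rabs h) by now apply Rabs_pos_lt.
  replace ((p (x + h) - p x) / h - l) with ((p (x + h) - p x - h * l) / h) by (field; auto).
  unfold Rdiv. rewrite Rabs_mult, Rabs_inv.
  apply Rmult_lt_reg_r with (Rabs h); auto.
  rewrite Rmult_assoc, Rinv_l, Rmult_1_r by lra.
  assert (K * h² <= k * (Rabs h * Rabs h)).
  { rewrite <- Rabs_mult. fold (Rsqr h). rewrite (Rabs_pos_eq h²) by apply Rle_0_sqr.
    apply Rmult_le_compat_r; [apply Rle_0_sqr|]. unfold k. pose proof (RRle_abs K). lra. }
  assert (Hm : k * Rabs h < eps).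
  { apply Rlt_le_trans with (k * (eps / (2 * k)) + k * (eps / (2 * k))).
    - assert (0 < k * (eps / (2 * k))) by (apply Rmult_lt_0_compat; [lra|apply Rdiv_lt_0_compat; lra]).
      assert (k * Rabs h < k * (eps / (2 * k))) by (apply Rmult_lt_compat_l; lra). lra.
    - right. field. lra. }
  nra.
Qed.

(** The bound on [g2] puts [g1 t x] within [K * |y - x|] of the difference quotient of [g t],
    uniformly in [t]. Convergence of the values thus makes [g1 t x] Cauchy, and the estimate itself
    passes to the limit. *)
Lemma filterlim_derive_step {T : Type} (F : (T -> Prop) -> Prop) {FF : ProperFilter F}
    (g g1 g2 : T -> R -> R) (p : R -> R) (x r K : R) :
  0 < r -> 0 <= K ->
  F (fun t => forall y, Rabs (y - x) <= r ->
       is_derive (g t) y (g1 t y) /\ is_derive (g1 t) y (g2 t y) /\ Rabs (g2 t y) <= K) ->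
  (forall y, Rabs (y - x) <= r -> filterlim (fun t => g t y) F (locally (p y))) ->
  exists l, filterlim (fun t => g1 t x) F (locally l) /\ is_derive p x l.
Proof.
  intros Hr HK Hg Hp.
  assert (HT : F (fun t => forall y, Rabs (y - x) <= r ->
     Rabs (g t y - g t x - (y - x) * g1 t x) <= K * (y - x)²)).
  { refine (filter_imp _ _ _ Hg). intros t Ht y Hy.
    assert (Hin : forall z, Rmin x y <= z <= Rmax x y -> Rabs (z - x) <= Rabs (y - x)).
    { intros z Hz. unfold Rmin, Rmax in Hz. destruct (Rle_dec x y); unfold Rabs;
      repeat destruct Rcase_abs; lra. }
    destruct (mvt_between (g t) (g1 t) x y) as [c [Hc ->]].
    { intros z Hz. apply Ht. specialize (Hin z Hz). lra. }
    assert (Hc' := Hin c Hc).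
    destruct (mvt_between (g1 t) (g2 t) x c) as [e [He Hd]].
    { intros z Hz. apply Ht.
      assert (Rabs (z - x) <= Rabs (c - x)); [|lra].
      unfold Rmin, Rmax in Hz. destruct (Rle_dec x c); unfold Rabs;
      repeat destruct Rcase_abs; lra. }
    assert (He' : Rabs (g2 t e) <= K).
    { apply Ht. assert (Rabs (e - x) <= Rabs (c - x)); [|lra].
      unfold Rmin, Rmax in He. destruct (Rle_dec x c); unfold Rabs;
      repeat destruct Rcase_abs; lra. }
    replace (g1 t c * (y - x) - (y - x) * g1 t x) with ((g1 t c - g1 t x) * (y - x)) by ring.
    rewrite Hd, !Rabs_mult. rewrite Rsqr_abs. unfold Rsqr.
    rewrite <- Rmult_assoc. apply Rmult_le_compat_r; [apply Rabs_pos|].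
    apply Rmult_le_compat; auto using Rabs_pos. }
  assert (Hx0 : Rabs (x - x) <= r) by (rewrite Rminus_diag, Rabs_R0; lra).
  assert (Hball : forall y, Rabs (y - x) <= r -> forall e, 0 < e ->
            F (fun t => Rabs (g t y - p y) < e)).
  { intros y Hy e He. exact (Hp y Hy _ (locally_ball (p y) (mkposreal e He))). }
  destruct (proj1 (filterlim_locally_cauchy (F := F) (fun t => g1 t x))) as [l Hl].
  { intros eps. pose proof (cond_pos eps) as He.
    (* With [K * h <= eps / 8], the two Taylor errors contribute at most [h * eps / 4]; four value
       errors below [h * eps / 16] contribute as much again. *)
    set (h := Rmin r (eps / (8 * (K + 1)))).
    assert (Hh : 0 < h) by (apply Rmin_pos; auto; apply Rdiv_lt_0_compat; lra).
    assert (Hh1 : h <= r) by apply Rmin_l.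
    assert (Hh2 : h * (8 * (K + 1)) <= eps).
    { apply Rle_trans with (eps / (8 * (K + 1)) * (8 * (K + 1))).
      - apply Rmult_le_compat_r; [lra|apply Rmin_r].
      - right. field. lra. }
    assert (Hy : Rabs (x + h - x) <= r) by (replace (x + h - x) with h by ring; rewrite Rabs_pos_eq; lra).
    assert (Hn : 0 < h * eps / 16) by nra.
    eexists. split.
    { apply filter_and; [exact HT|apply filter_and].
      - exact (Hball _ Hx0 _ Hn).
      - exact (Hball _ Hy _ Hn). }
    intros u v [Hu [Hu1 Hu2]] [Hv [Hv1 Hv2]].
    specialize (Hu _ Hy). specialize (Hv _ Hy).
    replace (x + h - x) with h in Hu, Hv by ring.
    apply Rabs_le_between in Hu, Hv. apply Rabs_def2 in Hu1, Hu2, Hv1, Hv2.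
    change (Rabs (g1 v x - g1 u x) < eps). unfold Rsqr in *.
    apply Rabs_def1; apply Rmult_lt_reg_l with h; auto; nra. }
  exists l. split; [exact Hl|].
  apply is_derive_quadratic with r K; auto.
  intros y Hy. apply Rle_plus_epsilon. intros e He.
  assert (Hn : 0 < e / (4 * (1 + Rabs (y - x)))).
  { apply Rdiv_lt_0_compat; auto. pose proof (Rabs_pos (y - x)); lra. }
  set (n := e / (4 * (1 + Rabs (y - x)))) in Hn.
  assert (He' : n + n + Rabs (y - x) * n <= e).
  { apply Rle_trans with (n * (4 * (1 + Rabs (y - x)))).
    - pose proof (Rabs_pos (y - x)). nra.
    - right. unfold n. field. pose proof (Rabs_pos (y - x)). lra. }
  assert (HL : F (fun t => Rabs (g1 t x - l) < n))
    by exact (Hl _ (locally_ball l (mkposreal n Hn))).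
  destruct (filter_ex (F := F) _ (filter_and _ _ HT (filter_and _ _ (Hball _ Hx0 _ Hn)
     (filter_and _ _ (Hball _ Hy _ Hn) HL))))
    as [t [H1 [H2 [H3 H4]]]].
  specialize (H1 y Hy).
  replace (p y - p x - (y - x) * l) with
    ((g t y - g t x - (y - x) * g1 t x) + (- (g t y - p y) + (g t x - p x) + (y - x) * (g1 t x - l))) by ring.
  eapply Rle_trans; [apply Rabs_triang|].
  apply Rplus_le_compat; [exact H1|].
  eapply Rle_trans; [apply Rabs_triang|].
  rewrite Rabs_mult.
  assert (Rabs (- (g t y - p y) + (g t x - p x)) <= n + n).
  { eapply Rle_trans; [apply Rabs_triang|]. rewrite Rabs_Ropp. lra. }
  assert (Rabs (y - x) * Rabs (g1 t x - l) <= Rabs (y - x) * n).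
  { apply Rmult_le_compat_l; [apply Rabs_pos|lra]. }
  lra.
Qed.

(** Mean value theorem for [s -> f (s + h) - f s], then for [f1]. *)
Lemma second_difference (f f1 f2 : R -> R) (a h : R) :
  0 < h ->
  (forall y, a <= y <= a + 2 * h -> is_derive f y (f1 y)) ->
  (forall y, a <= y <= a + 2 * h -> is_derive f1 y (f2 y)) ->
  exists c, a <= c <= a + 2 * h /\ f (a + 2 * h) - 2 * f (a + h) + f a = h² * f2 c.
Proof.
  intros Hh H1 H2.
  destruct (mvt_between (fun s => f (s + h) - f s) (fun s => f1 (s + h) - f1 s) a (a + h))
    as [c [Hc E]].
  { intros s Hs. rewrite Rmin_left, Rmax_right in Hs by lra.
    refine (is_derive_minus _ _ _ _ _ _ _); [|apply H1; lra].
    replace (f1 (s + h)) with (1 * f1 (s + h)) by ring.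
    refine (is_derive_comp f (fun s => s + h) _ _ _ _ _); [apply H1; lra|].
    auto_derive; auto. }
  rewrite Rmin_left, Rmax_right in Hc by lra.
  destruct (mvt_between f1 f2 c (c + h)) as [d [Hd E']].
  { intros s Hs. rewrite Rmin_left, Rmax_right in Hs by lra. apply H2; lra. }
  rewrite Rmin_left, Rmax_right in Hd by lra.
  exists d. split; [lra|].
  replace (a + h + h) with (a + 2 * h) in E by ring.
  rewrite E' in E. unfold Rsqr. lra.
Qed.

Lemma alternating_nonincreasing (f : R -> R) (n : nat) (x y : R) :
  alternating f -> (2 <= n)%nat -> 0 < x <= y ->
  (-1) ^ n * Derive_n f n y <= (-1) ^ n * Derive_n f n x.
Proof.
  intros [Hs Hf] Hn [Hx Hxy].
  destruct (mvt_between (fun z => (-1) ^ n * Derive_n f n z)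
    (fun z => (-1) ^ n * Derive_n f (S n) z) x y) as [c [Hc E]].
  { intros z Hz. rewrite Rmin_left, Rmax_right in Hz by lra.
    refine (is_derive_scal _ _ _ _ _). apply smooth_is_derive; auto; lra. }
  rewrite Rmin_left, Rmax_right in Hc by lra.
  assert (H := Hf (S n) c ltac:(lia) ltac:(lra)). rewrite <- tech_pow_Rmult in H. nra.
Qed.

(* The second difference of (-1)^n f^(n) dominates its second derivative to the right,
   because the latter is nonincreasing: values of f thus control all its derivatives. *)
Lemma alternating_derive_bound (f : R -> R) (n : nat) (a h y : R) :
  alternating f -> 0 < a -> 0 < h -> a + 2 * h <= y ->
  h² * Rabs (Derive_n f (S (S n)) y) <=
  (-1) ^ n * (Derive_n f n (a + 2 * h) - 2 * Derive_n f n (a + h) + Derive_n f n a).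
Proof.
  intros Hf Ha Hh Hy. pose proof Hf as [Hs Hp].
  destruct (second_difference (fun z => (-1) ^ n * Derive_n f n z)
    (fun z => (-1) ^ n * Derive_n f (S n) z) (fun z => (-1) ^ n * Derive_n f (S (S n)) z) a h)
    as [c [Hc E]]; auto.
  { intros z Hz. refine (is_derive_scal _ _ _ _ _). apply smooth_is_derive; auto; lra. }
  { intros z Hz. refine (is_derive_scal _ _ _ _ _). apply smooth_is_derive; auto; lra. }
  assert (Hsg : forall z, (-1) ^ n * Derive_n f (S (S n)) z = (-1) ^ (S (S n)) * Derive_n f (S (S n)) z).
  { intros z. simpl. ring. }
  replace ((-1) ^ n * (Derive_n f n (a + 2 * h) - 2 * Derive_n f n (a + h) + Derive_n f n a))
    with (h² * ((-1) ^ n * Derive_n f (S (S n)) c)) by lra.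
  apply Rmult_le_compat_l; [apply Rle_0_sqr|].
  rewrite Hsg.
  assert (HA : Rabs (Derive_n f (S (S n)) y) = (-1) ^ (S (S n)) * Derive_n f (S (S n)) y).
  { rewrite <- (Rabs_pos_eq ((-1) ^ (S (S n)) * _)) by (apply Hp; [lia|lra]).
    rewrite Rabs_mult, pow_1_abs. ring. }
  rewrite HA. apply alternating_nonincreasing; auto; [lia|lra].
Qed.

Lemma filterlim_Rabs_bounded {T : Type} (F : (T -> Prop) -> Prop) {FF : Filter F}
    (u : T -> R) (l : R) :
  filterlim u F (locally l) -> F (fun t => Rabs (u t) <= Rabs l + 1).
Proof.
  intros H.
  refine (filter_imp (fun t => Rabs (u t - l) < 1) _ _ (H _ (locally_ball l (mkposreal 1 Rlt_0_1)))).
  intros t Ht.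
  replace (u t) with (l + (u t - l)) by ring. eapply Rle_trans; [apply Rabs_triang|]. lra.
Qed.

(** Induction on the order: convergence at order [n] bounds order [n + 2] near [x] by
    [alternating_derive_bound], and [filterlim_derive_step] then yields order [n + 1]. *)
Lemma alternating_limit {T : Type} (F : (T -> Prop) -> Prop) {FF : ProperFilter F}
    (g : T -> R -> R) (p : R -> R) :
  F (fun t => alternating (g t)) ->
  (forall x, 0 < x -> filterlim (fun t => g t x) F (locally (p x))) ->
  alternating p /\
  forall n x, 0 < x -> filterlim (fun t => Derive_n (g t) n x) F (locally (Derive_n p n x)).
Proof.
  intros Hg Hp.
  assert (H : forall n x, 0 < x -> ex_derive_n p n x /\
     filterlim (fun t => Derive_n (g t) n x) F (locally (Derive_n p n x))).
  { induction n as [|n IH]; intros x Hx.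
    { split; [exact I|]. exact (Hp x Hx). }
    (* [a + 2 * h = x / 2] is the left end of the interval [|y - x| <= x / 2], so the three values
       at [a], [a + h], [a + 2 * h] bound the derivative on all of it. *)
    set (a := x / 4). set (h := x / 8).
    assert (Hb := fun z (Hz : 0 < z) => filterlim_Rabs_bounded F _ _ (proj2 (IH z Hz))).
    assert (Ha : 0 < a) by (unfold a; lra). assert (Hh : 0 < h) by (unfold h; lra).
    set (B := fun z => Rabs (Derive_n p n z) + 1).
    assert (HB : forall z, 0 <= B z) by (intros z; unfold B; pose proof (Rabs_pos (Derive_n p n z)); lra).
    destruct (filterlim_derive_step F (fun t => Derive_n (g t) n) (fun t => Derive_n (g t) (S n))
      (fun t => Derive_n (g t) (S (S n))) (Derive_n p n) x (x / 2)
      ((B (a + 2 * h) + 2 * B (a + h) + B a) / h²)) as [l [Hl1 Hl2]].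
    - lra.
    - apply Rmult_le_pos; [|apply Rlt_le, Rinv_0_lt_compat, Rlt_0_sqr; lra].
      pose proof (HB (a + 2 * h)). pose proof (HB (a + h)). pose proof (HB a). lra.
    - assert (Ha1 : 0 < a + h) by lra. assert (Ha2 : 0 < a + 2 * h) by lra.
      refine (filter_imp _ _ _ (filter_and _ _ Hg (filter_and _ _ (Hb _ Ha)
         (filter_and _ _ (Hb _ Ha1) (Hb _ Ha2))))).
      intros t [Ht [H1 [H2 H3]]] y Hy. apply Rabs_le_between in Hy.
      assert (Hy0 : 0 < y) by lra.
      split; [apply smooth_is_derive; auto; apply Ht|].
      split; [apply (smooth_is_derive (g t) (S n)); auto; apply Ht|].
      assert (Hh2 : 0 < h²) by (apply Rlt_0_sqr; lra).
      apply Rmult_le_reg_l with h²; auto.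
      replace (h² * ((B (a + 2 * h) + 2 * B (a + h) + B a) / h²)) with (B (a + 2 * h) + 2 * B (a + h) + B a)
        by (field; lra).
      eapply Rle_trans; [apply (alternating_derive_bound (g t) n a h y); auto|].
      { unfold a, h. lra. }
      eapply Rle_trans; [apply RRle_abs|].
      rewrite Rabs_mult, pow_1_abs, Rmult_1_l.
      fold (B a) in H1. fold (B (a + h)) in H2. fold (B (a + 2 * h)) in H3.
      apply Rabs_le_between in H1, H2, H3. apply Rabs_le_between. lra.
    - intros y Hy. apply Rabs_le_between in Hy. apply IH. lra.
    - assert (E : Derive_n p (S n) x = l) by (apply is_derive_unique; exact Hl2).
      split; [exists l; exact Hl2|]. rewrite E. exact Hl1. }
  split; [|intros n x Hx; apply H; exact Hx].
  split; [intros n x Hx; apply H; exact Hx|].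
  intros n x Hn Hx.
  apply (filterlim_le (F := F) (fun _ => 0) (fun t => (-1) ^ n * Derive_n (g t) n x) 0
    ((-1) ^ n * Derive_n p n x)).
  - refine (filter_imp _ _ _ Hg). intros t Ht. apply Ht; auto.
  - apply filterlim_const.
  - eapply filterlim_comp; [apply (H n x Hx)|].
    apply (filterlim_scal_r ((-1) ^ n) (Derive_n p n x)).
Qed.

(** * Resolvents *)

(* Complete monotonicity up to order [n] on an arbitrary set [D]: the truncation makes
   implicit characterizations such as [g' = k o g] usable by induction on [n]. *)
Fixpoint cm (D : R -> Prop) (n : nat) (f : R -> R) : Prop :=
  (forall x, D x -> 0 <= f x) /\
  match n with
  | O => True
  | S m => exists f', (forall x, D x -> is_derive f x (- f' x)) /\ cm D m f'
  end.

Definition pos_real (x : R) : Prop := 0 < x.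

Lemma cm_nonneg D n f x : cm D n f -> D x -> 0 <= f x.
Proof. destruct n; intros [H _]; apply H. Qed.

Lemma cm_pred D n f : cm D (S n) f -> cm D n f.
Proof.
  revert f. induction n as [|n IH]; intros f [H0 [f' [H1 H2]]].
  - split; auto.
  - split; auto. exists f'. split; auto.
Qed.

Lemma cm_sub (D E : R -> Prop) n f : (forall x, E x -> D x) -> cm D n f -> cm E n f.
Proof.
  intros HE. revert f. induction n as [|n IH]; intros f [H0 H1].
  - split; auto.
  - split; auto. destruct H1 as [f' [H1 H2]]. exists f'. split; auto.
Qed.

Lemma cm_ext D n f g : (forall x, f x = g x) -> cm D n f -> cm D n g.
Proof.
  intros E. destruct n as [|n]; intros [C0 C1]; split; auto.
  - intros x Hx. rewrite <- E. auto.
  - intros x Hx. rewrite <- E. auto.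
  - destruct C1 as [f' [C1 C2]]. exists f'. split; auto.
    intros x Hx. exact (is_derive_ext _ _ _ _ E (C1 x Hx)).
Qed.

Lemma cm_plus D n f g : cm D n f -> cm D n g -> cm D n (fun x => f x + g x).
Proof.
  revert f g. induction n as [|n IH]; intros f g [F0 F1] [G0 G1].
  - split; auto. intros x Hx. specialize (F0 x Hx). specialize (G0 x Hx). lra.
  - split. { intros x Hx. specialize (F0 x Hx). specialize (G0 x Hx). lra. }
    destruct F1 as [f' [F1 F2]], G1 as [g' [G1 G2]].
    exists (fun x => f' x + g' x). split; [|auto].
    intros x Hx. replace (- (f' x + g' x)) with (- f' x + - g' x) by ring.
    apply (is_derive_plus f g); auto.
Qed.

Lemma cm_mult D n f g : cm D n f -> cm D n g -> cm D n (fun x => f x * g x).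
Proof.
  revert f g. induction n as [|n IH]; intros f g Hf Hg.
  - destruct Hf as [F0 _], Hg as [G0 _]. split; auto.
    intros x Hx. apply Rmult_le_pos; auto.
  - pose proof (cm_pred _ _ _ Hf) as Hf'. pose proof (cm_pred _ _ _ Hg) as Hg'.
    destruct Hf as [F0 [f' [F1 F2]]], Hg as [G0 [g' [G1 G2]]].
    split. { intros x Hx. apply Rmult_le_pos; auto. }
    exists (fun x => f' x * g x + f x * g' x). split.
    + intros x Hx. replace (- (f' x * g x + f x * g' x)) with (- f' x * g x + f x * - g' x) by ring.
      apply (is_derive_mult f g); auto. intros; apply Rmult_comm.
    + apply cm_plus; apply IH; auto.
Qed.

Lemma cm_scal D n f c : 0 <= c -> cm D n f -> cm D n (fun x => c * f x).
Proof.
  intros Hc. revert f. induction n as [|n IH]; intros f [F0 F1].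
  - split; auto. intros x Hx. apply Rmult_le_pos; auto.
  - split. { intros x Hx. apply Rmult_le_pos; auto. }
    destruct F1 as [f' [F1 F2]]. exists (fun x => c * f' x). split; auto.
    intros x Hx. replace (- (c * f' x)) with (c * - f' x) by ring.
    apply is_derive_scal; auto.
Qed.

(** To reach order [n] for the composite, [g'] is needed only to order [n - 1]. This gain of one
    order closes the induction for the resolvent. *)
Lemma cm_comp D E n f g g' :
  (forall x, D x -> E (g x)) -> (forall x, D x -> is_derive g x (g' x)) ->
  cm E n f -> cm D (pred n) g' -> cm D n (fun x => f (g x)).
Proof.
  intros HE Hg. revert f. induction n as [|n IH]; intros f [F0 F1] Hg'.
  - split; auto.
  - split; auto. destruct F1 as [f' [F1 F2]].
    exists (fun x => f' (g x) * g' x). split.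
    + intros x Hx. replace (- (f' (g x) * g' x)) with (g' x * - f' (g x)) by ring.
      apply (is_derive_comp f g); auto.
    + apply cm_mult; auto. apply IH; auto.
      destruct n; auto. now apply cm_pred.
Qed.

Lemma cm_derive_n n f : cm pos_real n f ->
  forall k x, (k <= n)%nat -> 0 < x -> ex_derive_n f k x /\ 0 <= (-1) ^ k * Derive_n f k x.
Proof.
  revert f. induction n as [|n IH]; intros f [F0 F1] k x Hk Hx.
  - replace k with 0%nat by lia. simpl. split; auto. rewrite Rmult_1_l. auto.
  - destruct k as [|k]. { simpl. split; auto. rewrite Rmult_1_l. auto. }
    destruct F1 as [f' [F1 F2]].
    assert (E : forall j y, 0 < y -> Derive_n f (S j) y = - Derive_n f' j y).
    { intros j y Hy. rewrite <- Derive_n_opp.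
      replace (S j) with (j + 1)%nat by lia. rewrite <- Derive_n_comp.
      apply Derive_n_ext_loc. refine (filter_imp _ _ _ (locally_pos y Hy)).
      intros z Hz. apply is_derive_unique, F1, Hz. }
    destruct (IH f' F2 k x ltac:(lia) Hx) as [I1 I2]. split.
    + destruct k as [|k]. { simpl. eexists. apply F1, Hx. }
      apply ex_derive_ext_loc with (fun y => - Derive_n f' k y).
      * refine (filter_imp _ _ _ (locally_pos x Hx)). intros y Hy. symmetry. apply E, Hy.
      * refine (ex_derive_opp _ _ _). exact I1.
    + rewrite E by auto. simpl. lra.
Qed.

Lemma cm_alternating f n k : alternating f -> (2 <= k)%nat ->
  cm pos_real n (fun x => (-1) ^ k * Derive_n f k x).
Proof.
  intros Hf. revert k. induction n as [|n IH]; intros k Hk.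
  - split; auto. intros x Hx. apply Hf; auto.
  - split. { intros x Hx. apply Hf; auto. }
    exists (fun x => (-1) ^ (S k) * Derive_n f (S k) x). split; [|apply IH; lia].
    intros x Hx. replace (- ((-1) ^ (S k) * Derive_n f (S k) x)) with ((-1) ^ k * Derive_n f (S k) x)
      by (simpl; ring).
    apply is_derive_scal. apply smooth_is_derive; auto. apply Hf.
Qed.

(** Strict positivity makes the class closed under composition, so iterated resolvents remain in
    it. *)
Definition pos_bernstein (f : R -> R) : Prop :=
  (forall x, 0 < x -> 0 < f x) /\
  exists f', (forall x, 0 < x -> is_derive f x (f' x)) /\ forall n, cm pos_real n f'.

Lemma pos_bernstein_id : pos_bernstein (fun x => x).
Proof.
  split; auto. exists (fun _ => 1). split.
  - intros x _. apply @is_derive_id.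
  - intros n. assert (H0 : forall m, cm pos_real m (fun _ => 0)).
    { induction m as [|m IH]; simpl; split; auto; try (intros; lra).
      exists (fun _ => 0). split; auto. intros x _. rewrite Ropp_0. apply @is_derive_const. }
    destruct n as [|n]; split; auto; try (intros; lra).
    exists (fun _ => 0). split; auto. intros x _. rewrite Ropp_0. apply @is_derive_const.
Qed.

Lemma pos_bernstein_comp f g :
  pos_bernstein f -> pos_bernstein g -> pos_bernstein (fun x => f (g x)).
Proof.
  intros [F0 [f' [F1 F2]]] [G0 [g' [G1 G2]]]. split; auto.
  exists (fun x => f' (g x) * g' x). split.
  - intros x Hx. rewrite Rmult_comm. apply (is_derive_comp f g); auto.
  - intros n. apply cm_mult; auto. apply cm_comp with pos_real g'; auto.
Qed.

Lemma pos_bernstein_derive_n f : pos_bernstein f ->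
  smooth f /\ forall n x, (1 <= n)%nat -> 0 < x -> 0 <= (-1) ^ (n + 1) * Derive_n f n x.
Proof.
  intros [F0 [f' [F1 F2]]].
  assert (E : forall j y, 0 < y -> Derive_n f (S j) y = Derive_n f' j y).
  { intros j y Hy. replace (S j) with (j + 1)%nat by lia. rewrite <- Derive_n_comp.
    apply Derive_n_ext_loc. refine (filter_imp _ _ _ (locally_pos y Hy)).
    intros z Hz. apply is_derive_unique, F1, Hz. }
  split.
  - intros [|[|k]] x Hx; simpl; auto.
    { eexists. apply F1, Hx. }
    apply ex_derive_ext_loc with (Derive_n f' k).
    + refine (filter_imp _ _ _ (locally_pos x Hx)). intros y Hy. symmetry. apply E, Hy.
    + exact (proj1 (cm_derive_n (S k) f' (F2 _) (S k) x ltac:(lia) Hx)).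
  - intros [|n] x Hn Hx; [lia|]. rewrite E by auto.
    replace (S n + 1)%nat with (S (S n)) by lia.
    replace ((-1) ^ S (S n)) with ((-1) ^ n) by (simpl; ring).
    apply (cm_derive_n n f' (F2 _) n x); auto.
Qed.

Lemma Bernstein_alternating f : smooth f ->
  (forall n x, (1 <= n)%nat -> 0 < x -> 0 <= (-1) ^ (n + 1) * Derive_n f n x) ->
  alternating (fun x => - f x).
Proof.
  intros Hs Hf. split.
  - intros n x Hx. apply ex_derive_n_opp. auto.
  - intros n x Hn Hx. rewrite Derive_n_opp.
    specialize (Hf n x ltac:(lia) Hx). rewrite pow_add in Hf. lra.
Qed.

(** * Convexity and the resolvent equation *)

Lemma alternating_derive_nondecreasing p x y :
  alternating p -> 0 < x <= y -> Derive p x <= Derive p y.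
Proof.
  intros Hp Hxy.
  destruct (mvt_between (Derive_n p 1) (Derive_n p 2) x y) as [c [Hc E]].
  { intros z Hz. rewrite Rmin_left, Rmax_right in Hz by lra.
    apply smooth_is_derive; [apply Hp|lra]. }
  rewrite Rmin_left, Rmax_right in Hc by lra.
  assert (H := proj2 Hp 2%nat c ltac:(lia) ltac:(lra)).
  replace ((-1) ^ 2) with 1 in H by ring.
  assert (0 <= Derive_n p 2 c * (y - x)) by (apply Rmult_le_pos; lra).
  change (Derive_n p 1) with (Derive p) in E. lra.
Qed.

Lemma alternating_tangent p x y :
  alternating p -> 0 < x -> 0 < y -> p x + Derive p x * (y - x) <= p y.
Proof.
  intros Hp Hx Hy.
  destruct (mvt_between p (Derive p) x y) as [c [Hc E]].
  { intros z Hz. apply (smooth_is_derive p 0); [apply Hp|].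
    apply Rlt_le_trans with (Rmin x y); [apply Rmin_pos; auto|lra]. }
  destruct (Rle_lt_dec x y) as [H|H].
  - rewrite Rmin_left, Rmax_right in Hc by lra.
    assert (Derive p x <= Derive p c) by (apply alternating_derive_nondecreasing; auto; lra). nra.
  - rewrite Rmin_right, Rmax_left in Hc by lra.
    assert (Derive p c <= Derive p x) by (apply alternating_derive_nondecreasing; auto; lra). nra.
Qed.

(** The upper limit at [0+] is at most 0. This form applies equally to a function with a nonpositive
    limit and to the quotients [(x - v(x)) / t] with [v >= 0]. *)
Definition nonpos_at_0 (p : R -> R) : Prop :=
  forall eta, 0 < eta -> exists delta, 0 < delta /\ forall e, 0 < e < delta -> p e < eta.

(** The tangent at [y] lies below [p]; evaluate it at a point [s] tending to 0. *)
Lemma alternating_le_slope p y : alternating p -> nonpos_at_0 p -> 0 < y -> p y <= Derive p y * y.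
Proof.
  intros Hp H0 Hy. apply Rle_plus_epsilon. intros e He.
  destruct (H0 (e / 2)) as [d [Hd Hd']]; [lra|].
  set (D := Derive p y). set (C := Rabs D + 1).
  assert (HC : 0 < C) by (unfold C; pose proof (Rabs_pos D); lra).
  set (s := Rmin (d / 2) (e / (2 * C))).
  assert (Hs1 : s <= d / 2) by rmin. assert (Hs2 : s <= e / (2 * C)) by rmin.
  assert (Hs : 0 < s) by (apply Rmin_pos; [lra|apply Rdiv_lt_0_compat; lra]).
  assert (A := alternating_tangent p y s Hp Hy Hs). fold D in A. specialize (Hd' s ltac:(lra)).
  assert (- D * s <= C * (e / (2 * C))).
  { apply Rle_trans with (C * s); [|apply Rmult_le_compat_l; lra].
    apply Rmult_le_compat_r; [lra|]. unfold C. pose proof (RRle_abs (- D)). rewrite Rabs_Ropp in *. lra. }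
  replace (C * (e / (2 * C))) with (e / 2) in H by (field; lra). lra.
Qed.

(** The tangent at [y] has slope at least [p y / y], and [p x] lies above it. *)
Lemma alternating_star p x y :
  alternating p -> nonpos_at_0 p -> 0 < y <= x -> x * p y <= y * p x.
Proof.
  intros Hp H0 Hxy.
  assert (A := alternating_tangent p y x Hp ltac:(lra) ltac:(lra)).
  assert (B := alternating_le_slope p y Hp H0 ltac:(lra)). nra.
Qed.

(* For small h, x + h p(x) is convex and takes nonpositive values at 0+, so it takes each
   positive value exactly once, with positive slope. *)
Lemma resolvent_exists p h x :
  alternating p -> nonpos_at_0 p -> 0 < h -> h * Rabs (Derive p 1) <= / 2 -> 0 < x ->
  exists y, 0 < y /\ y + h * p y = x.
Proof.
  intros Hp H0 Hh Hh1 Hx.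
  destruct (H0 (x / (2 * h))) as [d [Hd Hd']]. { apply Rdiv_lt_0_compat; lra. }
  (* At [s] the left side is too small: [s <= x / 4] and [h * p s < x / 2]. *)
  set (s := Rmin (d / 2) (Rmin (x / 4) (1 / 2))).
  assert (Hs1 : s <= d / 2) by apply Rmin_l.
  assert (Hs2 : s <= x / 4) by rmin.
  assert (Hs3 : s <= 1 / 2) by rmin.
  assert (Hs : 0 < s). { repeat apply Rmin_pos; lra. }
  specialize (Hd' s ltac:(lra)).
  (* The tangent at 1 bounds [Y + h * p Y] below by [(Y + 1) / 2 - h * Rabs (p 1)], which exceeds
     [x] for this [Y]. *)
  set (Y := 2 + 2 * (x + h * Rabs (p 1))).
  assert (HhY : 0 <= h * Rabs (p 1)). { apply Rmult_le_pos; [lra|apply Rabs_pos]. }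
  assert (HY : 2 <= Y) by (unfold Y; lra).
  destruct (IVT_interv (fun y => y + h * p y - x) s Y) as [y [Hy E]].
  - intros a Ha. apply derivable_continuous_pt. exists (1 + h * Derive p a - 0).
    apply is_derive_Reals.
    refine (is_derive_minus (fun y => y + h * p y) (fun _ => x) a _ _ _ _).
    + refine (is_derive_plus (fun y => y) (fun y => h * p y) a _ _ _ _).
      * apply @is_derive_id.
      * apply is_derive_scal. apply (smooth_is_derive p 0); [apply Hp|lra].
    + apply @is_derive_const.
  - lra.
  - assert (h * p s < x / 2); [|lra].
    replace (x / 2) with (h * (x / (2 * h))) by (field; lra).
    apply Rmult_lt_compat_l; lra.
  - assert (A := alternating_tangent p 1 Y Hp ltac:(lra) ltac:(lra)).
    assert (B : h * (p 1 + Derive p 1 * (Y - 1)) <= h * p Y) by (apply Rmult_le_compat_l; lra).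
    assert (- (h * Rabs (p 1)) <= h * p 1).
    { rewrite <- Ropp_mult_distr_r_reverse. apply Rmult_le_compat_l; [lra|].
      rewrite <- Rabs_Ropp. pose proof (RRle_abs (- p 1)). lra. }
    assert (- (/ 2 * (Y - 1)) <= h * (Derive p 1 * (Y - 1))).
    { rewrite <- Rmult_assoc. replace (- (/ 2 * (Y - 1))) with (- / 2 * (Y - 1)) by ring.
      apply Rmult_le_compat_r; [lra|].
      assert (h * - Derive p 1 <= h * Rabs (Derive p 1)).
      { apply Rmult_le_compat_l; [lra|]. rewrite <- Rabs_Ropp. apply RRle_abs. }
      lra. }
    unfold Y in *. lra.
  - exists y. split; lra.
Qed.

(** [0 < x = y + h * p y <= y * (1 + h * Derive p y)]. *)
Lemma resolvent_slope p h x y :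
  alternating p -> nonpos_at_0 p -> 0 < h -> 0 < x -> 0 < y -> y + h * p y = x ->
  0 < 1 + h * Derive p y.
Proof.
  intros Hp H0 Hh Hx Hy E. assert (A := alternating_le_slope p y Hp H0 Hy).
  apply Rmult_lt_reg_r with y; [auto|]. nra.
Qed.

(** A root is merely chosen; its regular dependence on [x] follows from tangent inequalities valid
    for arbitrary roots, in [resolvent_is_derive]. *)
Definition resolvent (p : R -> R) (h x : R) : R :=
  epsilon (inhabits 0) (fun y => 0 < y /\ y + h * p y = x).

(** Since [p'] is at least [p'(1)] beyond 1, the last bound gives [x + h * p x] slope at least 1/2
    there, so that it reaches every large value. *)
Definition admissible (p : R -> R) (h : R) : Prop :=
  alternating p /\ nonpos_at_0 p /\ 0 < h /\ h * Rabs (Derive p 1) <= / 2.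

Lemma resolvent_spec p h x : admissible p h -> 0 < x ->
  0 < resolvent p h x /\ resolvent p h x + h * p (resolvent p h x) = x.
Proof.
  intros [Hp [H0 [Hh Hh1]]] Hx.
  exact (epsilon_spec (inhabits 0) _ (resolvent_exists p h x Hp H0 Hh Hh1 Hx)).
Qed.

(** Write [w = y' - y]. The tangents at both roots enclose [x' - x] between [m * w] and [m' * w]. As
    [m' - m] is [O(w)] and [w] is [O(x' - x)], the error of the linear approximation is
    quadratic. *)
Lemma resolvent_is_derive p h x : admissible p h -> 0 < x ->
  is_derive (resolvent p h) x (/ (1 + h * Derive p (resolvent p h x))).
Proof.
  intros Had Hx. destruct (resolvent_spec p h x Had Hx) as [Hy E].
  pose proof Had as [Hp [H0 [Hh Hh1]]].
  set (y := resolvent p h x) in *.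
  assert (Hm := resolvent_slope p h x y Hp H0 Hh Hx Hy E).
  set (m := 1 + h * Derive p y) in *.
  assert (Hc : continuity_pt (Derive p) y).
  { apply derivable_continuous_pt. exists (Derive_n p 2 y). apply is_derive_Reals.
    apply (smooth_is_derive p 1); [apply Hp|auto]. }
  assert (Hc1 := proj1 (continuity_pt_locally (Derive p) y) Hc).
  assert (Hmh : 0 < m / (2 * h)) by (apply Rdiv_lt_0_compat; lra).
  destruct (Hc1 (mkposreal _ Hmh)) as [d Hd]. simpl in Hd.
  (* The slope [1 + h * p'] decreases to the left and may vanish there; to the right of
     [a = y - eta] it is still at least [m / 2]. *)
  set (eta := Rmin (d / 2) (y / 2)).
  assert (He1 : eta <= d / 2) by apply Rmin_l. assert (He2 : eta <= y / 2) by apply Rmin_r.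
  assert (He : 0 < eta). { apply Rmin_pos; [|lra]. pose proof (cond_pos d). lra. }
  set (a := y - eta). assert (Ha : 0 < a) by (unfold a; lra).
  assert (Hsl : forall z, a <= z -> m / 2 <= 1 + h * Derive p z).
  { intros z Hz. assert (Derive p a <= Derive p z) by (apply alternating_derive_nondecreasing; auto).
    assert (Hb : Rabs (Derive p a - Derive p y) < m / (2 * h)).
    { apply Hd. change (Rabs (a - y) < d). replace (a - y) with (- eta) by (unfold a; ring).
      rewrite Rabs_Ropp, Rabs_pos_eq; [|lra]. pose proof (cond_pos d). lra. }
    apply Rabs_def2 in Hb.
    assert (h * (Derive p y - m / (2 * h)) <= h * Derive p z) by (apply Rmult_le_compat_l; lra).
    assert (h * (m / (2 * h)) = m / 2) by (field; lra).
    unfold m in *. lra. }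
  set (K := Rabs (Derive_n p 2 a)).
  assert (HK : forall z, a <= z -> 0 <= Derive_n p 2 z <= K).
  { intros z Hz. assert (H1 := alternating_nonincreasing p 2 a z Hp ltac:(lia) ltac:(lra)).
    assert (H2 := proj2 Hp 2%nat z ltac:(lia) ltac:(lra)).
    unfold K. pose proof (RRle_abs (Derive_n p 2 a)).
    replace ((-1) ^ 2) with 1 in * by ring. lra. }
  apply is_derive_quadratic with (Rmin (eta * m / 2) (x / 2)) (h * K * (4 / (m * m * m))).
  { apply Rmin_pos; [|lra]. apply Rmult_lt_0_compat; [apply Rmult_lt_0_compat; lra|lra]. }
  intros x' Hx'.
  assert (Hr1 : Rabs (x' - x) <= eta * m / 2) by (eapply Rle_trans; [exact Hx'|apply Rmin_l]).
  assert (Hr2 : Rabs (x' - x) <= x / 2) by (eapply Rle_trans; [exact Hx'|apply Rmin_r]).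
  apply Rabs_le_between in Hr1, Hr2. clear Hx'.
  assert (Hx' : 0 < x') by lra.
  destruct (resolvent_spec p h x' Had Hx') as [Hy' E'].
  assert (Hm' := resolvent_slope p h x' _ Hp H0 Hh Hx' Hy' E').
  set (y' := resolvent p h x') in *.
  assert (T : forall u v, 0 < u -> 0 < v ->
     u + h * p u + (1 + h * Derive p u) * (v - u) <= v + h * p v).
  { intros u v Hu Hv. assert (A := alternating_tangent p u v Hp Hu Hv).
    assert (h * (p u + Derive p u * (v - u)) <= h * p v) by (apply Rmult_le_compat_l; lra). lra. }
  (* Otherwise [x'] would lie below the image of [a], which itself is at least [eta * m / 2] below
     [x], against the radius chosen above. *)
  assert (Hay : a <= y').
  { destruct (Rle_lt_dec a y') as [|Hlt]; auto. exfalso.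
    assert (A1 := T y' a Hy' Ha). assert (A2 := T a y Ha Hy).
    assert (A3 := Hsl a (Rle_refl a)).
    unfold a in *. nra. }
  assert (A1 := T y y' Hy Hy'). assert (A2 := T y' y Hy' Hy). fold m in A1.
  assert (A3 := Hsl y' Hay). rewrite E, E' in A1. rewrite E, E' in A2.
  set (m' := 1 + h * Derive p y') in *.
  set (u := x' - x) in *. set (w := y' - y).
  assert (B1 : m * w <= u) by (unfold u, w; lra).
  assert (B2 : u <= m' * w) by (unfold u, w; lra).
  assert (Hww : m / 2 * Rabs w <= Rabs u).
  { unfold Rabs. destruct (Rcase_abs w), (Rcase_abs u); nra. }
  assert (Hmm : Rabs (m' - m) <= h * K * Rabs w).
  { destruct (mvt_between (Derive_n p 1) (Derive_n p 2) y y') as [c [Hc' Ec]].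
    { intros z Hz. apply (smooth_is_derive p 1); [apply Hp|].
      assert (a <= Rmin y y') by (apply Rmin_glb; [unfold a; lra|auto]). lra. }
    assert (Hac : a <= c).
    { assert (a <= Rmin y y') by (apply Rmin_glb; [unfold a; lra|auto]). lra. }
    replace (m' - m) with (h * (Derive_n p 1 y' - Derive_n p 1 y)) by (change (Derive_n p 1) with (Derive p); unfold m', m; ring).
    rewrite Ec. fold w. rewrite !Rabs_mult, (Rabs_pos_eq h) by lra.
    rewrite Rmult_assoc. apply Rmult_le_compat_l; [lra|].
    apply Rmult_le_compat_r; [apply Rabs_pos|]. specialize (HK c Hac). rewrite Rabs_pos_eq; lra. }
  (* m (w - u/m) = m w - u lies between m w - m' w and 0 *)
  assert (B3 : Rabs (m * w - u) <= Rabs (m' - m) * Rabs w).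
  { rewrite <- Rabs_mult. unfold Rabs at 1. destruct (Rcase_abs (m * w - u)).
    - eapply Rle_trans; [|apply RRle_abs]. lra.
    - assert (m * w - u = 0) as -> by lra. apply Rabs_pos. }
  change (Rabs (w - u * / m) <= h * K * (4 / (m * m * m)) * u²).
  replace (w - u * / m) with ((m * w - u) * / m) by (field; lra).
  rewrite Rabs_mult, (Rabs_pos_eq (/ m)) by (apply Rlt_le, Rinv_0_lt_compat; lra).
  assert (B4 : Rabs w <= 2 / m * Rabs u).
  { apply Rmult_le_reg_l with (m / 2); [lra|]. eapply Rle_trans; [exact Hww|]. right. field. lra. }
  assert (HK0 : 0 <= K) by apply Rabs_pos.
  assert (HhK : 0 <= h * K) by (apply Rmult_le_pos; lra).
  rewrite (Rsqr_abs u).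
  apply Rle_trans with (h * K * (2 / m * Rabs u) * (2 / m * Rabs u) * / m).
  - apply Rmult_le_compat_r. { apply Rlt_le, Rinv_0_lt_compat; lra. }
    eapply Rle_trans; [exact B3|].
    apply Rmult_le_compat; auto using Rabs_pos.
    eapply Rle_trans; [exact Hmm|]. apply Rmult_le_compat_l; auto.
  - right. unfold Rsqr. field. lra.
Qed.

Lemma resolvent_pos_bernstein p h : admissible p h -> pos_bernstein (resolvent p h).
Proof.
  intros Had. pose proof Had as [Hp [H0 [Hh Hh1]]]. split.
  { intros x Hx. apply resolvent_spec; auto. }
  exists (fun x => / (1 + h * Derive p (resolvent p h x))).
  assert (HD := fun x => resolvent_is_derive p h x Had). split; [exact HD|].
  (* Near 0 the slope [1 + h * p'] may be negative, so its reciprocal is completely monotone only on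
     this set; hence the domain argument of [cm]. *)
  set (D := fun y => 0 < y /\ 0 < 1 + h * Derive p y).
  assert (Hmap : forall x, pos_real x -> D (resolvent p h x)).
  { intros x Hx. destruct (resolvent_spec p h x Had Hx) as [A B]. split; auto.
    apply (resolvent_slope p h x); auto. }
  assert (Hinv : forall n, cm D n (fun y => / (1 + h * Derive p y))).
  { assert (P0 : forall y, D y -> 0 <= / (1 + h * Derive p y)).
    { intros y [_ Hy]. apply Rlt_le, Rinv_0_lt_compat, Hy. }
    induction n as [|n IH]; split; auto.
    exists (fun y => h * Derive_n p 2 y * (/ (1 + h * Derive p y) * / (1 + h * Derive p y))). split.
    - intros y [Hy Hs].
      replace (- _) with (- (h * Derive_n p 2 y) / (1 + h * Derive p y) ^ 2) by (field; lra).
      apply (is_derive_inv (fun y => 1 + h * Derive p y)); [|lra].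
      rewrite <- (Rplus_0_l (h * Derive_n p 2 y)).
      refine (is_derive_plus (fun _ => 1) (fun y => h * Derive p y) y _ _ _ _).
      + apply @is_derive_const.
      + apply is_derive_scal. apply (smooth_is_derive p 1); [apply Hp|auto].
    - apply cm_mult; [|apply cm_mult; auto]. apply cm_scal; [lra|].
      apply cm_sub with pos_real; [intros y Hy; apply Hy|].
      assert (C := cm_alternating p n 2 Hp (le_n _)).
      replace ((-1) ^ 2) with 1 in C by ring.
      refine (cm_ext _ _ _ _ _ C). intros t. apply Rmult_1_l. }
  (* The derivative is itself the composite of [1 / (1 + h * p')] with the resolvent: order [n] for
     it, through [cm_comp], gives order [n + 1]. *)
  induction n as [|n IH].
  - split; auto. intros x Hx. apply (cm_nonneg D 0 _ _ (Hinv 0%nat)), Hmap, Hx.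
  - apply (cm_comp pos_real D (S n) (fun y => / (1 + h * Derive p y)) (resolvent p h)
      (fun x => / (1 + h * Derive p (resolvent p h x)))); auto.
Qed.

(** * The flow on the half-line *)

Definition floor_nat (r : R) : nat := Z.to_nat (up r - 1).

Lemma floor_nat_spec r : 0 <= r -> INR (floor_nat r) <= r < INR (floor_nat r) + 1.
Proof.
  intros Hr. destruct (archimed r) as [H1 H2].
  assert (0 < IZR (up r)) by lra. apply lt_IZR in H.
  unfold floor_nat. rewrite INR_IZR_INZ, Z2Nat.id by lia. rewrite minus_IZR. lra.
Qed.

Definition euler (p : R -> R) (h : R) (n : nat) (x : R) : R := Nat.iter n (resolvent p h) x.

Lemma euler_S p h n x : euler p h (S n) x = resolvent p h (euler p h n x).
Proof. reflexivity. Qed.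

Lemma euler_add p h n m x : euler p h (n + m) x = euler p h n (euler p h m x).
Proof. apply Nat.iter_add. Qed.

Lemma euler_pos_bernstein p h n : admissible p h -> pos_bernstein (euler p h n).
Proof.
  intros H. induction n as [|n IH].
  - exact pos_bernstein_id.
  - exact (pos_bernstein_comp _ _ (resolvent_pos_bernstein p h H) IH).
Qed.

Lemma euler_step p h n x : admissible p h -> 0 < x ->
  0 < euler p h n x /\
  euler p h (S n) x + h * p (euler p h (S n) x) = euler p h n x.
Proof.
  intros H Hx. assert (0 < euler p h n x) by (apply (euler_pos_bernstein p h n H); auto).
  split; auto. rewrite euler_S. apply resolvent_spec; auto.
Qed.

Lemma exp_le_exp x y : x <= y -> exp x <= exp y.
Proof. intros [H| ->]; [apply Rlt_le, exp_increasing, H|apply Rle_refl]. Qed.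

(** [1 / (1 - s) <= 1 + 2 * s <= exp (2 * s)]: one step of the discrete Gronwall inequality of the
    implicit scheme, and the origin of the factor 2 in the exponents below. *)
Lemma inv_one_minus_le_exp s y x : 0 <= s <= / 2 -> 0 <= y -> y * (1 - s) <= x -> y <= x * exp (2 * s).
Proof.
  intros Hs Hy H. assert (E := exp_ineq1_le (2 * s)).
  assert (0 <= x) by nra.
  apply Rle_trans with (x * (1 + 2 * s)); [|apply Rmult_le_compat_l; lra].
  apply Rle_trans with (y * (1 - s) * (1 + 2 * s)); [|apply Rmult_le_compat_r; lra].
  assert (0 <= y * (s * (1 - 2 * s))) by (apply Rmult_le_pos; nra). nra.
Qed.

(* For steps h <= h1, Euler orbits issued from [a, b] stay in [al, be] up to time T; M and L
   bound p and its Lipschitz constant there. *)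
Definition stable (p : R -> R) (a b T h1 al be M L : R) : Prop :=
  0 < h1 /\ 0 < al /\ 0 <= M /\ 0 <= L /\
  (forall h, 0 < h <= h1 -> admissible p h /\ h * L <= / 2 /\
     forall n x, a <= x <= b -> INR n * h <= T -> al <= euler p h n x <= be) /\
  (forall y, al <= y <= be -> Rabs (p y) <= M) /\
  (forall y z, al <= y <= be -> al <= z <= be -> Rabs (p y - p z) <= L * Rabs (y - z)).

(** The tangent at 1 gives [- p y <= A * (1 + y)], so [1 + y] grows by at most [exp (2 * A * h)] per
    step; this yields [be]. Below [be], the monotonicity of [p y / y] gives [p y <= B * y], so a
    step divides the orbit by at most [exp (B * h)]; this yields [al]. *)
Lemma stable_exists p a b T : alternating p -> nonpos_at_0 p -> 0 < a <= b -> 0 <= T ->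
  exists h1 al be M L, stable p a b T h1 al be M L.
Proof.
  intros Hp H0 Hab HT.
  set (A := Rabs (p 1) + Rabs (Derive p 1)).
  assert (HA : 0 <= A). { unfold A. pose proof (Rabs_pos (p 1)). pose proof (Rabs_pos (Derive p 1)). lra. }
  set (be := (1 + b) * exp (2 * A * T)).
  assert (Hbe : 1 < be).
  { unfold be. assert (1 <= exp (2 * A * T)).
    { assert (0 <= 2 * A * T) by (apply Rmult_le_pos; lra). pose proof (exp_ineq1_le (2 * A * T)). lra. }
    nra. }
  set (B := Rabs (p be) / be).
  assert (HB : 0 <= B). { apply Rmult_le_pos; [apply Rabs_pos|apply Rlt_le, Rinv_0_lt_compat; lra]. }
  set (al := a * exp (- (B * T))).
  assert (Hal : 0 < al). { apply Rmult_lt_0_compat; [lra|apply exp_pos]. }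
  (* [p'] is monotone, so its two end values bound it on [[al, be]]. *)
  set (L := Rabs (Derive p al) + Rabs (Derive p be)).
  assert (HL : 0 <= L). { unfold L. pose proof (Rabs_pos (Derive p al)). pose proof (Rabs_pos (Derive p be)). lra. }
  (* Makes [h * A] and [h * L] at most 1/2, as the Gronwall steps require; the first also gives
     admissibility, because [A] includes [|p'(1)|]. *)
  set (h1 := / (2 * (A + L + 1))).
  assert (Hh1 : 0 < h1). { apply Rinv_0_lt_compat. lra. }
  assert (Hlip : forall y z, al <= y <= be -> al <= z <= be -> Rabs (p y - p z) <= L * Rabs (y - z)).
  { intros y z Hy Hz. destruct (mvt_between p (Derive p) z y) as [c [Hc E]].
    { intros c Hc. apply (smooth_is_derive p 0); [apply Hp|].
      apply Rlt_le_trans with (Rmin z y); [apply Rmin_pos; lra|lra]. }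
    rewrite E, Rabs_mult. apply Rmult_le_compat_r; [apply Rabs_pos|].
    assert (al <= Rmin z y) by (apply Rmin_glb; lra).
    assert (Rmax z y <= be) by (apply Rmax_lub; lra).
    assert (D1 : Derive p al <= Derive p c) by (apply alternating_derive_nondecreasing; auto; lra).
    assert (D2 : Derive p c <= Derive p be) by (apply alternating_derive_nondecreasing; auto; lra).
    unfold L. pose proof (Rabs_pos (Derive p al)). pose proof (Rabs_pos (Derive p be)).
    pose proof (RRle_abs (Derive p be)). pose proof (RRle_abs (- Derive p al)). rewrite Rabs_Ropp in *.
    apply Rabs_le. lra. }
  exists h1, al, be, (Rabs (p al) + L * (be + al)), L.
  split; [auto|]. split; [auto|]. split.
  { pose proof (Rabs_pos (p al)). assert (0 <= L * (be + al)) by (apply Rmult_le_pos; lra). lra. }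
  split; [auto|]. split; [|split; [|exact Hlip]].
  2:{ intros y Hy. replace (p y) with (p al + (p y - p al)) by ring.
      eapply Rle_trans; [apply Rabs_triang|]. apply Rplus_le_compat_l.
      eapply Rle_trans; [apply Hlip; lra|]. apply Rmult_le_compat_l; auto. apply Rabs_le. lra. }
  intros h Hh.
  assert (Hhs : h * (2 * (A + L + 1)) <= 1).
  { apply Rle_trans with (h1 * (2 * (A + L + 1))).
    - apply Rmult_le_compat_r; lra.
    - right. unfold h1. field. lra. }
  assert (HhA : 0 <= h * A) by (apply Rmult_le_pos; lra).
  assert (HhL : 0 <= h * L) by (apply Rmult_le_pos; lra).
  assert (Had : admissible p h).
  { split; [auto|split; [auto|split; [lra|]]].
    apply Rle_trans with (h * A); [|lra]. apply Rmult_le_compat_l; [lra|].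
    unfold A. pose proof (Rabs_pos (p 1)). lra. }
  split; [exact Had|]. split; [lra|].
  assert (Hup : forall n x, a <= x <= b -> 1 + euler p h n x <= (1 + x) * exp (2 * A * (INR n * h))).
  { intros n x Hx. induction n as [|n IH].
    { simpl. rewrite Rmult_0_l, Rmult_0_r, exp_0. unfold euler. simpl. lra. }
    destruct (euler_step p h n x Had ltac:(lra)) as [S1 S2].
    assert (S3 : 0 < euler p h (S n) x) by (apply (euler_step p h (S n) x Had); lra).
    set (y := euler p h (S n) x) in *. set (x0 := euler p h n x) in *.
    assert (T1 := alternating_tangent p 1 y Hp ltac:(lra) S3).
    assert (T2 : - (A * (1 + y)) <= p y).
    { unfold A. pose proof (RRle_abs (- p 1)). rewrite Rabs_Ropp in *.
      assert (- (Rabs (Derive p 1) * (1 + y)) <= Derive p 1 * (y - 1)).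
      { pose proof (Rabs_le_between (Derive p 1) (Rabs (Derive p 1))) as [Q _].
        specialize (Q (Rle_refl _)). pose proof (Rabs_pos (Derive p 1)). nra. }
      pose proof (Rabs_pos (p 1)). nra. }
    assert (T3 : (1 + y) * (1 - h * A) <= 1 + x0).
    { assert (h * - (A * (1 + y)) <= h * p y) by (apply Rmult_le_compat_l; lra). lra. }
    apply inv_one_minus_le_exp in T3; [|lra|lra].
    eapply Rle_trans; [exact T3|].
    replace (2 * A * (INR (S n) * h)) with (2 * A * (INR n * h) + 2 * (h * A)) by (rewrite S_INR; ring).
    rewrite exp_plus, <- (Rmult_assoc (1 + x)). apply Rmult_le_compat_r; [apply Rlt_le, exp_pos|exact IH]. }
  assert (Hupb : forall n x, a <= x <= b -> INR n * h <= T -> euler p h n x <= be).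
  { intros n x Hx Hn. specialize (Hup n x Hx).
    assert (exp (2 * A * (INR n * h)) <= exp (2 * A * T)).
    { apply exp_le_exp. apply Rmult_le_compat_l; lra. }
    assert (be >= (1 + x) * exp (2 * A * (INR n * h))).
    { unfold be. apply Rle_ge, Rmult_le_compat; try lra. apply Rlt_le, exp_pos. }
    lra. }
  intros n x Hx Hn. split; [|auto].
  assert (Hlow : x <= euler p h n x * exp (B * (INR n * h))).
  { induction n as [|n IH].
    { simpl. rewrite Rmult_0_l, Rmult_0_r, exp_0. unfold euler. simpl. lra. }
    destruct (euler_step p h n x Had ltac:(lra)) as [S1 S2].
    assert (S3 : 0 < euler p h (S n) x) by (apply (euler_step p h (S n) x Had); lra).
    assert (S4 := Hupb (S n) x Hx Hn).
    rewrite S_INR in Hn. specialize (IH ltac:(nra)).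
    set (y := euler p h (S n) x) in *. set (x0 := euler p h n x) in *.
    assert (T1 : p y <= B * y).
    { assert (Q := alternating_star p be y Hp H0 ltac:(lra)).
      apply Rmult_le_reg_l with be; [lra|]. eapply Rle_trans; [exact Q|].
      unfold B. replace (be * (Rabs (p be) / be * y)) with (y * Rabs (p be)) by (field; lra).
      apply Rmult_le_compat_l; [lra|apply RRle_abs]. }
    assert (T2 : x0 <= y * exp (B * h)).
    { assert (h * p y <= h * (B * y)) by (apply Rmult_le_compat_l; lra).
      pose proof (exp_ineq1_le (B * h)). nra. }
    eapply Rle_trans; [exact IH|].
    replace (B * (INR (S n) * h)) with (B * h + B * (INR n * h)) by (rewrite S_INR; ring).
    rewrite exp_plus, <- (Rmult_assoc y). apply Rmult_le_compat_r; [apply Rlt_le, exp_pos|exact T2]. }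
  unfold al.
  apply Rmult_le_reg_r with (exp (B * (INR n * h))); [apply exp_pos|].
  rewrite Rmult_assoc, <- exp_plus.
  eapply Rle_trans; [|exact Hlow].
  assert (exp (- (B * T) + B * (INR n * h)) <= 1).
  { rewrite <- exp_0. apply exp_le_exp. assert (B * (INR n * h) <= B * T) by (apply Rmult_le_compat_l; lra). lra. }
  assert (a * exp (- (B * T) + B * (INR n * h)) <= a * 1) by (apply Rmult_le_compat_l; lra). lra.
Qed.

Lemma euler_lipschitz_time p a b T h1 al be M L h n m x :
  stable p a b T h1 al be M L -> 0 < h <= h1 -> a <= x <= b -> 0 < x -> INR (n + m) * h <= T ->
  Rabs (euler p h (n + m) x - euler p h n x) <= INR m * h * M.
Proof.
  intros [_ [Hal [HM [HL [HE [HB Hlip]]]]]] Hh Hx Hx0 Hn.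
  destruct (HE h Hh) as [Had [_ Hr]].
  induction m as [|m IH].
  - rewrite Nat.add_0_r, Rminus_diag, Rabs_R0. simpl. lra.
  - rewrite Nat.add_succ_r in *. rewrite S_INR in Hn.
    destruct (euler_step p h (n + m) x Had ltac:(lra)) as [S1 S2].
    assert (Q := HB _ (Hr (S (n + m)) x Hx ltac:(rewrite S_INR; lra))).
    set (y := euler p h (S (n + m)) x) in *. set (y0 := euler p h (n + m) x) in *.
    replace (y - euler p h n x) with (- (h * p y) + (y0 - euler p h n x)) by lra.
    eapply Rle_trans; [apply Rabs_triang|].
    rewrite Rabs_Ropp, Rabs_mult, (Rabs_pos_eq h) by lra.
    assert (h * Rabs (p y) <= h * M) by (apply Rmult_le_compat_l; lra).
    rewrite S_INR. lra.
Qed.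

(** At step [j] the orbit is within [j * h * M] of [x], so replacing [p] there by [p x] costs at
    most [h * L * (j * h * M)]; these errors are summed. *)
Lemma euler_consistency p a b T h1 al be M L h n x :
  stable p a b T h1 al be M L -> 0 < h <= h1 -> a <= x <= b -> 0 < x -> INR n * h <= T ->
  Rabs (euler p h n x - x + INR n * h * p x) <= L * M * (INR n * h)².
Proof.
  intros HS Hh Hx Hx0 Hn. pose proof HS as [_ [Hal [HM [HL [HE [HB Hlip]]]]]].
  destruct (HE h Hh) as [Had [_ Hr]].
  induction n as [|n IH].
  - simpl. unfold euler. simpl.
    replace (x - x + 0 * h * p x) with 0 by ring. rewrite Rabs_R0. unfold Rsqr. lra.
  - assert (Q := euler_lipschitz_time p a b T h1 al be M L h 0 (S n) x HS Hh Hx Hx0 Hn).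
    simpl (0 + S n)%nat in Q.
    assert (R0 := Hr 0%nat x Hx ltac:(simpl; pose proof (pos_INR (S n)); nra)).
    assert (R1 := Hr (S n) x Hx Hn).
    assert (Q1 := Hlip _ _ R1 R0).
    rewrite S_INR in Hn. specialize (IH ltac:(nra)).
    destruct (euler_step p h n x Had ltac:(lra)) as [S1 S2].
    change (euler p h 0 x) with x in *.
    set (y := euler p h (S n) x) in *. set (y0 := euler p h n x) in *.
    replace (y - x + INR (S n) * h * p x) with ((y0 - x + INR n * h * p x) + - (h * (p y - p x)))
      by (rewrite S_INR; lra).
    eapply Rle_trans; [apply Rabs_triang|].
    rewrite Rabs_Ropp, Rabs_mult, (Rabs_pos_eq h) by lra.
    assert (h * Rabs (p y - p x) <= h * (L * (INR (S n) * h * M))).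
    { apply Rmult_le_compat_l; [lra|]. eapply Rle_trans; [exact Q1|]. apply Rmult_le_compat_l; auto. }
    rewrite S_INR in *. unfold Rsqr in *. pose proof (pos_INR n).
    assert (0 <= L * M * (INR n * (h * h))) by (apply Rmult_le_pos; nra).
    nra.
Qed.

Lemma euler_lipschitz p a b T h1 al be M L h n x x' :
  stable p a b T h1 al be M L -> 0 < h <= h1 -> 0 < a -> a <= x <= b -> a <= x' <= b ->
  INR n * h <= T ->
  Rabs (euler p h n x - euler p h n x') <= Rabs (x - x') * exp (2 * L * (INR n * h)).
Proof.
  intros HS Hh Ha Hx Hx' Hn. pose proof HS as [_ [Hal [HM [HL [HE [HB Hlip]]]]]].
  destruct (HE h Hh) as [Had [Hs Hr]].
  induction n as [|n IH].
  - simpl. rewrite Rmult_0_l, Rmult_0_r, exp_0, Rmult_1_r. apply Rle_refl.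
  - assert (Q := Hlip _ _ (Hr (S n) x Hx Hn) (Hr (S n) x' Hx' Hn)).
    rewrite S_INR in Hn. specialize (IH ltac:(nra)).
    destruct (euler_step p h n x Had ltac:(lra)) as [_ S2].
    destruct (euler_step p h n x' Had ltac:(lra)) as [_ S2'].
    set (y := euler p h (S n) x) in *. set (y' := euler p h (S n) x') in *.
    assert (E : Rabs (y - y') * (1 - h * L) <= Rabs (euler p h n x - euler p h n x')).
    { rewrite <- S2, <- S2'.
      replace (y - y') with ((y + h * p y - (y' + h * p y')) + - (h * (p y - p y'))) at 1 by ring.
      assert (Rabs (y + h * p y - (y' + h * p y') + - (h * (p y - p y'))) <=
        Rabs (y + h * p y - (y' + h * p y')) + h * (L * Rabs (y - y'))).
      { eapply Rle_trans; [apply Rabs_triang|]. apply Rplus_le_compat_l.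
        rewrite Rabs_Ropp, Rabs_mult, (Rabs_pos_eq h) by lra. apply Rmult_le_compat_l; lra. }
      replace (y + h * p y - (y' + h * p y') + - (h * (p y - p y'))) with (y - y') in * by ring.
      lra. }
    assert (0 <= h * L) by (apply Rmult_le_pos; lra).
    apply inv_one_minus_le_exp in E; [|lra|apply Rabs_pos].
    eapply Rle_trans; [exact E|].
    replace (2 * L * (INR (S n) * h)) with (2 * L * (INR n * h) + 2 * (h * L)) by (rewrite S_INR; ring).
    rewrite exp_plus, <- (Rmult_assoc (Rabs (x - x'))). apply Rmult_le_compat_r; [apply Rlt_le, exp_pos|exact IH].
Qed.

(** Compares step [h] with step [H = k * h] at common times. Each block of [k] fine steps deviates
    from one coarse step by [L * M * H^2], and Gronwall accumulates these local errors. *)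
Lemma euler_refine p a b T h1 al be M L h k n x :
  stable p a b T h1 al be M L -> (1 <= k)%nat -> 0 < h -> INR k * h <= h1 -> 0 < a -> a <= x <= b ->
  INR n * (INR k * h) <= T ->
  Rabs (euler p h (n * k) x - euler p (INR k * h) n x) <=
  INR n * (L * M * (INR k * h)²) * exp (2 * L * (INR n * (INR k * h))).
Proof.
  intros HS Hk Hh Hh1 Ha Hx Hn. pose proof HS as [_ [Hal [HM [HL [HE [HB Hlip]]]]]].
  assert (HINR : 1 <= INR k) by (apply (le_INR 1); auto).
  assert (Hhk : h <= INR k * h) by nra.
  set (H := INR k * h) in *.
  destruct (HE h ltac:(lra)) as [Had [_ Hr]].
  destruct (HE H ltac:(lra)) as [Had' [Hs Hr']].
  assert (HLM : 0 <= L * M) by (apply Rmult_le_pos; auto).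
  induction n as [|n IH].
  - simpl. unfold euler. simpl. rewrite Rminus_diag, Rabs_R0. lra.
  - assert (Hnk : INR (n * k + k) * h = INR (S n) * H).
    { rewrite plus_INR, mult_INR, S_INR. unfold H. ring. }
    (* [p] is frozen at the end of the block, because the coarse implicit step also evaluates [p] at
       its end point. *)
    assert (Hblock : forall j, (j <= k)%nat ->
      Rabs (euler p h (n * k + j) x - euler p h (n * k) x + INR j * h * p (euler p h (n * k + k) x))
      <= INR j * h * (L * (H * M))).
    { intros j Hj. induction j as [|j IHj].
      - rewrite Nat.add_0_r. simpl.
        match goal with |- Rabs ?e <= _ => replace e with 0 by ring end. rewrite Rabs_R0. lra.
      - specialize (IHj ltac:(lia)).
        destruct (euler_step p h (n * k + j) x Had ltac:(lra)) as [_ S2].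
        rewrite <- Nat.add_succ_r in S2.
        assert (I1 : INR (n * k + S j) * h <= T).
        { apply Rle_trans with (INR (n * k + k) * h); [|lra].
          apply Rmult_le_compat_r; [lra|]. apply le_INR. lia. }
        assert (R1 := Hr (n * k + S j)%nat x Hx I1).
        assert (R2 := Hr (n * k + k)%nat x Hx ltac:(lra)).
        assert (Q := euler_lipschitz_time p a b T h1 al be M L h (n * k + S j) (k - S j) x HS
          ltac:(lra) Hx ltac:(lra)).
        replace (n * k + S j + (k - S j))%nat with (n * k + k)%nat in Q by lia.
        assert (Q' := Hlip _ _ R1 R2).
        set (y := euler p h (n * k + S j) x) in *. set (w := euler p h (n * k + k) x) in *.
        assert (I2 : INR (k - S j) * h * M <= H * M).
        { apply Rmult_le_compat_r; auto. apply Rmult_le_compat_r; [lra|]. apply le_INR; lia. }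
        rewrite Rabs_minus_sym in Q.
        assert (Q2 : h * Rabs (p y - p w) <= h * (L * (H * M))).
        { apply Rmult_le_compat_l; [lra|]. eapply Rle_trans; [exact Q'|].
          apply Rmult_le_compat_l; lra. }
        replace (y - euler p h (n * k) x + INR (S j) * h * p w) with
          ((euler p h (n * k + j) x - euler p h (n * k) x + INR j * h * p w) + - (h * (p y - p w)))
          by (rewrite S_INR; lra).
        eapply Rle_trans; [apply Rabs_triang|].
        rewrite Rabs_Ropp, Rabs_mult, (Rabs_pos_eq h), S_INR by lra. lra. }
    specialize (Hblock k (le_n k)). fold H in Hblock.
    assert (R1 := Hr (n * k + k)%nat x Hx ltac:(lra)).
    assert (R2 := Hr' (S n) x Hx Hn).
    assert (Q' := Hlip _ _ R1 R2).
    destruct (euler_step p H n x Had' ltac:(lra)) as [_ S2].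
    rewrite S_INR in Hn. specialize (IH ltac:(nra)).
    replace (S n * k)%nat with (n * k + k)%nat by lia.
    set (w := euler p h (n * k + k) x) in *. set (y := euler p H (S n) x) in *.
    set (D := Rabs (w - y)) in *.
    assert (E : D * (1 - H * L) <= Rabs (euler p h (n * k) x - euler p H n x) + L * M * H²).
    { unfold D in *.
      replace (w - y) with ((w - euler p h (n * k) x + H * p w) +
        ((euler p h (n * k) x - euler p H n x) + - (H * (p w - p y)))) at 1 by lra.
      assert (H * Rabs (p w - p y) <= H * (L * Rabs (w - y))) by (apply Rmult_le_compat_l; lra).
      assert (Z := Rabs_triang (w - euler p h (n * k) x + H * p w)
        ((euler p h (n * k) x - euler p H n x) + - (H * (p w - p y)))).
      assert (Z' := Rabs_triang (euler p h (n * k) x - euler p H n x) (- (H * (p w - p y)))).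
      rewrite (Rabs_Ropp (H * _)), (Rabs_mult H), (Rabs_pos_eq H) in Z' by lra.
      replace (w - euler p h (n * k) x + H * p w + (euler p h (n * k) x - euler p H n x + - (H * (p w - p y))))
        with (w - y) in * by lra.
      unfold Rsqr. lra. }
    assert (0 <= H * L) by (apply Rmult_le_pos; lra).
    apply inv_one_minus_le_exp in E; [|lra|apply Rabs_pos].
    eapply Rle_trans; [exact E|].
    replace (2 * L * (INR (S n) * H)) with (2 * L * (INR n * H) + 2 * (H * L)) by (rewrite S_INR; ring).
    rewrite exp_plus, <- (Rmult_assoc (INR (S n) * _)). apply Rmult_le_compat_r; [apply Rlt_le, exp_pos|].
    rewrite S_INR, Rmult_plus_distr_r, Rmult_plus_distr_r.
    apply Rplus_le_compat; [exact IH|]. rewrite Rmult_1_l.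
    assert (0 <= L * M * H²) by (apply Rmult_le_pos; [auto|apply Rle_0_sqr]).
    assert (1 <= exp (2 * L * (INR n * H))).
    { assert (0 <= 2 * L * (INR n * H)).
      { apply Rmult_le_pos; [lra|]. apply Rmult_le_pos; [apply pos_INR|lra]. }
      pose proof (exp_ineq1_le (2 * L * (INR n * H))). lra. }
    nra.
Qed.

(** * Limit along dyadic meshes *)

Definition mesh (M : nat) : R := / 2 ^ M.

Lemma mesh_pos M : 0 < mesh M.
Proof. apply Rinv_0_lt_compat, pow_lt. lra. Qed.

Lemma mesh_small e : 0 < e -> exists N, forall M, (N <= M)%nat -> mesh M < e.
Proof.
  intros He. destruct (pow_lt_1_zero (/ 2)) with (y := e) as [N HN]; auto.
  { rewrite Rabs_pos_eq; lra. }
  exists N. intros M HM. specialize (HN M HM). unfold mesh. rewrite <- pow_inv.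
  apply Rabs_def2 in HN. lra.
Qed.

Lemma mesh_add M k : INR (2 ^ k) * mesh (M + k) = mesh M.
Proof.
  unfold mesh. rewrite pow_INR, pow_add. change (INR 2) with 2. field.
  split; apply pow_nonzero; lra.
Qed.

Definition steps (t : R) (M : nat) : nat := floor_nat (t * 2 ^ M).

Lemma steps_spec t M : 0 <= t ->
  INR (steps t M) * mesh M <= t < INR (steps t M) * mesh M + mesh M.
Proof.
  intros Ht. assert (H2 : 0 < 2 ^ M) by (apply pow_lt; lra).
  destruct (floor_nat_spec (t * 2 ^ M)) as [A B]. { apply Rmult_le_pos; lra. }
  fold (steps t M) in A, B.
  assert (Hm := mesh_pos M).
  assert (E : t = t * 2 ^ M * mesh M) by (unfold mesh; field; lra).
  split.
  - rewrite E at 2. apply Rmult_le_compat_r; lra.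
  - rewrite E at 1. assert (t * 2 ^ M * mesh M < (INR (steps t M) + 1) * mesh M)
      by (apply Rmult_lt_compat_r; lra). lra.
Qed.

(** Dyadic meshes are nested, so [euler_refine] compares any two levels; the time [t] is rounded
    down to the grid. *)
Definition dyadic_flow (p : R -> R) (t x : R) (M : nat) : R := euler p (mesh M) (steps t M) x.

Definition flow (p : R -> R) (t x : R) : R := real (Lim_seq (dyadic_flow p t x)).

Lemma steps_refine t M k : 0 <= t ->
  (steps t M * 2 ^ k <= steps t (M + k) <= steps t M * 2 ^ k + 2 ^ k)%nat.
Proof.
  intros Ht. destruct (steps_spec t M Ht) as [A B]. destruct (steps_spec t (M + k) Ht) as [A' B'].
  assert (Hm := mesh_pos (M + k)). rewrite <- (mesh_add M k) in A, B.
  split.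
  - cut (steps t M * 2 ^ k < steps t (M + k) + 1)%nat; [lia|].
    apply INR_lt. rewrite plus_INR, mult_INR. simpl (INR 1).
    apply Rmult_lt_reg_r with (mesh (M + k)); lra.
  - apply INR_le. rewrite plus_INR, mult_INR.
    apply Rmult_le_reg_r with (mesh (M + k)); lra.
Qed.

(** Levels [M] and [M + k] differ by the rounding of [t], at most [2 ^ k] fine steps of total length
    [mesh M], and by the refinement error. These are the two terms of [K], and both are of order
    [mesh M]. *)
Lemma flow_is_lim p t x : alternating p -> nonpos_at_0 p -> 0 <= t -> 0 < x ->
  is_lim_seq (dyadic_flow p t x) (flow p t x).
Proof.
  intros Hp H0 Ht Hx.
  destruct (stable_exists p x x t Hp H0 ltac:(lra) Ht) as [h1 [al [be [MM [L HS]]]]].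
  pose proof HS as [Hh1 [Hal [HM [HL _]]]].
  set (K := MM + t * (L * MM) * exp (2 * L * t)).
  assert (HLM : 0 <= L * MM) by (apply Rmult_le_pos; auto).
  assert (HK : 0 <= K).
  { unfold K. assert (0 <= t * (L * MM) * exp (2 * L * t)); [|lra].
    apply Rmult_le_pos; [apply Rmult_le_pos; lra|apply Rlt_le, exp_pos]. }
  assert (HC : forall M k, mesh M <= h1 ->
    Rabs (dyadic_flow p t x (M + k) - dyadic_flow p t x M) <= K * mesh M).
  { intros M k Hm. unfold dyadic_flow.
    destruct (steps_refine t M k Ht) as [S1 S2].
    destruct (steps_spec t M Ht) as [A B]. destruct (steps_spec t (M + k) Ht) as [A' B'].
    assert (Hm' := mesh_pos (M + k)).
    assert (Hk : (1 <= 2 ^ k)%nat) by (apply Nat.neq_0_lt_0, Nat.pow_nonzero; lia).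
    assert (HI : 1 <= INR (2 ^ k)) by (apply (le_INR 1); auto).
    assert (Q := mesh_add M k).
    assert (Hmm : mesh (M + k) <= mesh M) by nra.
    set (n := steps t M) in *. set (n' := steps t (M + k)) in *.
    assert (E1 := euler_lipschitz_time p x x t h1 al be MM L (mesh (M + k)) (n * 2 ^ k)
      (n' - n * 2 ^ k) x HS ltac:(lra) ltac:(lra) Hx).
    replace (n * 2 ^ k + (n' - n * 2 ^ k))%nat with n' in E1 by lia.
    specialize (E1 A').
    assert (E2 := euler_refine p x x t h1 al be MM L (mesh (M + k)) (2 ^ k) n x HS Hk Hm'
      ltac:(lra) Hx ltac:(lra)).
    rewrite Q in E2. specialize (E2 A).
    replace (euler p (mesh (M + k)) n' x - euler p (mesh M) n x) with
      ((euler p (mesh (M + k)) n' x - euler p (mesh (M + k)) (n * 2 ^ k) x) +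
       (euler p (mesh (M + k)) (n * 2 ^ k) x - euler p (mesh M) n x)) by ring.
    eapply Rle_trans; [apply Rabs_triang|].
    unfold K. rewrite Rmult_plus_distr_r. apply Rplus_le_compat.
    - eapply Rle_trans; [exact E1|]. rewrite (Rmult_comm MM). apply Rmult_le_compat_r; auto.
      rewrite <- Q. apply Rmult_le_compat_r; [lra|]. apply le_INR. lia.
    - eapply Rle_trans; [exact E2|].
      replace (INR n * (L * MM * (mesh M)²)) with ((INR n * mesh M) * (L * MM) * mesh M)
        by (unfold Rsqr; ring).
      replace (t * (L * MM) * exp (2 * L * t) * mesh M) with
        (t * (L * MM) * mesh M * exp (2 * L * t)) by ring.
      apply Rmult_le_compat.
      + repeat apply Rmult_le_pos; auto; try lra. apply pos_INR.
      + apply Rlt_le, exp_pos.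
      + apply Rmult_le_compat_r; [lra|]. apply Rmult_le_compat_r; lra.
      + apply exp_le_exp. apply Rmult_le_compat_l; lra. }
  apply Lim_seq_correct'. apply ex_lim_seq_cauchy_corr. intros eps.
  assert (He : 0 < Rmin h1 (eps / (2 * (K + 1)))).
  { apply Rmin_pos; auto. apply Rdiv_lt_0_compat; [apply cond_pos|lra]. }
  destruct (mesh_small _ He) as [N HN]. exists N. intros n m Hn Hm.
  assert (HN' := HN N (le_n N)).
  assert (H1 : mesh N <= h1) by (pose proof (Rmin_l h1 (eps / (2 * (K + 1)))); lra).
  assert (H2 : K * mesh N < eps / 2).
  { apply Rle_lt_trans with ((K + 1) * mesh N).
    - pose proof (mesh_pos N). nra.
    - apply Rlt_le_trans with ((K + 1) * (eps / (2 * (K + 1)))).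
      + apply Rmult_lt_compat_l; [lra|]. pose proof (Rmin_r h1 (eps / (2 * (K + 1)))). lra.
      + right. field. lra. }
  assert (Q1 := HC N (n - N)%nat H1). assert (Q2 := HC N (m - N)%nat H1).
  replace (N + (n - N))%nat with n in Q1 by lia. replace (N + (m - N))%nat with m in Q2 by lia.
  rewrite Rabs_minus_sym in Q2.
  replace (dyadic_flow p t x n - dyadic_flow p t x m) with
    ((dyadic_flow p t x n - dyadic_flow p t x N) + (dyadic_flow p t x N - dyadic_flow p t x m)) by ring.
  eapply Rle_lt_trans; [apply Rabs_triang|]. lra.
Qed.

Lemma flow_approx p t x e : alternating p -> nonpos_at_0 p -> 0 <= t -> 0 < x -> 0 < e ->
  exists N, forall M, (N <= M)%nat -> Rabs (dyadic_flow p t x M - flow p t x) < e.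
Proof.
  intros Hp H0 Ht Hx He.
  assert (H := flow_is_lim p t x Hp H0 Ht Hx). apply is_lim_seq_spec in H.
  exact (H (mkposreal e He)).
Qed.

Lemma flow_bounds p a b T h1 al be MM L t x :
  alternating p -> nonpos_at_0 p -> 0 < a -> stable p a b T h1 al be MM L ->
  0 <= t <= T -> a <= x <= b -> al <= flow p t x <= be.
Proof.
  intros Hp H0 Ha HS Ht Hx. pose proof HS as [Hh1 [_ [_ [_ [HE _]]]]].
  destruct (mesh_small h1 Hh1) as [N HN].
  assert (HB : forall M, (N <= M)%nat -> al <= dyadic_flow p t x M <= be).
  { intros M HM. destruct (HE (mesh M)) as [_ [_ Hr]]. { split; [apply mesh_pos|]. left. auto. }
    apply Hr; auto. destruct (steps_spec t M) as [A _]; lra. }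
  assert (HL := flow_is_lim p t x Hp H0 ltac:(lra) ltac:(lra)).
  split.
  - apply (is_lim_seq_le_loc (fun _ => al) (dyadic_flow p t x) al (flow p t x)); auto.
    + exists N. intros M HM. apply HB, HM.
    + apply is_lim_seq_const.
  - apply (is_lim_seq_le_loc (dyadic_flow p t x) (fun _ => be) (flow p t x) be); auto.
    + exists N. intros M HM. apply HB, HM.
    + apply is_lim_seq_const.
Qed.

Lemma flow_0 p x : flow p 0 x = x.
Proof.
  unfold flow. rewrite (Lim_seq_ext _ (fun _ => x)).
  - now rewrite Lim_seq_const.
  - intros M. unfold dyadic_flow, steps. rewrite Rmult_0_l.
    assert (floor_nat 0 = 0%nat) as ->; [|reflexivity].
    destruct (floor_nat_spec 0 (Rle_refl 0)) as [A _].
    apply INR_eq. pose proof (pos_INR (floor_nat 0)). simpl. lra.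
Qed.

Lemma flow_pos p t x : alternating p -> nonpos_at_0 p -> 0 <= t -> 0 < x -> 0 < flow p t x.
Proof.
  intros Hp H0 Ht Hx.
  destruct (stable_exists p x x t Hp H0 ltac:(lra) Ht) as [h1 [al [be [MM [L HS]]]]].
  pose proof HS as [_ [Hal _]].
  assert (H := flow_bounds p x x t h1 al be MM L t x Hp H0 Hx HS ltac:(lra) ltac:(lra)). lra.
Qed.

(** Discrete orbits compose exactly, and the rounded step counts for [s], [t] and [s + t] disagree
    by at most one step. Replacing the inner discrete value by its limit costs a Lipschitz
    factor. *)
Lemma flow_add p s t x : alternating p -> nonpos_at_0 p -> 0 <= s -> 0 <= t -> 0 < x ->
  flow p s (flow p t x) = flow p (s + t) x.
Proof.
  intros Hp H0 Hs Ht Hx.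
  destruct (stable_exists p x x (s + t) Hp H0 ltac:(lra) ltac:(lra)) as [h1 [al [be [MM [L HS]]]]].
  pose proof HS as [Hh1 [Hal [HM [HL [HE _]]]]].
  assert (Hf := flow_bounds p x x (s + t) h1 al be MM L t x Hp H0 Hx HS ltac:(lra) ltac:(lra)).
  (* Starting from the range [[al, be]] of the first orbits, this covers the inner limit together
     with its approximations. *)
  destruct (stable_exists p al be s Hp H0 ltac:(lra) Hs) as [h2 [al2 [be2 [M2 [L2 HS2]]]]].
  pose proof HS2 as [Hh2 [_ [_ [HL2 _]]]].
  assert (Hfp : 0 < flow p t x) by lra.
  set (E := exp (2 * L2 * s)). assert (HEp : 0 < E) by apply exp_pos.
  apply Rminus_diag_uniq. apply cond_eq. rewrite Rminus_0_r.
  intros e He.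
  assert (He1 : 0 < e / (4 * E)) by (apply Rdiv_lt_0_compat; lra).
  assert (He2 : 0 < Rmin h1 (Rmin h2 (e / (4 * (MM + 1))))).
  { repeat apply Rmin_pos; auto. apply Rdiv_lt_0_compat; lra. }
  destruct (flow_approx p t x _ Hp H0 Ht Hx He1) as [N1 HN1].
  destruct (flow_approx p s (flow p t x) (e / 4) Hp H0 Hs Hfp ltac:(lra)) as [N2 HN2].
  destruct (flow_approx p (s + t) x (e / 4) Hp H0 ltac:(lra) Hx ltac:(lra)) as [N3 HN3].
  destruct (mesh_small _ He2) as [N4 HN4].
  set (M := (N1 + N2 + N3 + N4)%nat).
  specialize (HN1 M ltac:(lia)). specialize (HN2 M ltac:(lia)). specialize (HN3 M ltac:(lia)).
  specialize (HN4 M ltac:(lia)).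
  assert (Hm1 : mesh M < h1) by rmin_lt HN4.
  assert (Hm2 : mesh M < h2) by rmin_lt HN4.
  assert (Hm3 : mesh M < e / (4 * (MM + 1))) by rmin_lt HN4.
  destruct (steps_spec s M Hs) as [A1 B1]. destruct (steps_spec t M Ht) as [A2 B2].
  destruct (steps_spec (s + t) M ltac:(lra)) as [A3 B3].
  destruct (HE (mesh M) ltac:(lra)) as [_ [_ Hr]].
  unfold dyadic_flow in *.
  set (ns := steps s M) in *. set (nt := steps t M) in *. set (nst := steps (s + t) M) in *.
  assert (Hrt := Hr nt x ltac:(lra) ltac:(lra)).
  assert (Hst := euler_lipschitz p al be s h2 al2 be2 M2 L2 (mesh M) ns (euler p (mesh M) nt x)
     (flow p t x) HS2 ltac:(lra) Hal Hrt Hf A1).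
  rewrite <- euler_add in Hst.
  assert (Hst' : Rabs (euler p (mesh M) (ns + nt) x - euler p (mesh M) ns (flow p t x)) < e / 4).
  { eapply Rle_lt_trans; [exact Hst|]. apply Rle_lt_trans with (Rabs (euler p (mesh M) nt x - flow p t x) * E).
    - apply Rmult_le_compat_l; [apply Rabs_pos|]. apply exp_le_exp. apply Rmult_le_compat_l; lra.
    - apply Rlt_le_trans with (e / (4 * E) * E); [apply Rmult_lt_compat_r; auto|]. right. field. lra. }
  assert (Hn1 : (ns + nt <= nst)%nat).
  { cut (ns + nt < nst + 1)%nat; [lia|]. apply INR_lt. rewrite !plus_INR. simpl (INR 1).
    apply Rmult_lt_reg_r with (mesh M); lra. }
  assert (Hn2 : (nst - (ns + nt) <= 1)%nat).
  { cut (nst < ns + nt + 2)%nat; [lia|]. apply INR_lt. rewrite !plus_INR. simpl (INR 2).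
    apply Rmult_lt_reg_r with (mesh M); lra. }
  assert (Hl := euler_lipschitz_time p x x (s + t) h1 al be MM L (mesh M) (ns + nt) (nst - (ns + nt)) x HS
    ltac:(lra) ltac:(lra) Hx).
  replace (ns + nt + (nst - (ns + nt)))%nat with nst in Hl by lia. specialize (Hl A3).
  assert (Hl' : Rabs (euler p (mesh M) nst x - euler p (mesh M) (ns + nt) x) < e / 4).
  { eapply Rle_lt_trans; [exact Hl|]. apply Rle_lt_trans with (1 * mesh M * (MM + 1)).
    - apply Rmult_le_compat; try lra.
      + apply Rmult_le_pos; [apply pos_INR|lra].
      + apply Rmult_le_compat_r; [lra|]. apply (le_INR _ 1); auto.
    - apply Rlt_le_trans with (e / (4 * (MM + 1)) * (MM + 1)); [|right; field; lra].
      rewrite Rmult_1_l. apply Rmult_lt_compat_r; lra. }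
  apply Rabs_def2 in HN2, HN3, Hst', Hl'. apply Rabs_def1; lra.
Qed.

(** [euler_consistency] in the limit: it identifies the generator of the flow as [p], with an error
    linear in [t] for the difference quotient. *)
Lemma flow_tangent p x : alternating p -> nonpos_at_0 p -> 0 < x ->
  exists K, 0 <= K /\ forall t, 0 <= t <= 1 -> Rabs (flow p t x - x + t * p x) <= K * t².
Proof.
  intros Hp H0 Hx.
  destruct (stable_exists p x x 1 Hp H0 ltac:(lra) ltac:(lra)) as [h1 [al [be [MM [L HS]]]]].
  pose proof HS as [Hh1 [_ [HM [HL [HE _]]]]].
  exists (L * MM). split; [apply Rmult_le_pos; auto|].
  intros t Ht. apply Rle_plus_epsilon. intros e He.
  assert (HP := Rabs_pos (p x)).
  assert (He2 : 0 < Rmin h1 (e / (2 * (Rabs (p x) + 1)))).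
  { apply Rmin_pos; auto. apply Rdiv_lt_0_compat; lra. }
  destruct (mesh_small _ He2) as [N1 HN1].
  destruct (flow_approx p t x (e / 2) Hp H0 ltac:(lra) Hx ltac:(lra)) as [N2 HN2].
  set (M := (N1 + N2)%nat). specialize (HN1 M ltac:(lia)). specialize (HN2 M ltac:(lia)).
  assert (Hm1 : mesh M < h1) by rmin_lt HN1.
  assert (Hm2 : mesh M < e / (2 * (Rabs (p x) + 1))) by rmin_lt HN1.
  destruct (steps_spec t M ltac:(lra)) as [A B]. unfold dyadic_flow in *. set (n := steps t M) in *.
  assert (Q := euler_consistency p x x 1 h1 al be MM L (mesh M) n x HS ltac:(lra) ltac:(lra) Hx ltac:(lra)).
  assert (Hq : (INR n * mesh M)² <= t²).
  { apply Rsqr_incr_1; try lra. apply Rmult_le_pos; [apply pos_INR|lra]. }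
  assert (HLM : 0 <= L * MM) by (apply Rmult_le_pos; auto).
  assert (Hq' : L * MM * (INR n * mesh M)² <= L * MM * t²) by (apply Rmult_le_compat_l; auto).
  assert (Hd : Rabs ((t - INR n * mesh M) * p x) <= e / 2).
  { rewrite Rabs_mult, Rabs_pos_eq by lra.
    apply Rle_trans with (mesh M * (Rabs (p x) + 1)).
    - apply Rmult_le_compat; lra.
    - apply Rle_trans with (e / (2 * (Rabs (p x) + 1)) * (Rabs (p x) + 1)).
      + apply Rmult_le_compat_r; lra.
      + right. field. lra. }
  apply Rabs_le_between in Q, Hd. apply Rabs_def2 in HN2. apply Rabs_le. lra.
Qed.

(** [alternating_limit] applied to the negatives provides signs from order 2 on and convergence of
    all derivatives; that convergence then carries over the sign at order 1. *)
Lemma flow_bernstein p t : alternating p -> nonpos_at_0 p -> 0 <= t ->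
  alternating (fun x => - flow p t x) /\ smooth (flow p t) /\
  forall n x, (1 <= n)%nat -> 0 < x -> 0 <= (-1) ^ (n + 1) * Derive_n (flow p t) n x.
Proof.
  intros Hp H0 Ht.
  set (h1 := / (2 * (Rabs (Derive p 1) + 1))).
  assert (HD := Rabs_pos (Derive p 1)).
  assert (Hh1 : 0 < h1) by (apply Rinv_0_lt_compat; lra).
  destruct (mesh_small h1 Hh1) as [N HN].
  assert (HB : forall M, (N <= M)%nat -> pos_bernstein (fun x => dyadic_flow p t x M)).
  { intros M HM. apply euler_pos_bernstein. split; [auto|split; [auto|split; [apply mesh_pos|]]].
    apply Rle_trans with (h1 * (Rabs (Derive p 1) + 1)).
    - apply Rmult_le_compat; try lra. left. apply mesh_pos. left. auto.
    - right. unfold h1. field. lra. }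
  destruct (alternating_limit eventually (fun M x => - dyadic_flow p t x M) (fun x => - flow p t x))
    as [HA HL].
  { exists N. intros M HM. destruct (pos_bernstein_derive_n _ (HB M HM)) as [H1 H2].
    exact (Bernstein_alternating _ H1 H2). }
  { intros x Hx. apply (is_lim_seq_opp (dyadic_flow p t x) (flow p t x)).
    apply flow_is_lim; auto. }
  assert (HS : smooth (flow p t)).
  { intros n x Hx. apply ex_derive_n_ext with (fun x => - - flow p t x).
    { intros y. apply Ropp_involutive. }
    apply ex_derive_n_opp, HA, Hx. }
  split; [exact HA|split; [exact HS|]].
  intros n x Hn Hx. specialize (HL n x Hx).
  rewrite Derive_n_opp in HL.
  assert (HL' : is_lim_seq (fun M => (-1) ^ (n + 1) * Derive_n (fun x => dyadic_flow p t x M) n x)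
     ((-1) ^ (n + 1) * Derive_n (flow p t) n x)).
  { apply is_lim_seq_ext with (fun M => (-1) ^ n * Derive_n (fun x => - dyadic_flow p t x M) n x).
    { intros M. rewrite Derive_n_opp, pow_add. simpl. ring. }
    replace ((-1) ^ (n + 1) * Derive_n (flow p t) n x) with ((-1) ^ n * - Derive_n (flow p t) n x)
      by (rewrite pow_add; simpl; ring).
    apply (is_lim_seq_scal_l _ _ (- Derive_n (flow p t) n x)). exact HL. }
  apply (is_lim_seq_le_loc (fun _ => 0) _ 0 _ ) with (3 := HL').
  - exists N. intros M HM. apply (pos_bernstein_derive_n _ (HB M HM)); auto.
  - apply is_lim_seq_const.
Qed.

(** * Complex-valued functions of a real variable *)

Local Notation is_Cderive := (@is_derive C_AbsRing C_NormedModule) (only parsing).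
Local Notation ex_Cderive := (@ex_derive C_AbsRing C_NormedModule) (only parsing).
Local Notation is_RCderive := (@is_derive R_AbsRing C_R_NormedModule) (only parsing).

(** Integrals and derivatives in a real parameter use the real normed structure on [C], holomorphy
    the complex one; every estimate is brought to [Cmod]. *)
Lemma norm_C_R (z : C) : norm (z : C_R_NormedModule) = Cmod z.
Proof.
  destruct z as [x y]. unfold Cmod. simpl.
  change (sqrt (Rabs x ^ 2 + Rabs y ^ 2) = sqrt (x ^ 2 + y ^ 2)).
  now rewrite !pow2_abs.
Qed.

Lemma is_derive_C_spec (f : C -> C) (z l : C) :
  is_Cderive f z l <->
  forall eps, 0 < eps -> exists delta, 0 < delta /\ forall w, Cmod (w - z) < delta ->
    Cmod (f w - f z - (w - z) * l)%C <= eps * Cmod (w - z).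
Proof.
  split.
  - intros [_ H] eps He.
    destruct (H z (fun P HP => HP) (mkposreal eps He)) as [d Hd].
    exists d. split; [apply cond_pos|]. intros w Hw. exact (Hd w Hw).
  - intros H. split; [apply @is_linear_scal_l|].
    intros x Hx. rewrite <- (is_filter_lim_locally_unique _ _ Hx).
    intros eps. destruct (H eps (cond_pos eps)) as [d [Hd Hd']].
    exists (mkposreal d Hd). intros w Hw. exact (Hd' w Hw).
Qed.

Lemma is_derive_RC_spec (g : R -> C) (t : R) (l : C) :
  is_RCderive g t l <->
  forall eps, 0 < eps -> exists delta, 0 < delta /\ forall u, Rabs (u - t) < delta ->
    Cmod (g u - g t - RtoC (u - t) * l)%C <= eps * Rabs (u - t).
Proof.
  assert (E : forall u, minus (minus (g u : C_R_NormedModule) (g t)) (scal (minus u t) (l : C_R_NormedModule)) =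
    (g u - g t - RtoC (u - t) * l)%C).
  { intros u. destruct (g u), (g t), l. apply injective_projections; simpl;
    unfold minus, plus, opp, scal; simpl; unfold mult; simpl; ring. }
  split.
  - intros [_ H] eps He.
    destruct (H t (fun P HP => HP) (mkposreal eps He)) as [d Hd].
    exists d. split; [apply cond_pos|]. intros u Hu. specialize (Hd u Hu). simpl in Hd.
    rewrite E, norm_C_R in Hd. exact Hd.
  - intros H. split; [apply @is_linear_scal_l|].
    intros x Hx. rewrite <- (is_filter_lim_locally_unique _ _ Hx).
    intros eps. destruct (H eps (cond_pos eps)) as [d [Hd Hd']].
    exists (mkposreal d Hd). intros u Hu. rewrite E, norm_C_R. exact (Hd' u Hu).
Qed.

Lemma continuous_RC_spec (g : R -> C) (t : R) :
  continuous (g : R -> C_R_NormedModule) t <->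
  forall eps, 0 < eps -> exists delta, 0 < delta /\ forall u, Rabs (u - t) < delta ->
    Cmod (g u - g t)%C < eps.
Proof.
  split.
  - intros H eps He.
    destruct (proj1 (@filterlim_locally_ball_norm R_AbsRing R C_R_NormedModule _ _ g (g t)) H (mkposreal eps He)) as [d Hd].
    exists d. split; [apply cond_pos|]. intros u Hu. specialize (Hd u Hu).
    unfold ball_norm in Hd. rewrite norm_C_R in Hd. exact Hd.
  - intros H. apply (proj2 (@filterlim_locally_ball_norm R_AbsRing R C_R_NormedModule _ _ g (g t))). intros eps.
    destruct (H eps (cond_pos eps)) as [d [Hd Hd']].
    exists (mkposreal d Hd). intros u Hu. unfold ball_norm. rewrite norm_C_R. exact (Hd' u Hu).
Qed.

Lemma is_derive_C_bound (f : C -> C) (z l : C) :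
  is_Cderive f z l ->
  exists delta, 0 < delta /\ forall w, Cmod (w - z) < delta ->
    Cmod (f w - f z)%C <= (Cmod l + 1) * Cmod (w - z).
Proof.
  intros H. destruct (proj1 (is_derive_C_spec f z l) H 1 Rlt_0_1) as [d [Hd Hd']].
  exists d. split; auto. intros w Hw. specialize (Hd' w Hw).
  replace (f w - f z)%C with ((f w - f z - (w - z) * l) + (w - z) * l)%C by ring.
  eapply Rle_trans; [apply Cmod_triangle|]. rewrite Cmod_mult. lra.
Qed.

Lemma continuous_C_comp (f : C -> C) (g : R -> C) (t : R) :
  ex_Cderive f (g t) ->
  continuous (g : R -> C_R_NormedModule) t ->
  continuous ((fun u => f (g u)) : R -> C_R_NormedModule) t.
Proof.
  intros [l Hl] Hg. apply continuous_RC_spec. intros eps He.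
  destruct (is_derive_C_bound f (g t) l Hl) as [d [Hd Hd']].
  assert (Hl0 := Cmod_ge_0 l).
  destruct (proj1 (continuous_RC_spec g t) Hg (Rmin d (eps / (Cmod l + 1)))) as [d2 [Hd2 H2]].
  { apply Rmin_pos; auto. apply Rdiv_lt_0_compat; lra. }
  exists d2. split; auto. intros u Hu. specialize (H2 u Hu).
  assert (H3 : Cmod (g u - g t) < d) by rmin_lt H2.
  assert (H4 : Cmod (g u - g t) < eps / (Cmod l + 1)) by rmin_lt H2.
  eapply Rle_lt_trans; [apply Hd'; exact H3|].
  replace eps with ((Cmod l + 1) * (eps / (Cmod l + 1))) by (field; lra).
  apply Rmult_lt_compat_l; lra.
Qed.

Lemma is_derive_C_comp (f : C -> C) (g : R -> C) (t : R) (l m : C) :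
  is_Cderive f (g t) l ->
  is_RCderive g t m ->
  is_RCderive (fun u => f (g u)) t (l * m)%C.
Proof.
  intros Hf Hg. apply is_derive_RC_spec. intros eps He.
  assert (Hl := Cmod_ge_0 l). assert (Hm := Cmod_ge_0 m).
  set (e1 := eps / (2 * (Cmod m + 1))).
  assert (He1 : 0 < e1) by (apply Rdiv_lt_0_compat; lra).
  set (e2 := Rmin 1 (eps / (2 * (Cmod l + 1)))).
  assert (He2 : 0 < e2). { apply Rmin_pos; [lra|]. apply Rdiv_lt_0_compat; lra. }
  destruct (proj1 (is_derive_C_spec f (g t) l) Hf e1 He1) as [d1 [Hd1 H1]].
  destruct (proj1 (is_derive_RC_spec g t m) Hg e2 He2) as [d2 [Hd2 H2]].
  exists (Rmin d2 (d1 / (Cmod m + 1))). split.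
  { apply Rmin_pos; auto. apply Rdiv_lt_0_compat; lra. }
  intros u Hu.
  assert (Hu2 : Rabs (u - t) < d2) by rmin_lt Hu.
  assert (Hu1 : Rabs (u - t) < d1 / (Cmod m + 1)) by rmin_lt Hu.
  specialize (H2 u Hu2).
  assert (E2 : e2 <= 1) by apply Rmin_l.
  assert (E3 : e2 <= eps / (2 * (Cmod l + 1))) by apply Rmin_r.
  assert (Hru := Rabs_pos (u - t)).
  assert (HG : Cmod (g u - g t) <= (Cmod m + 1) * Rabs (u - t)).
  { replace (g u - g t)%C with ((g u - g t - RtoC (u - t) * m) + RtoC (u - t) * m)%C by ring.
    eapply Rle_trans; [apply Cmod_triangle|]. rewrite Cmod_mult, Cmod_R. nra. }
  assert (HG1 : Cmod (g u - g t) < d1).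
  { eapply Rle_lt_trans; [exact HG|].
    replace d1 with ((Cmod m + 1) * (d1 / (Cmod m + 1))) by (field; lra).
    apply Rmult_lt_compat_l; lra. }
  specialize (H1 (g u) HG1).
  replace (f (g u) - f (g t) - RtoC (u - t) * (l * m))%C with
    ((f (g u) - f (g t) - (g u - g t) * l) + l * (g u - g t - RtoC (u - t) * m))%C by ring.
  eapply Rle_trans; [apply Cmod_triangle|]. rewrite Cmod_mult.
  assert (A1 : e1 * Cmod (g u - g t) <= eps / 2 * Rabs (u - t)).
  { apply Rle_trans with (e1 * ((Cmod m + 1) * Rabs (u - t))).
    - apply Rmult_le_compat_l; lra.
    - right. unfold e1. field. lra. }
  assert (A2 : Cmod l * (e2 * Rabs (u - t)) <= eps / 2 * Rabs (u - t)).
  { rewrite <- Rmult_assoc. apply Rmult_le_compat_r; auto.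
    apply Rle_trans with ((Cmod l + 1) * (eps / (2 * (Cmod l + 1)))).
    - apply Rmult_le_compat; lra.
    - right. field. lra. }
  assert (Cmod l * Cmod (g u - g t - RtoC (u - t) * m) <= Cmod l * (e2 * Rabs (u - t)))
    by (apply Rmult_le_compat_l; auto).
  lra.
Qed.

Lemma continuous_RC_pair (u v : R -> R) (t : R) :
  continuous u t -> continuous v t -> continuous ((fun s => (u s, v s)) : R -> C_R_NormedModule) t.
Proof.
  intros Hu Hv. apply filterlim_locally. intros eps.
  assert (Bu : locally t (fun s => ball (u t) eps (u s))) by exact (Hu _ (locally_ball (u t) eps)).
  assert (Bv : locally t (fun s => ball (v t) eps (v s))) by exact (Hv _ (locally_ball (v t) eps)).
  exact (filter_and _ _ Bu Bv).
Qed.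

Lemma continuous_C_mult (f g : R -> C) (t : R) :
  continuous (f : R -> C_R_NormedModule) t -> continuous (g : R -> C_R_NormedModule) t ->
  continuous ((fun u => f u * g u)%C : R -> C_R_NormedModule) t.
Proof.
  intros Hf Hg.
  assert (F1 := continuous_comp f fst t Hf (continuous_fst _ _)).
  assert (F2 := continuous_comp f snd t Hf (continuous_snd _ _)).
  assert (G1 := continuous_comp g fst t Hg (continuous_fst _ _)).
  assert (G2 := continuous_comp g snd t Hg (continuous_snd _ _)).
  apply continuous_RC_pair.
  - apply (continuous_minus (V := R_NormedModule) (fun u => fst (f u) * fst (g u)) (fun u => snd (f u) * snd (g u)));
      apply (continuous_mult (K := R_AbsRing)); auto.
  - apply (continuous_plus (V := R_NormedModule) (fun u => fst (f u) * snd (g u)) (fun u => snd (f u) * fst (g u)));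
      apply (continuous_mult (K := R_AbsRing)); auto.
Qed.

Definition cint (f : R -> C) (a b : R) : C := @RInt C_R_CompleteNormedModule f a b.

Definition ccont (f : R -> C) (a b : R) : Prop :=
  forall t, a <= t <= b -> continuous (f : R -> C_R_NormedModule) t.

Lemma ccont_sub f a b a' b' : ccont f a b -> a <= a' -> b' <= b -> ccont f a' b'.
Proof. intros H H1 H2 t Ht. apply H. lra. Qed.

Lemma ccont_ex f a b : a <= b -> ccont f a b -> @ex_RInt C_R_NormedModule f a b.
Proof.
  intros Hab H. apply (@ex_RInt_continuous C_R_CompleteNormedModule).
  intros t Ht. rewrite Rmin_left, Rmax_right in Ht by auto. apply H, Ht.
Qed.

Lemma cint_chasles f a b c : a <= b <= c -> ccont f a c ->
  cint f a c = (cint f a b + cint f b c)%C.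
Proof.
  intros Hab H. symmetry. apply (@RInt_Chasles C_R_CompleteNormedModule).
  - apply ccont_ex; [lra|]. apply ccont_sub with a c; auto; lra.
  - apply ccont_ex; [lra|]. apply ccont_sub with a c; auto; lra.
Qed.

Lemma cint_plus f g a b : a <= b -> ccont f a b -> ccont g a b ->
  cint (fun t => f t + g t)%C a b = (cint f a b + cint g a b)%C.
Proof.
  intros Hab Hf Hg. apply (@RInt_plus C_R_CompleteNormedModule); apply ccont_ex; auto.
Qed.

Lemma cint_minus f g a b : a <= b -> ccont f a b -> ccont g a b ->
  cint (fun t => f t - g t)%C a b = (cint f a b - cint g a b)%C.
Proof.
  intros Hab Hf Hg. apply (@RInt_minus C_R_CompleteNormedModule); apply ccont_ex; auto.
Qed.

Lemma cint_bound f a b M : a <= b -> ccont f a b ->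
  (forall t, a <= t <= b -> Cmod (f t) <= M) -> Cmod (cint f a b) <= (b - a) * M.
Proof.
  intros Hab Hf HM. rewrite <- norm_C_R.
  apply (@norm_RInt_le_const C_R_NormedModule f a b _ M Hab).
  - intros t Ht. rewrite norm_C_R. auto.
  - apply (@RInt_correct C_R_CompleteNormedModule), ccont_ex; auto.
Qed.

Lemma cint_derive (f df : R -> C) a b : a <= b ->
  (forall t, a <= t <= b -> is_RCderive f t (df t)) ->
  ccont df a b -> cint df a b = (f b - f a)%C.
Proof.
  intros Hab Hf Hd. apply (@is_RInt_unique C_R_CompleteNormedModule).
  apply (@is_RInt_derive C_R_CompleteNormedModule);
  intros t Ht; rewrite Rmin_left, Rmax_right in Ht by auto; auto.
Qed.

Lemma cint_ext f g a b : a <= b -> (forall t, a <= t <= b -> f t = g t) -> cint f a b = cint g a b.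
Proof.
  intros Hab H. apply (@RInt_ext C_R_CompleteNormedModule).
  intros t Ht. rewrite Rmin_left, Rmax_right in Ht by auto. apply H. lra.
Qed.

Lemma ccont_ext (f g : R -> C) a b : (forall t, f t = g t) -> ccont f a b -> ccont g a b.
Proof. intros H Hf t Ht. apply continuous_ext with f; auto. Qed.

Lemma ccont_minus f g a b : ccont f a b -> ccont g a b -> ccont (fun t => f t - g t)%C a b.
Proof. intros Hf Hg t Ht. apply (@continuous_minus _ _ C_R_NormedModule); auto. Qed.

Lemma ccont_plus f g a b : ccont f a b -> ccont g a b -> ccont (fun t => f t + g t)%C a b.
Proof. intros Hf Hg t Ht. apply (@continuous_plus _ _ C_R_NormedModule); auto. Qed.

Lemma ccont_mult f g a b : ccont f a b -> ccont g a b -> ccont (fun t => f t * g t)%C a b.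
Proof. intros Hf Hg t Ht. apply continuous_C_mult; auto. Qed.

Lemma ccont_const (z : C) a b : ccont (fun _ => z) a b.
Proof. intros t Ht. apply continuous_const. Qed.

(** A complex factor is not a scalar of the real module in which [cint] is taken, so real and
    imaginary parts are treated separately. *)
Lemma cint_scal (k : C) f a b : a <= b -> ccont f a b ->
  cint (fun t => k * f t)%C a b = (k * cint f a b)%C.
Proof.
  intros Hab Hf. apply (@is_RInt_unique C_R_CompleteNormedModule).
  assert (H := @RInt_correct C_R_CompleteNormedModule f a b (ccont_ex f a b Hab Hf)).
  fold (cint f a b) in H.
  assert (H1 := is_RInt_fct_extend_fst f a b (cint f a b) H).
  assert (H2 := is_RInt_fct_extend_snd f a b (cint f a b) H).
  destruct k as [k1 k2].
  apply (is_RInt_fct_extend_pair (U := R_NormedModule) (V := R_NormedModule)).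
  - refine (is_RInt_minus _ _ _ _ _ _ (is_RInt_scal _ _ _ k1 _ H1) (is_RInt_scal _ _ _ k2 _ H2)).
  - refine (is_RInt_plus _ _ _ _ _ _ (is_RInt_scal _ _ _ k1 _ H2) (is_RInt_scal _ _ _ k2 _ H1)).
Qed.

(** * Goursat's lemma and the Cauchy-Taylor theorem *)

Definition subrect (x0 y0 a b x y u v : R) : Prop :=
  0 < u /\ 0 < v /\ x0 <= x /\ x + u <= x0 + a /\ y0 <= y /\ y + v <= y0 + b.

Lemma pow_half_le a k : 0 < a -> 0 < a / 2 ^ k.
Proof. intros Ha. apply Rdiv_lt_0_compat; auto. apply pow_lt. lra. Qed.

Lemma nested_limit (x u : nat -> R) (B : R) :
  (forall n, 0 <= u n) -> (forall n, x n + u n <= B) ->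
  (forall n, x n <= x (S n)) -> (forall n, x (S n) + u (S n) <= x n + u n) ->
  exists l, forall n, x n <= l <= x n + u n.
Proof.
  intros Hu HB Hx Hxu.
  destruct (ex_finite_lim_seq_incr x B) as [l Hl]; auto.
  { intros n. specialize (Hu n). specialize (HB n). lra. }
  exists l. intros n. split; [exact (is_lim_seq_incr_compare x l Hl Hx n)|].
  apply (is_lim_seq_le_loc x (fun _ => x n + u n) l (x n + u n)); auto.
  - exists n. intros m Hm. induction Hm as [|m Hm IH].
    + specialize (Hu n). lra.
    + assert (Q : forall k, (n <= k)%nat -> x k + u k <= x n + u n).
      { intros k Hk. induction Hk; [lra|]. specialize (Hxu m0). lra. }
      specialize (Q (S m) ltac:(lia)). specialize (Hu (S m)). lra.
  - apply is_lim_seq_const.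
Qed.

(** Goursat's subdivision for an arbitrary additive function of rectangles, with corner [(x, y)] and
    sides [u], [v]. Some quarter always carries at least a quarter of the modulus; at the common
    limit point this contradicts the local bound, since [(u + v)^2] also shrinks by the factor 4. *)
Lemma quartering (I : R -> R -> R -> R -> C) (x0 y0 a b : R) :
  0 < a -> 0 < b ->
  (forall x y u v, subrect x0 y0 a b x y (2 * u) (2 * v) ->
     I x y (2 * u) (2 * v) =
     (I x y u v + I (x + u)%R y u v + (I x (y + v)%R u v + I (x + u)%R (y + v)%R u v))%C) ->
  (forall px py, x0 <= px <= x0 + a -> y0 <= py <= y0 + b -> forall eps, 0 < eps ->
     exists delta, 0 < delta /\ forall x y u v, subrect x0 y0 a b x y u v ->
       x <= px <= x + u -> y <= py <= y + v -> u < delta -> v < delta ->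
       Cmod (I x y u v) <= eps * (u + v)²) ->
  I x0 y0 a b = RtoC 0.
Proof.
  intros Ha Hb Hadd Hloc.
  apply Cmod_eq_0. apply Rle_antisym; [|apply Cmod_ge_0].
  apply Rnot_lt_le. intros Heta. set (eta := Cmod (I x0 y0 a b)) in *.
  set (u := fun k => a / 2 ^ k). set (v := fun k => b / 2 ^ k).
  assert (Hu : forall k, 0 < u k) by (intros; apply pow_half_le; auto).
  assert (Hv : forall k, 0 < v k) by (intros; apply pow_half_le; auto).
  assert (Hu2 : forall k, u k = 2 * u (S k)) by (intros; unfold u; simpl; field; apply pow_nonzero; lra).
  assert (Hv2 : forall k, v k = 2 * v (S k)) by (intros; unfold v; simpl; field; apply pow_nonzero; lra).
  set (big := fun k (q : R * R) => eta / 4 ^ k <= Cmod (I (fst q) (snd q) (u k) (v k))).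
  (* If the first three quarters are too small, the triangle inequality forces the fourth to be
     large. *)
  set (step := fun k (q : R * R) =>
    let x := fst q in let y := snd q in
    if excluded_middle_informative (big (S k) (x, y)) then (x, y) else
    if excluded_middle_informative (big (S k) (x + u (S k), y)) then (x + u (S k), y) else
    if excluded_middle_informative (big (S k) (x, y + v (S k))) then (x, y + v (S k)) else
    (x + u (S k), y + v (S k))).
  set (q := fix q k := match k with O => (x0, y0) | S k => step k (q k) end).
  set (x := fun k => fst (q k)). set (y := fun k => snd (q k)).
  assert (Hstep : forall k,
    (x (S k) = x k \/ x (S k) = x k + u (S k)) /\ (y (S k) = y k \/ y (S k) = y k + v (S k))).
  { intros k. unfold x, y. simpl. unfold step. repeat destruct excluded_middle_informative; simpl; auto. }
  assert (Hinv : forall k, subrect x0 y0 a b (x k) (y k) (u k) (v k) /\ big k (q k)).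
  { induction k as [|k [IH1 IH2]].
    - unfold subrect, big, x, y, u, v. simpl. unfold Rdiv. rewrite Rinv_1, !Rmult_1_r.
      repeat split; try lra. fold eta. lra.
    - split.
      + destruct (Hstep k) as [Hx Hy]. destruct IH1 as [A1 [A2 [A3 [A4 [A5 A6]]]]].
        rewrite (Hu2 k) in *. rewrite (Hv2 k) in *.
        destruct Hx as [-> | ->], Hy as [-> | ->]; unfold subrect; lra.
      + simpl. unfold step. fold (x k). fold (y k).
        destruct excluded_middle_informative as [|N1]; auto.
        destruct excluded_middle_informative as [|N2]; auto.
        destruct excluded_middle_informative as [|N3]; auto.
        unfold big in *. simpl fst in *. simpl snd in *. fold (x k) (y k) in IH2.
        apply Rnot_le_lt in N1, N2, N3.
        rewrite (Hu2 k), (Hv2 k) in IH2, IH1. rewrite Hadd in IH2 by exact IH1.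
        set (i1 := I (x k) (y k) (u (S k)) (v (S k))) in *.
        set (i2 := I (x k + u (S k))%R (y k) (u (S k)) (v (S k))) in *.
        set (i3 := I (x k) (y k + v (S k))%R (u (S k)) (v (S k))) in *.
        set (i4 := I (x k + u (S k))%R (y k + v (S k))%R (u (S k)) (v (S k))) in *.
        pose proof (Cmod_triangle (i1 + i2) (i3 + i4)).
        pose proof (Cmod_triangle i1 i2). pose proof (Cmod_triangle i3 i4).
        assert (eta / 4 ^ k = 4 * (eta / 4 ^ S k)) by (simpl; field; apply pow_nonzero; lra).
        lra. }
  destruct (nested_limit x u (x0 + a)) as [px Hpx].
  { intros n. apply Rlt_le, Hu. }
  { intros n. apply Hinv. }
  { intros n. destruct (Hstep n) as [[-> | ->] _]; pose proof (Hu (S n)); lra. }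
  { intros n. rewrite (Hu2 n). destruct (Hstep n) as [[-> | ->] _]; pose proof (Hu (S n)); lra. }
  destruct (nested_limit y v (y0 + b)) as [py Hpy].
  { intros n. apply Rlt_le, Hv. }
  { intros n. apply Hinv. }
  { intros n. destruct (Hstep n) as [_ [-> | ->]]; pose proof (Hv (S n)); lra. }
  { intros n. rewrite (Hv2 n). destruct (Hstep n) as [_ [-> | ->]]; pose proof (Hv (S n)); lra. }
  (* Turns the local bound at level [k] into half of [eta / 4 ^ k]. *)
  set (eps := eta / (2 * (a + b)²)).
  assert (Hab : 0 < (a + b)²) by (apply Rlt_0_sqr; lra).
  assert (Heps : 0 < eps) by (apply Rdiv_lt_0_compat; lra).
  assert (X0 := Hpx 0%nat). assert (Y0 := Hpy 0%nat).
  unfold x, u in X0. unfold y, v in Y0. simpl in X0, Y0. rewrite Rdiv_1_r in X0, Y0.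
  destruct (Hloc px py X0 Y0 eps Heps) as [d [Hd Hd']].
  destruct (pow_lt_1_zero (/ 2) ltac:(rewrite Rabs_pos_eq; lra) (d / (a + b))) as [k Hk].
  { apply Rdiv_lt_0_compat; lra. }
  specialize (Hk k (le_n k)). rewrite Rabs_pos_eq in Hk by (apply pow_le; lra).
  rewrite pow_inv in Hk.
  assert (Hdk : / 2 ^ k * (a + b) < d).
  { apply Rlt_le_trans with (d / (a + b) * (a + b)); [apply Rmult_lt_compat_r; lra|right; field; lra]. }
  destruct (Hinv k) as [HS HB]. unfold big in HB. fold (x k) (y k) in HB.
  specialize (Hd' (x k) (y k) (u k) (v k) HS (Hpx k) (Hpy k)).
  assert (Huk : u k < d) by (unfold u, Rdiv; nra).
  assert (Hvk : v k < d) by (unfold v, Rdiv; nra).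
  assert (E : eps * (u k + v k)² = eta / 4 ^ k / 2).
  { unfold eps, u, v, Rsqr. replace 4 with (2 * 2) by ring. rewrite Rpow_mult_distr. field.
    split; [apply pow_nonzero; lra|lra]. }
  assert (0 < eta / 4 ^ k) by (apply Rdiv_lt_0_compat; auto; apply pow_lt; lra).
  fold (x k) (y k) in *. lra.
Qed.

Definition loop (P Q : R -> R -> C) (x y u v : R) : C :=
  (cint (fun s => P s y) x (x + u)%R + cint (fun t => Q (x + u)%R t) y (y + v)%R
   - cint (fun s => P s (y + v)%R) x (x + u)%R - cint (fun t => Q x t) y (y + v)%R)%C.

(** [A] is a primitive of the linear approximation of [F] at [z], so that part integrates exactly
    and only the approximation error remains. *)
Lemma side_integral (F : C -> C) (g dg : R -> C) (z l : C) (a b M : R) :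
  a <= b -> (forall t, a <= t <= b -> is_RCderive g t (dg t)) ->
  ccont dg a b -> ccont (fun t => F (g t)) a b ->
  (forall t, a <= t <= b -> Cmod ((F (g t) - F z - (g t - z) * l) * dg t)%C <= M) ->
  let A := fun w : C => (F z * (w - z) + (w - z) * (w - z) * (l / RtoC 2))%C in
  Cmod (cint (fun t => F (g t) * dg t)%C a b - (A (g b) - A (g a)))%C <= (b - a) * M.
Proof.
  intros Hab Hg Hdg HF HM A.
  assert (HA : forall w, is_Cderive A w (F z + (w - z) * l)%C).
  { intros w. apply is_derive_C_spec. intros eps He.
    assert (Hl := Cmod_ge_0 l).
    exists (eps / (Cmod l + 1)). split; [apply Rdiv_lt_0_compat; lra|].
    intros w' Hw'.
    replace (A w' - A w - (w' - w) * (F z + (w - z) * l))%C with ((w' - w) * ((w' - w) * (l / RtoC 2)))%C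
      by (unfold A; field; intros E; apply RtoC_inj in E; lra).
    rewrite !Cmod_mult, Rmult_comm. apply Rmult_le_compat_r; [apply Cmod_ge_0|].
    unfold Cdiv. rewrite Cmod_mult, Cmod_inv by (intros E; apply RtoC_inj in E; lra).
    rewrite Cmod_R, Rabs_pos_eq by lra.
    apply Rle_trans with (eps / (Cmod l + 1) * (Cmod l + 1)); [|right; field; lra].
    apply Rmult_le_compat; try apply Cmod_ge_0; try lra. }
  assert (Hgc : ccont g a b).
  { intros t Ht. apply (@ex_derive_continuous R_AbsRing C_R_NormedModule). exists (dg t). apply Hg, Ht. }
  assert (Hlc : ccont (fun t => ((F z + (g t - z) * l) * dg t)%C) a b).
  { apply ccont_mult; auto. apply ccont_plus; [apply ccont_const|].
    apply ccont_mult; [|apply ccont_const]. apply ccont_minus; [auto|apply ccont_const]. }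
  assert (Hfc : ccont (fun t => F (g t) * dg t)%C a b) by (apply ccont_mult; auto).
  rewrite <- (cint_derive (fun t => A (g t)) (fun t => ((F z + (g t - z) * l) * dg t)%C)); auto.
  2:{ intros t Ht. apply is_derive_C_comp; auto. }
  rewrite <- cint_minus by auto.
  apply cint_bound; auto.
  { apply ccont_minus; auto. }
  intros t Ht. specialize (HM t Ht).
  replace (F (g t) * dg t - (F z + (g t - z) * l) * dg t)%C with
    ((F (g t) - F z - (g t - z) * l) * dg t)%C by ring. exact HM.
Qed.

(** Goursat's lemma for the form [F(w) dw] pulled back to a parameter rectangle, which suits the
    contraction of a circle. On a small rectangle the primitive of the linear part cancels around
    the boundary, so no mixed derivative of [g] enters. *)
Lemma goursat_pullback (F : C -> C) (g g1 g2 : R -> R -> C) (x0 y0 a b L : R) :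
  0 < a -> 0 < b -> 0 <= L ->
  (forall s t, x0 <= s <= x0 + a -> y0 <= t <= y0 + b ->
     is_RCderive (fun s => g s t) s (g1 s t) /\
     is_RCderive (fun t => g s t) t (g2 s t) /\
     Cmod (g1 s t) <= L /\ Cmod (g2 s t) <= L /\
     ex_Cderive F (g s t)) ->
  (forall t, y0 <= t <= y0 + b -> ccont (fun s => g1 s t) x0 (x0 + a)) ->
  (forall s, x0 <= s <= x0 + a -> ccont (fun t => g2 s t) y0 (y0 + b)) ->
  (forall s t s' t', x0 <= s <= x0 + a -> y0 <= t <= y0 + b ->
     x0 <= s' <= x0 + a -> y0 <= t' <= y0 + b ->
     Cmod (g s t - g s' t')%C <= L * (Rabs (s - s') + Rabs (t - t'))) ->
  loop (fun s t => F (g s t) * g1 s t)%C (fun s t => F (g s t) * g2 s t)%C x0 y0 a b = RtoC 0.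
Proof.
  intros Ha Hb HL Hg Hg1 Hg2 Hlip.
  assert (HP : forall t, y0 <= t <= y0 + b -> ccont (fun s => F (g s t) * g1 s t)%C x0 (x0 + a)).
  { intros t Ht. apply ccont_mult; auto. intros s Hs. apply continuous_C_comp; [apply Hg; auto|].
    apply (@ex_derive_continuous R_AbsRing C_R_NormedModule). exists (g1 s t). apply Hg; auto. }
  assert (HQ : forall s, x0 <= s <= x0 + a -> ccont (fun t => F (g s t) * g2 s t)%C y0 (y0 + b)).
  { intros s Hs. apply ccont_mult; auto. intros t Ht. apply continuous_C_comp; [apply Hg; auto|].
    apply (@ex_derive_continuous R_AbsRing C_R_NormedModule). exists (g2 s t). apply Hg; auto. }
  apply (quartering (loop (fun s t => F (g s t) * g1 s t)%C (fun s t => F (g s t) * g2 s t)%C)); auto.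
  - intros x y u v [H1 [H2 [H3 [H4 [H5 H6]]]]]. unfold loop.
    replace (x + 2 * u) with (x + u + u) in * by ring.
    replace (y + 2 * v) with (y + v + v) in * by ring.
    assert (CP : forall t, y0 <= t <= y0 + b ->
      cint (fun s => F (g s t) * g1 s t)%C x (x + u + u) =
      (cint (fun s => F (g s t) * g1 s t)%C x (x + u) + cint (fun s => F (g s t) * g1 s t)%C (x + u) (x + u + u))%C).
    { intros t Ht. apply cint_chasles; [lra|]. apply ccont_sub with x0 (x0 + a); auto; lra. }
    assert (CQ : forall s, x0 <= s <= x0 + a ->
      cint (fun t => F (g s t) * g2 s t)%C y (y + v + v) =
      (cint (fun t => F (g s t) * g2 s t)%C y (y + v) + cint (fun t => F (g s t) * g2 s t)%C (y + v) (y + v + v))%C).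
    { intros s Hs. apply cint_chasles; [lra|]. apply ccont_sub with y0 (y0 + b); auto; lra. }
    rewrite (CP y), (CP (y + v + v)), (CQ x), (CQ (x + u + u)) by lra. ring.
  - intros px py Hpx Hpy eps He.
    destruct (Hg px py Hpx Hpy) as [_ [_ [_ [_ [l Hl]]]]].
    set (z := g px py) in *.
    (* The four sides have total parameter length [2 * (u + v)] and the error on them is at most
       [e1 * L * (u + v) * L]. *)
    set (e1 := eps / (2 * L * L + 1)).
    assert (HLL : 0 <= L * L) by (apply Rmult_le_pos; auto).
    assert (He1 : 0 < e1) by (apply Rdiv_lt_0_compat; lra).
    destruct (proj1 (is_derive_C_spec F z l) Hl e1 He1) as [d [Hd Hd']].
    exists (d / (2 * L + 1)). split; [apply Rdiv_lt_0_compat; lra|].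
    intros x y u v [H1 [H2 [H3 [H4 [H5 H6]]]]] Hx Hy Hu Hv.
    assert (Hdist : forall s t, x <= s <= x + u -> y <= t <= y + v ->
       Cmod (g s t - z) <= L * (u + v)).
    { intros s t Hs Ht. eapply Rle_trans; [apply Hlip; lra|].
      apply Rmult_le_compat_l; auto. apply Rplus_le_compat; apply Rabs_le; lra. }
    assert (Huv : L * (u + v) < d).
    { apply Rle_lt_trans with (L * (2 * (d / (2 * L + 1)))); [apply Rmult_le_compat_l; lra|].
      replace d with ((2 * L + 1) * (d / (2 * L + 1))) at 2 by (field; lra).
      assert (0 < d / (2 * L + 1)) by (apply Rdiv_lt_0_compat; lra). nra. }
    assert (HE : forall s t, x <= s <= x + u -> y <= t <= y + v -> forall k, Cmod k <= L ->
       Cmod ((F (g s t) - F z - (g s t - z) * l) * k)%C <= e1 * (L * (u + v)) * L).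
    { intros s t Hs Ht k Hk. rewrite Cmod_mult.
      apply Rmult_le_compat; try apply Cmod_ge_0; auto.
      specialize (Hdist s t Hs Ht).
      eapply Rle_trans; [apply Hd'; lra|]. apply Rmult_le_compat_l; lra. }
    assert (HFc : forall s t, x <= s <= x + u -> y <= t <= y + v ->
       continuous ((fun s => F (g s t)) : R -> C_R_NormedModule) s /\
       continuous ((fun t => F (g s t)) : R -> C_R_NormedModule) t).
    { intros s t Hs Ht. destruct (Hg s t ltac:(lra) ltac:(lra)) as [G1 [G2 [_ [_ G3]]]].
      split; apply continuous_C_comp; auto; apply (@ex_derive_continuous R_AbsRing C_R_NormedModule);
      eexists; eassumption. }
    set (M := e1 * (L * (u + v)) * L) in *.
    set (A := fun w : C => (F z * (w - z) + (w - z) * (w - z) * (l / RtoC 2))%C).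
    assert (SP : forall t, y <= t <= y + v ->
      Cmod (cint (fun s => F (g s t) * g1 s t)%C x (x + u) - (A (g (x + u)%R t) - A (g x t)))%C <= u * M).
    { intros t Ht. replace (u * M) with ((x + u - x) * M) by ring.
      apply (side_integral F (fun s => g s t) (fun s => g1 s t) z l); try lra.
      - intros s Hs. apply Hg; lra.
      - apply ccont_sub with x0 (x0 + a); try lra. apply Hg1; lra.
      - intros s Hs. apply HFc; lra.
      - intros s Hs. apply HE; try lra. apply Hg; lra. }
    assert (SQ : forall s, x <= s <= x + u ->
      Cmod (cint (fun t => F (g s t) * g2 s t)%C y (y + v) - (A (g s (y + v)%R) - A (g s y)))%C <= v * M).
    { intros s Hs. replace (v * M) with ((y + v - y) * M) by ring.
      apply (side_integral F (fun t => g s t) (fun t => g2 s t) z l); try lra.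
      - intros t Ht. apply Hg; lra.
      - apply ccont_sub with y0 (y0 + b); try lra. apply Hg2; lra.
      - intros t Ht. apply HFc; lra.
      - intros t Ht. apply HE; try lra. apply Hg; lra. }
    assert (S1 := SP y ltac:(lra)). assert (S2 := SP (y + v) ltac:(lra)).
    assert (S3 := SQ x ltac:(lra)). assert (S4 := SQ (x + u) ltac:(lra)).
    unfold loop.
    (* The values of [A] at the four corners cancel in this combination. *)
    match type of S1 with Cmod ?e1 <= _ => match type of S2 with Cmod ?e2 <= _ =>
    match type of S3 with Cmod ?e3 <= _ => match type of S4 with Cmod ?e4 <= _ =>
      match goal with |- Cmod ?e <= _ => replace e with ((e1 + e4) + - (e2 + e3))%C by ring end;
      pose proof (Cmod_triangle (e1 + e4)%C (- (e2 + e3))%C) as T1;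
      pose proof (Cmod_triangle e1 e4) as T2; pose proof (Cmod_triangle e2 e3) as T3;
      rewrite Cmod_opp in T1 end end end end.
    assert (2 * (u + v) * M <= eps * (u + v)²).
    { unfold M, Rsqr.
      replace (2 * (u + v) * (e1 * (L * (u + v)) * L)) with (e1 * (2 * L * L) * ((u + v) * (u + v))) by ring.
      apply Rmult_le_compat_r; [nra|].
      apply Rle_trans with (e1 * (2 * L * L + 1)); [nra|]. right. unfold e1. field. lra. }
    lra.
Qed.

Lemma Cmod_le_Re_Im (z : C) : Cmod z <= Rabs (Re z) + Rabs (Im z).
Proof.
  destruct z as [x y]. unfold Cmod. simpl.
  assert (H1 := Rabs_pos x). assert (H2 := Rabs_pos y).
  apply Rsqr_incr_0_var; [|lra].
  rewrite Rsqr_sqrt by nra. unfold Rsqr.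
  rewrite <- (pow2_abs x), <- (pow2_abs y) at 1. nra.
Qed.

Lemma Rabs_Cmod_minus (z w : C) : Rabs (Cmod z - Cmod w) <= Cmod (z - w).
Proof.
  apply Rabs_le. split.
  - assert (H := Cmod_triangle z (w - z)). replace (z + (w - z))%C with w in H by ring.
    replace (w - z)%C with (- (z - w))%C in H by ring. rewrite Cmod_opp in H. lra.
  - assert (H := Cmod_triangle w (z - w)). replace (w + (z - w))%C with z in H by ring. lra.
Qed.

(** * Cauchy's theorem on a circle *)

Definition eit (t : R) : C := (cos t, sin t).

Lemma Cmod_eit t : Cmod (eit t) = 1.
Proof.
  unfold Cmod, eit. simpl. rewrite !Rmult_1_r.
  assert (H := sin2_cos2 t). unfold Rsqr in H. rewrite Rplus_comm, H. apply sqrt_1.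
Qed.

Lemma eit_neq_0 t : eit t <> RtoC 0.
Proof. intros E. assert (H := Cmod_eit t). rewrite E, Cmod_0 in H. lra. Qed.

Lemma is_derive_RC_pair (u v : R -> R) (t du dv : R) :
  is_derive u t du -> is_derive v t dv ->
  is_RCderive (fun s => (u s, v s)) t (du, dv).
Proof.
  intros Hu Hv. apply is_derive_RC_spec. intros eps He.
  assert (He2 : 0 < eps / 2) by lra.
  destruct Hu as [_ Hu]. destruct Hv as [_ Hv].
  destruct (Hu t (fun P HP => HP) (mkposreal _ He2)) as [d1 H1].
  destruct (Hv t (fun P HP => HP) (mkposreal _ He2)) as [d2 H2].
  exists (Rmin d1 d2). split; [apply Rmin_pos; apply cond_pos|].
  intros s Hs. specialize (H1 s (Rlt_le_trans _ _ _ Hs (Rmin_l _ _))).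
  specialize (H2 s (Rlt_le_trans _ _ _ Hs (Rmin_r _ _))).
  change (Rabs (u s - u t - (s - t) * du) <= eps / 2 * Rabs (s - t)) in H1.
  change (Rabs (v s - v t - (s - t) * dv) <= eps / 2 * Rabs (s - t)) in H2.
  eapply Rle_trans; [apply Cmod_le_Re_Im|]. simpl.
  replace (u s + - u t + - ((s - t) * du - 0 * dv)) with (u s - u t - (s - t) * du) by ring.
  replace (v s + - v t + - ((s - t) * dv + 0 * du)) with (v s - v t - (s - t) * dv) by ring.
  lra.
Qed.

Lemma is_derive_eit t : is_RCderive eit t (Ci * eit t)%C.
Proof.
  replace (Ci * eit t)%C with ((- sin t, cos t) : C).
  - apply is_derive_RC_pair; [apply is_derive_cos|apply is_derive_sin].
  - unfold Ci, eit. apply injective_projections; simpl; ring.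
Qed.

Lemma eit_lipschitz s t : Cmod (eit s - eit t) <= 2 * Rabs (s - t).
Proof.
  eapply Rle_trans; [apply Cmod_le_Re_Im|]. simpl.
  destruct (mvt_between cos (fun x => - sin x) t s) as [c1 [_ E1]]. { intros; apply is_derive_cos. }
  destruct (mvt_between sin cos t s) as [c2 [_ E2]]. { intros; apply is_derive_sin. }
  change (cos s + - cos t) with (cos s - cos t). change (sin s + - sin t) with (sin s - sin t).
  rewrite E1, E2, !Rabs_mult.
  assert (Rabs (- sin c1) <= 1) by (apply Rabs_le; pose proof (SIN_bound c1); lra).
  assert (Rabs (cos c2) <= 1) by (apply Rabs_le; pose proof (COS_bound c2); lra).
  pose proof (Rabs_pos (s - t)). nra.
Qed.

Lemma ccont_eit a b : ccont eit a b.
Proof.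
  intros t Ht. apply (@ex_derive_continuous R_AbsRing C_R_NormedModule).
  eexists. apply is_derive_eit.
Qed.

Lemma is_derive_Cinv (z : C) : z <> RtoC 0 ->
  is_Cderive Cinv z (- / (z * z))%C.
Proof.
  intros Hz. apply is_derive_C_spec. intros eps He.
  assert (Hm := proj1 (Cmod_gt_0 z) Hz). set (m := Cmod z) in *.
  exists (Rmin (m / 2) (eps * m * m * m / 2)). split.
  { apply Rmin_pos; [lra|]. assert (0 < eps * m * m * m); [|lra]. repeat apply Rmult_lt_0_compat; auto. }
  intros w Hw.
  assert (H1 : Cmod (w - z) < m / 2) by rmin_lt Hw.
  assert (H2 : Cmod (w - z) < eps * m * m * m / 2) by rmin_lt Hw.
  assert (H3 : m / 2 <= Cmod w).
  { assert (Q := Rabs_Cmod_minus z w). fold m in Q.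
    replace (z - w)%C with (- (w - z))%C in Q by ring. rewrite Cmod_opp in Q.
    apply Rabs_le_between in Q. lra. }
  assert (Hw0 : w <> RtoC 0) by (intros ->; rewrite Cmod_0 in H3; lra).
  replace (/ w - / z - (w - z) * - / (z * z))%C with ((w - z) * ((w - z) * / (w * (z * z))))%C
    by (field; auto).
  rewrite !Cmod_mult, Rmult_comm. apply Rmult_le_compat_r; [apply Cmod_ge_0|].
  rewrite Cmod_inv by (repeat apply Cmult_neq_0; auto).
  rewrite !Cmod_mult. fold m.
  apply Rle_trans with (eps * m * m * m / 2 * / (m / 2 * (m * m))); [|right; field; lra].
  apply Rmult_le_compat; try apply Cmod_ge_0; try lra.
  - apply Rlt_le, Rinv_0_lt_compat. repeat apply Rmult_lt_0_compat; lra.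
  - apply Rinv_le_contravar; [repeat apply Rmult_lt_0_compat; lra|].
    apply Rmult_le_compat_r; [nra|auto].
Qed.

Lemma is_derive_C_AbsRing (f : C -> C) (z l : C) :
  is_Cderive f z l <->
  @is_derive C_AbsRing (AbsRing_NormedModule C_AbsRing) f z l.
Proof. split; intros [_ H]; (split; [apply @is_linear_scal_l|exact H]). Qed.

Lemma is_derive_C_mult (f g : C -> C) (z l m : C) :
  is_Cderive f z l -> is_Cderive g z m ->
  is_Cderive (fun u => f u * g u)%C z (l * g z + f z * m)%C.
Proof.
  rewrite !is_derive_C_AbsRing. intros Hf Hg.
  exact (@is_derive_mult C_AbsRing f g z l m Hf Hg Cmult_comm).
Qed.

Lemma is_derive_C_C_comp (f g : C -> C) (z l m : C) :
  is_Cderive f (g z) l -> is_Cderive g z m ->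
  is_Cderive (fun u => f (g u)) z (m * l)%C.
Proof.
  rewrite (is_derive_C_AbsRing g). intros Hf Hg.
  exact (@is_derive_comp C_AbsRing C_NormedModule f g z l m Hf Hg).
Qed.

Lemma is_derive_C_minus_const (g : C -> C) (z k m : C) :
  is_Cderive g z m ->
  is_Cderive (fun u => g u - k)%C z m.
Proof.
  intros Hg. apply is_derive_C_spec. intros eps He.
  destruct (proj1 (is_derive_C_spec g z m) Hg eps He) as [d [Hd Hd']].
  exists d. split; auto. intros u Hu. specialize (Hd' u Hu).
  replace (g u - k - (g z - k) - (u - z) * m)%C with (g u - g z - (u - z) * m)%C by ring. exact Hd'.
Qed.

Lemma is_derive_C_id z : is_Cderive (fun u => u) z (RtoC 1).
Proof. apply is_derive_C_AbsRing. exact (@is_derive_id C_AbsRing z). Qed.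

Lemma ex_derive_difference_quotient (f : C -> C) (z w : C) :
  w <> z -> ex_Cderive f w ->
  ex_Cderive (fun u => (f u - f z) * / (u - z))%C w.
Proof.
  intros Hwz [l Hl]. eexists. apply is_derive_C_mult.
  - apply is_derive_C_minus_const. exact Hl.
  - apply (is_derive_C_C_comp Cinv (fun u => (u - z)%C)).
    + apply is_derive_Cinv. intros E. apply Hwz.
      replace w with ((w - z) + z)%C by ring. rewrite E. ring.
    + apply (is_derive_C_minus_const (fun u => u)), is_derive_C_id.
Qed.

(* The circle is contracted onto z by g(s, t) = z + s (c + r e^(it) - z), s in [e, 1]: this
   never meets z, so the quotient need not be known to be differentiable there, and the
   integral over the small circle is O(e). *)
Lemma cauchy_difference_quotient (f : C -> C) (c z : C) (r rho : R) :
  0 < r < rho -> (forall w, Cmod (w - c) < rho -> ex_Cderive f w) ->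
  Cmod (z - c) < r ->
  cint (fun t => (f (c + RtoC r * eit t) - f z) * / (c + RtoC r * eit t - z) * (RtoC r * (Ci * eit t)))%C
    0 (2 * PI) = RtoC 0.
Proof.
  intros Hr Hf Hz.
  set (g := fun s t : R => (z + RtoC s * (c + RtoC r * eit t - z))%C).
  set (F := fun u => ((f u - f z) * / (u - z))%C).
  set (g1 := fun _ t : R => (c + RtoC r * eit t - z)%C).
  set (g2 := fun s t : R => (RtoC s * (RtoC r * (Ci * eit t)))%C).
  assert (HPI := PI_RGT_0).
  assert (Hre : forall t, Cmod (RtoC r * eit t) = r).
  { intros t. rewrite Cmod_mult, Cmod_eit, Cmod_R, Rabs_pos_eq; lra. }
  assert (Hg1b : forall s t, Cmod (g1 s t) <= 2 * r).
  { intros s t. unfold g1. replace (c + RtoC r * eit t - z)%C with (RtoC r * eit t + - (z - c))%C by ring.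
    eapply Rle_trans; [apply Cmod_triangle|]. rewrite Hre, Cmod_opp. lra. }
  assert (Hg1n : forall s t, g1 s t <> RtoC 0).
  { intros s t E. unfold g1 in E.
    assert (RtoC r * eit t = z - c)%C as E' by (replace (z - c)%C with ((z - c) + (c + RtoC r * eit t - z))%C
      by (rewrite E; ring); ring).
    assert (H := Hre t). rewrite E' in H. lra. }
  assert (Hg2b : forall s t, 0 <= s <= 1 -> Cmod (g2 s t) <= s * r).
  { intros s t Hs. unfold g2. rewrite !Cmod_mult, Cmod_eit, !Cmod_R, !Rabs_pos_eq by lra.
    unfold Ci, Cmod. simpl. replace (0 * (0 * 1) + 1 * (1 * 1)) with 1 by ring. rewrite sqrt_1. lra. }
  assert (HD1 : forall s t, is_RCderive (fun s => g s t) s (g1 s t)).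
  { intros s t. apply is_derive_RC_spec. intros eps He. exists 1. split; [lra|]. intros u _.
    replace (g u t - g s t - RtoC (u - s) * g1 s t)%C with (RtoC 0)
      by (unfold g, g1; rewrite RtoC_minus; ring).
    rewrite Cmod_0. apply Rmult_le_pos; [lra|apply Rabs_pos]. }
  assert (HD2 : forall s t, 0 <= s <= 1 -> is_RCderive (fun t => g s t) t (g2 s t)).
  { intros s t Hs. apply is_derive_RC_spec. intros eps He.
    destruct (proj1 (is_derive_RC_spec eit t _) (is_derive_eit t) (eps / r)) as [d [Hd Hd']].
    { apply Rdiv_lt_0_compat; lra. }
    exists d. split; auto. intros u Hu. specialize (Hd' u Hu).
    replace (g s u - g s t - RtoC (u - t) * g2 s t)%C with
      (RtoC (s * r) * (eit u - eit t - RtoC (u - t) * (Ci * eit t)))%C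
      by (unfold g, g2; rewrite RtoC_mult; ring).
    rewrite Cmod_mult, Cmod_R, Rabs_pos_eq by (apply Rmult_le_pos; lra).
    apply Rle_trans with (1 * r * (eps / r * Rabs (u - t))).
    - apply Rmult_le_compat; auto; try apply Cmod_ge_0.
      + apply Rmult_le_pos; lra.
      + apply Rmult_le_compat_r; lra.
    - right. field. lra. }
  assert (Hdisc : forall s t, 0 <= s <= 1 -> Cmod (g s t - c) < rho).
  { intros s t Hs. unfold g.
    replace (z + RtoC s * (c + RtoC r * eit t - z) - c)%C with
      (RtoC (1 - s) * (z - c) + RtoC s * (RtoC r * eit t))%C by (rewrite RtoC_minus; ring).
    eapply Rle_lt_trans; [apply Cmod_triangle|].
    rewrite !(Cmod_mult (RtoC _)), Cmod_eit, !Cmod_R, !Rabs_pos_eq by lra. nra. }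
  assert (Hgz : forall s t, 0 < s -> g s t <> z).
  { intros s t Hs E. apply (Hg1n s t). unfold g in E. fold (g1 s t) in E.
    assert (E2 : (RtoC s * g1 s t)%C = RtoC 0).
    { replace (RtoC s * g1 s t)%C with (z + RtoC s * g1 s t - z)%C by ring. rewrite E. ring. }
    destruct (Ceq_dec (g1 s t) (RtoC 0)) as [|N]; auto. exfalso.
    apply (Cmult_neq_0 (RtoC s) (g1 s t)); auto. intros E3. apply RtoC_inj in E3. lra. }
  assert (HF : forall s t, 0 < s <= 1 -> ex_Cderive F (g s t)).
  { intros s t Hs. apply ex_derive_difference_quotient; [apply Hgz; lra|].
    apply Hf, Hdisc; lra. }
  assert (Hlip : forall s t s' t', 0 <= s <= 1 -> 0 <= s' <= 1 ->
    Cmod (g s t - g s' t') <= 2 * r * (Rabs (s - s') + Rabs (t - t'))).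
  { intros s t s' t' Hs Hs'.
    replace (g s t - g s' t')%C with (RtoC (s - s') * g1 s t + RtoC (s' * r) * (eit t - eit t'))%C
      by (unfold g, g1; rewrite RtoC_minus, RtoC_mult; ring).
    eapply Rle_trans; [apply Cmod_triangle|].
    rewrite !Cmod_mult, !Cmod_R, (Rabs_pos_eq (s' * r)) by (apply Rmult_le_pos; lra).
    rewrite Rmult_plus_distr_l. apply Rplus_le_compat.
    - rewrite Rmult_comm. apply Rmult_le_compat_r; [apply Rabs_pos|apply Hg1b].
    - assert (Q := eit_lipschitz t t').
      apply Rle_trans with (1 * r * (2 * Rabs (t - t'))); [|lra].
      apply Rmult_le_compat; auto; try apply Cmod_ge_0; nra. }
  set (T := fun s => cint (fun t => F (g s t) * g2 s t)%C 0 (2 * PI)).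
  assert (HT : forall e, 0 < e < 1 -> T 1 = T e).
  { intros e He.
    assert (Q := goursat_pullback F g g1 g2 e 0 (1 - e) (2 * PI) (2 * r) ltac:(lra) ltac:(lra) ltac:(lra)).
    assert (Q' : loop (fun s t => F (g s t) * g1 s t)%C (fun s t => F (g s t) * g2 s t)%C e 0 (1 - e) (2 * PI) = RtoC 0).
    { apply Q.
      - intros s t Hs Ht. split; [apply HD1|]. split; [apply HD2; lra|]. split; [apply Hg1b|].
        split; [|apply HF; lra]. eapply Rle_trans; [apply Hg2b; lra|]. nra.
      - intros t Ht. exact (ccont_const (c + RtoC r * eit t - z)%C _ _).
      - intros s Hs. apply ccont_mult; [apply ccont_const|]. apply ccont_mult; [apply ccont_const|].
        apply ccont_mult; [apply ccont_const|apply ccont_eit].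
      - intros s t s' t' Hs Ht Hs' Ht'. apply Hlip; lra. }
    unfold loop in Q'. replace (e + (1 - e)) with 1 in Q' by ring. rewrite Rplus_0_l in Q'.
    (* By periodicity the sides [t = 0] and [t = 2 * PI] of the rectangle cancel, leaving the outer
       and the inner circle. *)
    assert (Eper : eit (2 * PI) = eit 0).
    { unfold eit. now rewrite cos_2PI, sin_2PI, cos_0, sin_0. }
    assert (EP : cint (fun s => F (g s (2 * PI)%R) * g1 s (2 * PI)%R)%C e 1 =
                 cint (fun s => F (g s 0) * g1 s 0)%C e 1).
    { apply cint_ext; [lra|]. intros s _. unfold g, g1. now rewrite Eper. }
    rewrite EP in Q'. fold (T 1) (T e) in Q'.
    replace (T 1) with (T 1 - T e + T e)%C by ring.
    match type of Q' with (?A + ?B - ?A - ?D)%C = _ => replace (A + B - A - D)%C with (B - D)%C in Q' by ring end.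
    rewrite Q'. ring. }
  assert (HT1 : T 1 = RtoC 0).
  { apply Cmod_eq_0. apply Rle_antisym; [|apply Cmod_ge_0].
    apply Rle_plus_epsilon. intros eps He. rewrite Rplus_0_l.
    destruct (Hf z ltac:(lra)) as [l Hl].
    destruct (is_derive_C_bound f z l Hl) as [d [Hd Hd']].
    assert (Hl0 := Cmod_ge_0 l). set (M := Cmod l + 1) in *.
    assert (HM : 1 <= M) by (unfold M; lra).
    (* The inner circle has radius at most [2 * r * e < d] about [z], where the quotient is bounded
       by [M]; the last bound makes [2 * PI * M * r * e] at most [eps]. *)
    set (e := Rmin (1 / 2) (Rmin (d / (4 * r)) (eps / (2 * PI * M * r)))).
    assert (HPMr : 0 < 2 * PI * M * r) by (apply Rmult_lt_0_compat; [apply Rmult_lt_0_compat|]; lra).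
    assert (He0 : 0 < e).
    { repeat apply Rmin_pos; try lra; apply Rdiv_lt_0_compat; lra. }
    assert (He1 : e <= 1 / 2) by apply Rmin_l.
    assert (He2 : e <= d / (4 * r)) by rmin.
    assert (He3 : e <= eps / (2 * PI * M * r)) by rmin.
    rewrite (HT e) by lra. unfold T.
    eapply Rle_trans.
    - apply (cint_bound _ 0 (2 * PI) (M * (e * r))); [lra| |].
      + apply ccont_mult.
        * intros t Ht. apply continuous_C_comp; [apply HF; lra|].
          apply (@ex_derive_continuous R_AbsRing C_R_NormedModule). eexists. apply HD2. lra.
        * apply ccont_mult; [apply ccont_const|]. apply ccont_mult; [apply ccont_const|].
          apply ccont_mult; [apply ccont_const|apply ccont_eit].
      + intros t Ht. rewrite Cmod_mult.
        apply Rmult_le_compat; try apply Cmod_ge_0; [|apply Hg2b; lra].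
        unfold F. assert (Hne := Hgz e t He0).
        assert (Hgd : Cmod (g e t - z) < d).
        { replace (g e t - z)%C with (RtoC e * g1 e t)%C by (unfold g, g1; ring).
          rewrite Cmod_mult, Cmod_R, Rabs_pos_eq by lra.
          apply Rle_lt_trans with (d / (4 * r) * (2 * r)).
          - apply Rmult_le_compat; try lra; [apply Cmod_ge_0|apply Hg1b].
          - replace (d / (4 * r) * (2 * r)) with (d / 2) by (field; lra). lra. }
        assert (Hpos : 0 < Cmod (g e t - z)).
        { apply Cmod_gt_0. intros E. apply Hne. replace (g e t) with ((g e t - z) + z)%C by ring. rewrite E. ring. }
        rewrite Cmod_mult, Cmod_inv by (apply Cmod_gt_0; auto).
        apply Rmult_le_reg_r with (Cmod (g e t - z)); auto.
        rewrite Rmult_assoc, Rinv_l, Rmult_1_r by lra. apply Hd'. exact Hgd.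
    - rewrite Rminus_0_r.
      apply Rle_trans with (2 * PI * M * r * (eps / (2 * PI * M * r))); [|right; field; repeat split; lra].
      replace (2 * PI * (M * (e * r))) with (2 * PI * M * r * e) by ring.
      apply Rmult_le_compat_l; lra. }
  rewrite <- HT1. unfold T. apply cint_ext; [lra|]. intros t _.
  unfold F, g, g2. replace (z + RtoC 1 * (c + RtoC r * eit t - z))%C with (c + RtoC r * eit t)%C by ring. ring.
Qed.

(** * Taylor expansion of holomorphic functions *)

Fixpoint csum (a : nat -> C) (n : nat) : C :=
  match n with O => RtoC 0 | S m => (csum a m + a m)%C end.

Definition cconv (u : nat -> C) (l : C) : Prop :=
  forall eps, 0 < eps -> exists N, forall n, (N <= n)%nat -> Cmod (u n - l) < eps.

Lemma cconv_unique u l m : cconv u l -> cconv u m -> l = m.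
Proof.
  intros Hl Hm. assert (E : (l - m)%C = RtoC 0).
  { apply Cmod_eq_0. apply Rle_antisym; [|apply Cmod_ge_0].
    apply Rle_plus_epsilon. intros e He. rewrite Rplus_0_l.
    destruct (Hl (e / 2) ltac:(lra)) as [N1 H1]. destruct (Hm (e / 2) ltac:(lra)) as [N2 H2].
    specialize (H1 (N1 + N2)%nat ltac:(lia)). specialize (H2 (N1 + N2)%nat ltac:(lia)).
    replace (l - m)%C with (- (u (N1 + N2)%nat - l) + (u (N1 + N2)%nat - m))%C by ring.
    eapply Rle_trans; [apply Cmod_triangle|]. rewrite Cmod_opp. lra. }
  replace l with ((l - m) + m)%C by ring. rewrite E. ring.
Qed.

Lemma csum_ext a b n : (forall k, a k = b k) -> csum a n = csum b n.
Proof. intros H. induction n as [|n IH]; simpl; [reflexivity|]. now rewrite IH, H. Qed.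

Lemma csum_mult k a n : csum (fun i => k * a i)%C n = (k * csum a n)%C.
Proof. induction n as [|n IH]; simpl; [ring|]. rewrite IH. ring. Qed.

Lemma csum_geom x n : ((RtoC 1 - x) * csum (fun k => x ^ k)%C n = RtoC 1 - x ^ n)%C.
Proof. induction n as [|n IH]; simpl; [ring|]. rewrite Cmult_plus_distr_l, IH. ring. Qed.

Lemma cint_csum (a : nat -> R -> C) n u v : u <= v -> (forall k, ccont (a k) u v) ->
  ccont (fun t => csum (fun k => a k t) n) u v /\
  cint (fun t => csum (fun k => a k t) n) u v = csum (fun k => cint (a k) u v) n.
Proof.
  intros Huv Ha. induction n as [|n [IH1 IH2]]; simpl.
  - split; [apply ccont_const|].
    rewrite (cint_derive (fun _ => RtoC 0) (fun _ => RtoC 0)); auto.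
    + ring.
    + intros t _. apply (@is_derive_const R_AbsRing C_R_NormedModule).
    + apply ccont_const.
  - split; [apply ccont_plus; auto|]. rewrite cint_plus, IH2; auto.
Qed.

(** This is [e^(-it)], whose natural powers are the Fourier modes that extract Taylor
    coefficients. *)
Definition eim (t : R) : C := (cos t, - sin t).

Lemma eit_eim t : (eit t * eim t)%C = RtoC 1.
Proof.
  unfold eit, eim. apply injective_projections; simpl; [|ring].
  rewrite <- (sin2_cos2 t). unfold Rsqr. ring.
Qed.

Lemma Cmod_eim t : Cmod (eim t) = 1.
Proof.
  assert (H := f_equal Cmod (eit_eim t)). rewrite Cmod_mult, Cmod_eit, Cmod_1 in H. lra.
Qed.

Lemma is_derive_eim_pow n t :
  is_RCderive (fun s => eim s ^ n)%C t (- (RtoC (INR n) * Ci) * eim t ^ n)%C.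
Proof.
  assert (D1 : is_RCderive eim t (- Ci * eim t)%C).
  { replace (- Ci * eim t)%C with ((- sin t, - cos t) : C)
      by (unfold Ci, eim; apply injective_projections; simpl; ring).
    apply is_derive_RC_pair; [apply is_derive_cos|].
    refine (is_derive_opp _ _ _ (is_derive_sin t)). }
  assert (DP : forall m w, is_Cderive (fun z => z ^ m)%C w
     (RtoC (INR m) * w ^ (pred m))%C).
  { induction m as [|m IH]; intros w.
    - simpl. replace (0 * 1)%C with (RtoC 0) by ring. apply is_derive_C_AbsRing.
      apply (@is_derive_const C_AbsRing).
    - replace (RtoC (INR (S m)) * w ^ (pred (S m)))%C with
        (RtoC 1 * w ^ m + w * (RtoC (INR m) * w ^ (pred m)))%C.
      + apply (is_derive_C_mult (fun z => z) (fun z => z ^ m)%C); [apply is_derive_C_id|apply IH].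
      + rewrite S_INR, RtoC_plus. simpl pred. destruct m as [|m]; simpl; ring. }
  replace (- (RtoC (INR n) * Ci) * eim t ^ n)%C with (RtoC (INR n) * eim t ^ (pred n) * (- Ci * eim t))%C.
  - exact (is_derive_C_comp (fun z => z ^ n)%C eim t _ _ (DP n (eim t)) D1).
  - destruct n as [|n]; simpl pred; [simpl; ring|]. rewrite (Cpow_S _ n). ring.
Qed.

Lemma ccont_eim_pow n a b : ccont (fun t => eim t ^ n)%C a b.
Proof.
  intros t Ht. apply (@ex_derive_continuous R_AbsRing C_R_NormedModule).
  eexists. apply is_derive_eim_pow.
Qed.

Lemma cint_eim_pow n : cint (fun t => eim t ^ n)%C 0 (2 * PI) =
  match n with O => RtoC (2 * PI) | _ => RtoC 0 end.
Proof.
  assert (HPI := PI_RGT_0).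
  destruct n as [|n].
  - assert (Q := cint_derive RtoC (fun _ => RtoC 1) 0 (2 * PI) ltac:(lra)).
    simpl. rewrite Q.
    + ring.
    + intros t _. apply is_derive_RC_pair; [apply @is_derive_id|apply @is_derive_const].
    + apply ccont_const.
  - assert (HN : RtoC (INR (S n)) <> RtoC 0).
    { intros E. apply RtoC_inj in E. revert E. apply not_0_INR. lia. }
    set (k := (- (RtoC (INR (S n)) * Ci))%C).
    assert (HCi : (Ci * Ci)%C = RtoC (-1)) by (unfold Ci; apply injective_projections; simpl; ring).
    (* The integrand is, up to the nonzero factor [k], the derivative of a function with period
       [2 * PI]. *)
    assert (Q := cint_derive (fun t => eim t ^ S n)%C (fun t => k * eim t ^ S n)%C 0 (2 * PI)
      ltac:(lra) ltac:(intros t _; apply is_derive_eim_pow)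
      ltac:(apply ccont_mult; [apply ccont_const|apply ccont_eim_pow])).
    rewrite cint_scal in Q; [|lra|apply ccont_eim_pow].
    assert (E : eim (2 * PI) = eim 0) by (unfold eim; now rewrite cos_2PI, sin_2PI, cos_0, sin_0).
    rewrite E in Q.
    set (J := cint (fun t => eim t ^ S n)%C 0 (2 * PI)) in *.
    assert (Q2 : (RtoC (INR (S n)) * J)%C = RtoC 0).
    { replace (RtoC (INR (S n)) * J)%C with (Ci * (k * J) + (RtoC 1 + Ci * Ci) * (RtoC (INR (S n)) * J))%C
        by (unfold k; ring).
      rewrite Q, HCi. replace (RtoC 1 + RtoC (-1))%C with (RtoC 0)
        by (apply injective_projections; simpl; ring). ring. }
    destruct (Ceq_dec J (RtoC 0)) as [|N]; auto. exfalso. revert Q2. now apply Cmult_neq_0.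
Qed.

Lemma ccont_bounded f a b : a <= b -> ccont f a b -> exists M, 0 <= M /\ forall t, a <= t <= b -> Cmod (f t) <= M.
Proof.
  intros Hab Hf.
  destruct (continuity_ab_maj (fun t => Cmod (f t)) a b Hab) as [Mx [H1 _]].
  { intros t Ht. apply continuity_pt_locally. intros eps.
    destruct (proj1 (continuous_RC_spec f t) (Hf t Ht) eps (cond_pos eps)) as [d [Hd Hd']].
    exists (mkposreal d Hd). intros u Hu.
    eapply Rle_lt_trans; [apply Rabs_Cmod_minus|]. apply Hd', Hu. }
  exists (Cmod (f Mx)). split; [apply Cmod_ge_0|exact H1].
Qed.

(** The [a n] are Fourier coefficients of [f] on the circle divided by [r ^ n]. Put
    [q = (z - c) / r] and [X = q * e^(-it)]. Cauchy's theorem gives [h = (f - f z) / (1 - X)]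
    integral 0, and expanding [1 / (1 - X)] geometrically leaves the remainder [X ^ N * h], of size
    [|q| ^ N]. *)
Lemma cauchy_taylor (f : C -> C) (c : C) (r rho : R) :
  0 < r < rho -> (forall w, Cmod (w - c) < rho -> ex_Cderive f w) ->
  exists (a : nat -> C) (K : R),
    (forall n, Cmod (a n) * r ^ n <= K) /\
    forall z, Cmod (z - c) < r -> cconv (csum (fun n => a n * (z - c) ^ n)%C) (f z).
Proof.
  intros Hr Hf. assert (HPI := PI_RGT_0).
  set (zt := fun t => (c + RtoC r * eit t)%C).
  assert (Hzt : forall t, Cmod (zt t - c) = r).
  { intros t. unfold zt. replace (c + RtoC r * eit t - c)%C with (RtoC r * eit t)%C by ring.
    rewrite Cmod_mult, Cmod_eit, Cmod_R, Rabs_pos_eq; lra. }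
  assert (Hztc : forall u v, ccont zt u v).
  { intros u v. apply ccont_plus; [apply ccont_const|]. apply ccont_mult; [apply ccont_const|apply ccont_eit]. }
  set (fz := fun t => f (zt t)).
  assert (Hfz : ccont fz 0 (2 * PI)).
  { intros t Ht. apply continuous_C_comp; [|apply (Hztc 0 (2 * PI) t Ht)]. apply Hf. rewrite Hzt. lra. }
  destruct (ccont_bounded fz 0 (2 * PI)) as [M [HM0 HM]]; [lra|auto|].
  set (b := fun n => cint (fun t => fz t * eim t ^ n)%C 0 (2 * PI)).
  assert (Hb : forall n, Cmod (b n) <= 2 * PI * M).
  { intros n. unfold b. replace (2 * PI * M) with ((2 * PI - 0) * M) by ring. apply cint_bound; [lra| |].
    - apply ccont_mult; [auto|apply ccont_eim_pow].
    - intros t Ht. rewrite Cmod_mult, Cmod_pow, Cmod_eim, pow1, Rmult_1_r. auto. }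
  assert (Hrn : forall n, 0 < r ^ n) by (intros; apply pow_lt; lra).
  set (a := fun n => (RtoC (/ (2 * PI * r ^ n)) * b n)%C).
  exists a, M. split.
  { intros n. unfold a. rewrite Cmod_mult, Cmod_R. specialize (Hrn n).
    assert (0 < 2 * PI * r ^ n) by (apply Rmult_lt_0_compat; lra).
    rewrite Rabs_pos_eq by (apply Rlt_le, Rinv_0_lt_compat; auto).
    apply Rle_trans with (/ (2 * PI * r ^ n) * (2 * PI * M) * r ^ n); [|right; field; lra].
    apply Rmult_le_compat_r; [lra|]. apply Rmult_le_compat_l; auto.
    apply Rlt_le, Rinv_0_lt_compat; auto. }
  intros z Hz.
  set (q := ((z - c) * RtoC (/ r))%C).
  assert (Hq : Cmod q < 1).
  { unfold q. rewrite Cmod_mult, Cmod_R, Rabs_pos_eq by (apply Rlt_le, Rinv_0_lt_compat; lra).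
    apply Rmult_lt_reg_r with r; [lra|]. rewrite Rmult_assoc, Rinv_l by lra. lra. }
  assert (Hq0 := Cmod_ge_0 q).
  assert (Hqr : (q * RtoC r)%C = (z - c)%C).
  { unfold q. rewrite <- Cmult_assoc, <- RtoC_mult, Rinv_l by lra. ring. }
  set (X := fun t => (q * eim t)%C).
  assert (HX : forall t, Cmod (X t) = Cmod q).
  { intros t. unfold X. rewrite Cmod_mult, Cmod_eim. ring. }
  assert (HX1 : forall t, 1 - Cmod q <= Cmod (RtoC 1 - X t)).
  { intros t. assert (Q := Cmod_triangle (RtoC 1 - X t) (X t)).
    replace (RtoC 1 - X t + X t)%C with (RtoC 1) in Q by ring. rewrite Cmod_1, HX in Q. lra. }
  assert (HXn : forall t, (RtoC 1 - X t)%C <> RtoC 0).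
  { intros t E. specialize (HX1 t). rewrite E, Cmod_0 in HX1. lra. }
  (* Since [r e^(it) - (z - c) = r e^(it) (1 - X)], the integrand of [cauchy_difference_quotient] is
     [Ci * h]. *)
  set (h := fun t => ((fz t - f z) * / (RtoC 1 - X t))%C).
  assert (Hhc : ccont h 0 (2 * PI)).
  { apply ccont_mult; [apply ccont_minus; [auto|apply ccont_const]|].
    intros t Ht. apply (continuous_C_comp Cinv (fun t => (RtoC 1 - X t)%C)).
    - eexists. apply is_derive_Cinv. apply HXn.
    - apply (ccont_minus (fun _ => RtoC 1) X 0 (2 * PI)); auto; [apply ccont_const|].
      apply ccont_mult; [apply ccont_const|].
      apply (ccont_ext (fun t => eim t ^ 1)%C); [intros; apply Cpow_1_r|apply ccont_eim_pow]. }
  assert (Hh0 : cint h 0 (2 * PI) = RtoC 0).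
  { assert (Q := cauchy_difference_quotient f c z r rho Hr Hf Hz).
    rewrite (cint_ext _ (fun t => (Ci * h t)%C)) in Q.
    - rewrite cint_scal in Q; [|lra|auto].
      replace (cint h 0 (2 * PI)) with
        (- Ci * (Ci * cint h 0 (2 * PI)) + (RtoC 1 + Ci * Ci) * cint h 0 (2 * PI))%C by ring.
      rewrite Q. replace (RtoC 1 + Ci * Ci)%C with (RtoC 0)
        by (unfold Ci; apply injective_projections; simpl; ring). ring.
    - lra.
    - intros t _. unfold h, fz, zt.
      assert (E : (c + RtoC r * eit t - z)%C = (RtoC r * eit t * (RtoC 1 - X t))%C).
      { unfold X. replace (RtoC r * eit t * (RtoC 1 - q * eim t))%C with
          (RtoC r * eit t - (q * RtoC r) * (eit t * eim t))%C by ring.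
        rewrite Hqr, eit_eim. ring. }
      rewrite E. field. split; [apply HXn|].
      split; [apply eit_neq_0|]. intros E2. apply RtoC_inj in E2. lra. }
  assert (Hsum : forall N, csum (fun n => q ^ n * (b n - f z * cint (fun t => eim t ^ n)%C 0 (2 * PI)))%C N =
     (- cint (fun t => X t ^ N * h t)%C 0 (2 * PI))%C).
  { intros N.
    assert (HXc : forall k, ccont (fun t => X t ^ k)%C 0 (2 * PI)).
    { intros k. apply (ccont_ext (fun t => q ^ k * eim t ^ k)%C).
      - intros t. unfold X. now rewrite Cpow_mult_l.
      - apply ccont_mult; [apply ccont_const|apply ccont_eim_pow]. }
    assert (Hgc : ccont (fun t => fz t - f z)%C 0 (2 * PI)) by (apply ccont_minus; [auto|apply ccont_const]).
    destruct (cint_csum (fun k t => (fz t - f z) * X t ^ k)%C N 0 (2 * PI)) as [S1 S2].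
    { lra. } { intros k. apply ccont_mult; auto. }
    transitivity (csum (fun k => cint (fun t => (fz t - f z) * X t ^ k)%C 0 (2 * PI)) N).
    { apply csum_ext. intros k.
      rewrite (cint_ext (fun t => (fz t - f z) * X t ^ k)%C (fun t => q ^ k * (fz t * eim t ^ k - f z * eim t ^ k))%C).
      - rewrite (cint_scal (q ^ k)%C), cint_minus, (cint_scal (f z)); auto; try lra.
        + apply ccont_eim_pow.
        + apply ccont_mult; [auto|apply ccont_eim_pow].
        + apply ccont_mult; [apply ccont_const|apply ccont_eim_pow].
        + apply ccont_minus; apply ccont_mult; auto using ccont_eim_pow, ccont_const.
      - lra.
      - intros t _. unfold X. rewrite Cpow_mult_l. ring. }
    rewrite <- S2.
    rewrite (cint_ext _ (fun t => h t - X t ^ N * h t)%C).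
    - rewrite cint_minus; [|lra|auto|apply ccont_mult; auto]. rewrite Hh0. ring.
    - lra.
    - intros t _. rewrite csum_mult.
      replace (fz t - f z)%C with (h t * (RtoC 1 - X t))%C.
      + rewrite <- Cmult_assoc, csum_geom. ring.
      + unfold h. field. apply HXn. }
  destruct (ccont_bounded h 0 (2 * PI)) as [B [HB0 HB]]; [lra|auto|].
  (* [1 <= N] ensures that the mode 0, the only one in which [f z] appears, is included in the
     sum. *)
  assert (Hbound : forall N, (1 <= N)%nat ->
    Cmod (csum (fun n => a n * (z - c) ^ n)%C N - f z)%C <= B * Cmod q ^ N).
  { intros N HN.
    assert (E : csum (fun n => q ^ n * (b n - f z * cint (fun t => eim t ^ n)%C 0 (2 * PI)))%C N =
       (RtoC (2 * PI) * (csum (fun n => a n * (z - c) ^ n)%C N - f z))%C).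
    { destruct N as [|N]; [lia|]. clear HN. induction N as [|N IH].
      - cbn [csum]. rewrite cint_eim_pow. unfold a. simpl.
        assert (E1 : (RtoC (2 * PI) * RtoC (/ (2 * PI * 1)))%C = RtoC 1).
        { rewrite <- RtoC_mult. f_equal. field. lra. }
        transitivity ((RtoC (2 * PI) * RtoC (/ (2 * PI * 1))) * b 0%nat - RtoC (2 * PI) * f z)%C;
          [rewrite E1; ring|ring].
      - change (csum ?u (S (S N))) with (csum u (S N) + u (S N))%C.
        rewrite IH. change (csum (fun n => a n * (z - c) ^ n)%C (S (S N)))
          with (csum (fun n => a n * (z - c) ^ n) (S N) + a (S N) * (z - c) ^ (S N))%C.
        rewrite cint_eim_pow. unfold a. rewrite <- Hqr, Cpow_mult_l.
        assert (E1 : (RtoC (2 * PI) * RtoC (/ (2 * PI * r ^ S N)) * RtoC r ^ S N)%C = RtoC 1).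
        { rewrite <- RtoC_pow, <- !RtoC_mult. f_equal. specialize (Hrn (S N)). field. lra. }
        match goal with |- (_ + ?l)%C = (RtoC (2*PI) * (?s + ?t - f z))%C =>
          replace (RtoC (2 * PI) * (s + t - f z))%C with (RtoC (2 * PI) * (s - f z) + RtoC (2 * PI) * t)%C by ring
        end.
        f_equal.
        transitivity ((RtoC (2 * PI) * RtoC (/ (2 * PI * r ^ S N)) * RtoC r ^ S N) * (q ^ S N * b (S N)))%C;
          [rewrite E1; ring|ring]. }
    rewrite Hsum in E.
    assert (HC : Cmod (- cint (fun t => X t ^ N * h t)%C 0 (2 * PI)) <= 2 * PI * (Cmod q ^ N * B)).
    { rewrite Cmod_opp. replace (2 * PI * (Cmod q ^ N * B)) with ((2 * PI - 0) * (Cmod q ^ N * B)) by ring.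
      apply cint_bound; [lra| |].
      - apply ccont_mult; auto. apply (ccont_ext (fun t => q ^ N * eim t ^ N)%C).
        + intros t. unfold X. now rewrite Cpow_mult_l.
        + apply ccont_mult; [apply ccont_const|apply ccont_eim_pow].
      - intros t Ht. rewrite Cmod_mult, Cmod_pow, HX. apply Rmult_le_compat_l; [apply pow_le; auto|auto]. }
    rewrite E, Cmod_mult, Cmod_R, Rabs_pos_eq in HC by lra.
    apply Rmult_le_reg_l with (2 * PI); lra. }
  intros eps He.
  destruct (pow_lt_1_zero (Cmod q)) with (y := eps / (B + 1)) as [N HN].
  { rewrite Rabs_pos_eq; lra. } { apply Rdiv_lt_0_compat; lra. }
  exists (S N). intros n Hn. specialize (HN n ltac:(lia)). specialize (Hbound n ltac:(lia)).
  rewrite Rabs_pos_eq in HN by (apply pow_le; auto).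
  eapply Rle_lt_trans; [exact Hbound|].
  assert (0 <= Cmod q ^ n) by (apply pow_le; auto).
  apply Rle_lt_trans with ((B + 1) * Cmod q ^ n); [nra|].
  replace eps with ((B + 1) * (eps / (B + 1))) by (field; lra).
  apply Rmult_lt_compat_l; lra.
Qed.

(** * Convergent series and power series with real coefficients *)

Lemma csum_Re_Im u n :
  Re (csum u (S n)) = sum_n (fun k => Re (u k)) n /\ Im (csum u (S n)) = sum_n (fun k => Im (u k)) n.
Proof.
  induction n as [|n [IH1 IH2]].
  - rewrite !sum_O. unfold Re, Im. simpl. split; ring.
  - rewrite !sum_Sn. rewrite <- IH1, <- IH2. split; reflexivity.
Qed.

Lemma cconv_series u l : cconv (csum u) l ->
  is_series (fun n => Re (u n)) (Re l) /\ is_series (fun n => Im (u n)) (Im l).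
Proof.
  intros H.
  assert (A : is_lim_seq (sum_n (fun n => Re (u n))) (Re l) /\ is_lim_seq (sum_n (fun n => Im (u n))) (Im l)).
  { split; apply is_lim_seq_spec; intros eps; destruct (H eps (cond_pos eps)) as [N HN];
    exists N; intros n Hn; specialize (HN (S n) ltac:(lia)); destruct (csum_Re_Im u n) as [E1 E2].
    - rewrite <- E1. eapply Rle_lt_trans; [|exact HN]. apply (re_le_Cmod (csum u (S n) - l)).
    - rewrite <- E2. eapply Rle_lt_trans; [|exact HN].
      eapply Rle_trans; [|apply (Rmax_Cmod (csum u (S n) - l)%C)]. apply Rmax_r. }
  exact A.
Qed.

Lemma series_cconv u l : is_series (fun n => Re (u n)) (Re l) ->
  is_series (fun n => Im (u n)) (Im l) -> cconv (csum u) l.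
Proof.
  intros H1 H2 eps He.
  assert (H1' : is_lim_seq (sum_n (fun n => Re (u n))) (Re l)) by exact H1.
  assert (H2' : is_lim_seq (sum_n (fun n => Im (u n))) (Im l)) by exact H2.
  apply is_lim_seq_spec in H1'. apply is_lim_seq_spec in H2'.
  assert (He2 : 0 < eps / 2) by lra.
  destruct (H1' (mkposreal _ He2)) as [N1 HN1]. destruct (H2' (mkposreal _ He2)) as [N2 HN2].
  exists (S (N1 + N2)). intros [|n] Hn; [lia|].
  specialize (HN1 n ltac:(lia)). specialize (HN2 n ltac:(lia)). simpl in HN1, HN2.
  destruct (csum_Re_Im u n) as [E1 E2]. rewrite <- E1 in HN1. rewrite <- E2 in HN2.
  eapply Rle_lt_trans; [apply Cmod_le_Re_Im|].
  change (Rabs (Re (csum u (S n)) - Re l) + Rabs (Im (csum u (S n)) - Im l) < eps). lra.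
Qed.

Lemma cconv_dominated u (m : nat -> R) : (forall n, Cmod (u n) <= m n) -> ex_series m ->
  exists l, cconv (csum u) l /\ Cmod l <= Series m.
Proof.
  intros Hu Hm.
  assert (HRe : ex_series (fun n => Re (u n))).
  { apply (@ex_series_le R_AbsRing R_CompleteNormedModule _ m); auto.
    intros n. eapply Rle_trans; [apply re_le_Cmod|apply Hu]. }
  assert (HIm : ex_series (fun n => Im (u n))).
  { apply (@ex_series_le R_AbsRing R_CompleteNormedModule _ m); auto.
    intros n. eapply Rle_trans; [|apply Hu]. eapply Rle_trans; [|apply (Rmax_Cmod (u n))]. apply Rmax_r. }
  destruct HRe as [a Ha], HIm as [b Hb].
  assert (Hl : cconv (csum u) (a, b)) by (apply series_cconv; auto).
  exists (a, b). split; auto.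
  apply Rle_plus_epsilon. intros e He.
  destruct (Hl e He) as [N HN]. specialize (HN (S N) ltac:(lia)).
  assert (Hs : Cmod (csum u (S N)) <= sum_n m N).
  { clear HN. induction N as [|N IH].
    - rewrite sum_O. simpl. replace (RtoC 0 + u 0%nat)%C with (u 0%nat) by ring. apply Hu.
    - rewrite sum_Sn. change (csum u (S (S N))) with (csum u (S N) + u (S N))%C.
      eapply Rle_trans; [apply Cmod_triangle|]. apply Rplus_le_compat; auto. }
  assert (Hs2 : sum_n m N <= Series m).
  { apply (is_lim_seq_incr_compare (sum_n m)).
    - apply (Series_correct m Hm).
    - intros n. rewrite sum_Sn. unfold plus. simpl. specialize (Hu (S n)).
      pose proof (Cmod_ge_0 (u (S n))). lra. }
  replace (a, b) with (csum u (S N) + - (csum u (S N) - (a, b)))%C by ring.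
  eapply Rle_trans; [apply Cmod_triangle|]. rewrite Cmod_opp. lra.
Qed.

Lemma cconv_lin u v k l m : cconv (csum u) l -> cconv (csum v) m ->
  cconv (csum (fun n => u n + k * v n)%C) (l + k * m)%C.
Proof.
  intros Hu Hv eps He. assert (Hk := Cmod_ge_0 k).
  destruct (Hu (eps / 2) ltac:(lra)) as [N1 H1].
  destruct (Hv (eps / (2 * (Cmod k + 1)))) as [N2 H2]. { apply Rdiv_lt_0_compat; lra. }
  exists (N1 + N2)%nat. intros n Hn. specialize (H1 n ltac:(lia)). specialize (H2 n ltac:(lia)).
  assert (E : csum (fun n => u n + k * v n)%C n = (csum u n + k * csum v n)%C).
  { clear. induction n as [|n IH]; simpl; [ring|]. rewrite IH. ring. }
  rewrite E.
  replace (csum u n + k * csum v n - (l + k * m))%C with ((csum u n - l) + k * (csum v n - m))%C by ring.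
  eapply Rle_lt_trans; [apply Cmod_triangle|]. rewrite Cmod_mult.
  assert (Cmod k * Cmod (csum v n - m) <= (Cmod k + 1) * (eps / (2 * (Cmod k + 1)))).
  { apply Rmult_le_compat; try lra. apply Cmod_ge_0. }
  replace ((Cmod k + 1) * (eps / (2 * (Cmod k + 1)))) with (eps / 2) in H by (field; lra). lra.
Qed.

Lemma cconv_ext u v l : (forall n, u n = v n) -> cconv (csum u) l -> cconv (csum v) l.
Proof.
  intros E H eps He. destruct (H eps He) as [N HN]. exists N. intros n Hn.
  rewrite <- (csum_ext u v n E). auto.
Qed.

(* By the binomial formula, the left side is at most (|h|/eta)^2 times the same expression
   with w, h replaced by |w|, eta. *)
Lemma pow_second_order (w h : C) (eta : R) n : 0 < eta -> Cmod h <= eta ->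
  Cmod ((w + h) ^ n - w ^ n - h * (RtoC (INR n) * w ^ (pred n)))%C <=
    (Cmod h / eta)² * ((Cmod w + eta) ^ n - Cmod w ^ n - eta * (INR n * Cmod w ^ (pred n))) /\
  0 <= (Cmod w + eta) ^ n - Cmod w ^ n - eta * (INR n * Cmod w ^ (pred n)).
Proof.
  intros Heta Hh. assert (Hw := Cmod_ge_0 w). assert (Hh0 := Cmod_ge_0 h).
  induction n as [|n [IH1 IH2]].
  - simpl. replace (1 - 1 - h * (0 * 1))%C with (RtoC 0) by ring. rewrite Cmod_0. split; lra.
  - set (e := (Cmod w + eta) ^ n - Cmod w ^ n - eta * (INR n * Cmod w ^ (pred n))) in *.
    set (E := ((w + h) ^ n - w ^ n - h * (RtoC (INR n) * w ^ (pred n)))%C) in *.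
    assert (Hn := pos_INR n).
    assert (Hp : 0 <= INR n * Cmod w ^ (pred n)) by (apply Rmult_le_pos; auto; apply pow_le; auto).
    assert (R1 : (Cmod w + eta) ^ S n - Cmod w ^ S n - eta * (INR (S n) * Cmod w ^ (pred (S n))) =
      (Cmod w + eta) * e + eta² * (INR n * Cmod w ^ (pred n))).
    { unfold e, Rsqr. rewrite S_INR. simpl pred. destruct n as [|n]; [simpl; ring|]. simpl pred. simpl pow. ring. }
    assert (R2 : ((w + h) ^ S n - w ^ S n - h * (RtoC (INR (S n)) * w ^ (pred (S n))))%C =
      ((w + h) * E + h * h * (RtoC (INR n) * w ^ (pred n)))%C).
    { unfold E. rewrite S_INR, RtoC_plus. simpl pred. destruct n as [|n]; [simpl; ring|]. simpl pred. rewrite !(Cpow_S). ring. }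
    rewrite R1, R2. split.
    + eapply Rle_trans; [apply Cmod_triangle|]. rewrite !Cmod_mult, Cmod_R, Cmod_pow, (Rabs_pos_eq (INR n)) by auto.
      rewrite Rmult_plus_distr_l. apply Rplus_le_compat.
      * assert (Cmod (w + h) <= Cmod w + eta) by (eapply Rle_trans; [apply Cmod_triangle|lra]).
        apply Rle_trans with ((Cmod w + eta) * ((Cmod h / eta)² * e)); [|right; ring].
        apply Rmult_le_compat; auto; apply Cmod_ge_0.
      * right. unfold Rsqr. field. lra.
    + assert (0 <= eta²) by apply Rle_0_sqr.
      assert (0 <= (Cmod w + eta) * e) by (apply Rmult_le_pos; lra).
      assert (0 <= eta² * (INR n * Cmod w ^ (pred n))) by (apply Rmult_le_pos; auto). lra.
Qed.

Definition power_series (a : nat -> R) (w : C) : C :=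
  (Series (fun n => Re (RtoC (a n) * w ^ n)), Series (fun n => Im (RtoC (a n) * w ^ n))).

Lemma power_series_cconv a rho w : ex_series (fun n => Rabs (a n) * rho ^ n) -> Cmod w <= rho ->
  cconv (csum (fun n => RtoC (a n) * w ^ n)%C) (power_series a w).
Proof.
  intros Ha Hw.
  destruct (cconv_dominated (fun n => RtoC (a n) * w ^ n)%C (fun n => Rabs (a n) * rho ^ n)) as [l [Hl _]]; auto.
  { intros n. rewrite Cmod_mult, Cmod_R, Cmod_pow. apply Rmult_le_compat_l; [apply Rabs_pos|].
    apply pow_incr. split; auto. apply Cmod_ge_0. }
  destruct (cconv_series _ _ Hl) as [H1 H2].
  unfold power_series. rewrite (is_series_unique _ _ H1), (is_series_unique _ _ H2).
  destruct l; exact Hl.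
Qed.

(** The derivative is the termwise one, summable because [pow_second_order] gives
    [n |w|^(n-1) <= rho^n / eta]. The same lemma bounds the total error by [(|h| / eta)^2] times the
    sum of the series at [rho]. *)
Lemma power_series_ex_derive a rho w : ex_series (fun n => Rabs (a n) * rho ^ n) -> Cmod w < rho ->
  ex_Cderive (power_series a) w.
Proof.
  intros Ha Hw. set (eta := rho - Cmod w). assert (Heta : 0 < eta) by (unfold eta; lra).
  assert (Hw0 := Cmod_ge_0 w).
  assert (Hrho : Cmod w + eta = rho) by (unfold eta; ring).
  destruct (cconv_dominated (fun n => RtoC (a n) * (RtoC (INR n) * w ^ (pred n)))%C
    (fun n => / eta * (Rabs (a n) * rho ^ n))) as [d [Hd _]].
  { intros n. rewrite !Cmod_mult, !Cmod_R, Cmod_pow, (Rabs_pos_eq (INR n)) by apply pos_INR.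
    destruct (pow_second_order w (RtoC 0) eta n Heta) as [_ Q]; [rewrite Cmod_0; lra|].
    rewrite Hrho in Q.
    assert (INR n * Cmod w ^ (pred n) <= / eta * rho ^ n).
    { apply Rmult_le_reg_l with eta; auto. replace (eta * (/ eta * rho ^ n)) with (rho ^ n) by (field; lra).
      assert (0 <= Cmod w ^ n) by (apply pow_le; auto). lra. }
    pose proof (Rabs_pos (a n)).
    replace (/ eta * (Rabs (a n) * rho ^ n)) with (Rabs (a n) * (/ eta * rho ^ n)) by ring.
    apply Rmult_le_compat_l; auto. }
  { exact (ex_series_scal_l (V := R_NormedModule) (/ eta) _ Ha). }
  exists d. apply is_derive_C_spec. intros eps He.
  set (S := Series (fun n => Rabs (a n) * rho ^ n)).
  set (k := eta² * eps / (Rabs S + 1)).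
  assert (HS := Rabs_pos S).
  assert (Heta2 : 0 < eta²) by (apply Rlt_0_sqr; lra).
  assert (Hk : 0 < k) by (apply Rdiv_lt_0_compat; [apply Rmult_lt_0_compat; auto|lra]).
  exists (Rmin eta k). split; [apply Rmin_pos; auto|].
  intros w' Hw'. set (h := (w' - w)%C) in *.
  assert (Hh1 : Cmod h < eta) by (eapply Rlt_le_trans; [exact Hw'|apply Rmin_l]).
  assert (Hh2 : Cmod h < k) by (eapply Rlt_le_trans; [exact Hw'|apply Rmin_r]).
  assert (Hh0 := Cmod_ge_0 h).
  assert (Ew' : w' = (w + h)%C) by (unfold h; ring).
  assert (C1 : cconv (csum (fun n => RtoC (a n) * w' ^ n)%C) (power_series a w')).
  { apply power_series_cconv with rho; auto. rewrite Ew'. eapply Rle_trans; [apply Cmod_triangle|]. lra. }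
  assert (C2 : cconv (csum (fun n => RtoC (a n) * w ^ n)%C) (power_series a w)).
  { apply power_series_cconv with rho; auto. lra. }
  assert (C3 := cconv_lin _ _ (- h)%C _ _ (cconv_lin _ _ (RtoC (-1)) _ _ C1 C2) Hd).
  destruct (cconv_dominated (fun n => RtoC (a n) * ((w + h) ^ n - w ^ n - h * (RtoC (INR n) * w ^ (pred n))))%C
    (fun n => (Cmod h / eta)² * (Rabs (a n) * rho ^ n))) as [l [Hl Hlb]].
  { intros n. rewrite Cmod_mult, Cmod_R.
    destruct (pow_second_order w h eta n Heta ltac:(lra)) as [Q1 Q2]. rewrite Hrho in Q1.
    replace ((Cmod h / eta)² * (Rabs (a n) * rho ^ n)) with (Rabs (a n) * ((Cmod h / eta)² * rho ^ n)) by ring.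
    apply Rmult_le_compat_l; [apply Rabs_pos|].
    eapply Rle_trans; [exact Q1|]. apply Rmult_le_compat_l; [apply Rle_0_sqr|].
    assert (0 <= Cmod w ^ n) by (apply pow_le; auto).
    assert (0 <= eta * (INR n * Cmod w ^ (pred n))).
    { apply Rmult_le_pos; [lra|]. apply Rmult_le_pos; [apply pos_INR|apply pow_le; auto]. }
    lra. }
  { exact (ex_series_scal_l (V := R_NormedModule) ((Cmod h / eta)²) _ Ha). }
  assert (El : l = (power_series a w' - power_series a w - h * d)%C).
  { apply (cconv_unique (csum (fun n => RtoC (a n) * ((w + h) ^ n - w ^ n - h * (RtoC (INR n) * w ^ (pred n))))%C)); auto.
    replace (power_series a w' - power_series a w - h * d)%C with
      (power_series a w' + RtoC (-1) * power_series a w + - h * d)%C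
      by (replace (RtoC (-1)) with (- RtoC 1)%C by (apply injective_projections; simpl; ring); ring).
    eapply cconv_ext; [|exact C3]. intros n. simpl. rewrite Ew'.
    replace (RtoC (-1)) with (- RtoC 1)%C by (apply injective_projections; simpl; ring). ring. }
  rewrite <- El. eapply Rle_trans; [exact Hlb|].
  rewrite Series_scal_l. fold S.
  apply Rle_trans with ((Cmod h / eta)² * Rabs S).
  { apply Rmult_le_compat_l; [apply Rle_0_sqr|apply RRle_abs]. }
  replace ((Cmod h / eta)² * Rabs S) with (Cmod h * (/ eta² * Rabs S) * Cmod h) by (unfold Rsqr; field; lra).
  apply Rmult_le_compat_r; auto.
  assert (Hi : 0 < / eta²) by (apply Rinv_0_lt_compat; auto).
  apply Rle_trans with (k * (/ eta² * (Rabs S + 1))).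
  { apply Rmult_le_compat; [lra|apply Rmult_le_pos; lra|lra|apply Rmult_le_compat_l; lra]. }
  right. unfold k. field. split; lra.
Qed.

Definition taylor_coef (p : R -> R) (c : R) (n : nat) : R := Derive_n p n c / INR (fact n).

Local Notation taylor_sum p c w :=
  (csum (fun n => RtoC (taylor_coef p c n) * w ^ n)%C) (only parsing).

(** On the axis, the real and imaginary parts of the complex coefficients define real power series
    with sums [p] and 0. This makes [p] smooth at [c] and identifies the coefficients as its Taylor
    coefficients. *)
Lemma real_axis_taylor (f : C -> C) (p : R -> R) (c rho : R) : 0 < rho ->
  (forall w, Cmod (w - RtoC c) < rho -> ex_Cderive f w) ->
  (forall x, Rabs (x - c) < rho -> f (RtoC x) = RtoC (p x)) ->
  (forall n, ex_derive_n p n c) /\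
  forall z, Cmod (z - RtoC c) < rho ->
    cconv (taylor_sum p c (z - RtoC c)) (f z).
Proof.
  intros Hrho Hf Hp.
  (* The coefficients from [cauchy_taylor] might depend on [r]; once identified they do not, and [r]
     can be chosen according to [z]. *)
  assert (H : forall r, 0 < r < rho -> (forall n, ex_derive_n p n c) /\
    forall z, Cmod (z - RtoC c) < r ->
    cconv (taylor_sum p c (z - RtoC c)) (f z)).
  { intros r Hr. destruct (cauchy_taylor f (RtoC c) r rho Hr Hf) as [a [K [HK Ha]]].
    assert (HCV : forall b : nat -> R, (forall n, Rabs (b n) <= Cmod (a n)) -> Rbar_le r (CV_radius b)).
    { intros b Hb. apply (CV_radius_bounded b). exists K. intros n.
      rewrite Rabs_mult, (Rabs_pos_eq (r ^ n)) by (apply pow_le; lra).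
      eapply Rle_trans; [|apply HK]. apply Rmult_le_compat_r; [apply pow_le; lra|auto]. }
    assert (HA := HCV (fun n => Re (a n)) (fun n => re_le_Cmod (a n))).
    assert (HB := HCV (fun n => Im (a n))
       (fun n => Rle_trans _ _ _ (Rmax_r _ _) (Rmax_Cmod (a n)))).
    assert (HCV0 : forall b, Rbar_le r (CV_radius b) -> Rbar_lt 0 (CV_radius b)).
    { intros b Hb. apply Rbar_lt_le_trans with r; auto. simpl. lra. }
    assert (Hser : forall t, Rabs t < r ->
      PSeries (fun n => Re (a n)) t = p (t + c) /\ PSeries (fun n => Im (a n)) t = 0).
    { intros t Ht.
      assert (E : (RtoC (t + c) - RtoC c)%C = RtoC t) by (rewrite <- RtoC_minus; f_equal; ring).
      assert (Q := Ha (RtoC (t + c))). rewrite E, Cmod_R in Q. specialize (Q Ht).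
      rewrite Hp in Q by (replace (t + c - c) with t by ring; lra).
      apply cconv_series in Q. destruct Q as [Q1 Q2]. simpl in Q1, Q2.
      split; unfold PSeries; apply is_series_unique.
      - eapply is_series_ext; [|exact Q1]. intros n. simpl. rewrite <- RtoC_pow. unfold Re, Im. simpl. ring.
      - eapply is_series_ext; [|exact Q2]. intros n. simpl. rewrite <- RtoC_pow. unfold Re, Im. simpl. ring. }
    assert (Hloc : locally 0 (fun t => Rabs t < r)).
    { assert (Hr0 : 0 < r) by lra. exists (mkposreal r Hr0). intros y Hy.
      change (Rabs (y - 0) < r) in Hy. now rewrite Rminus_0_r in Hy. }
    assert (Hexp : forall n, ex_derive_n p n c).
    { intros n. apply ex_derive_n_ext_loc with (fun x => PSeries (fun n => Re (a n)) (x + - c)).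
      - assert (Hr0 : 0 < r) by lra. exists (mkposreal r Hr0). intros y Hy.
        change (Rabs (y - c) < r) in Hy.
        replace (p y) with (p (y + - c + c)) by (f_equal; ring). apply Hser.
        exact Hy.
      - apply ex_derive_n_comp_trans. apply ex_derive_n_PSeries.
        replace (c + - c) with 0 by ring. rewrite Rabs_R0. apply HCV0, HA. }
    assert (Hcoef : forall n, a n = RtoC (taylor_coef p c n)).
    { intros n. unfold taylor_coef.
      assert (D1 : Derive_n p n c = Re (a n) * INR (fact n)).
      { rewrite <- (Derive_n_coef (fun n => Re (a n)) n (HCV0 _ HA)).
        transitivity (Derive_n (fun t => p (t + c)) n 0).
        - rewrite Derive_n_comp_trans. f_equal. ring.
        - apply Derive_n_ext_loc. refine (filter_imp _ _ _ Hloc). intros t Ht. symmetry. apply Hser, Ht. }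
      assert (D2 : 0 = Im (a n) * INR (fact n)).
      { rewrite <- (Derive_n_coef (fun n => Im (a n)) n (HCV0 _ HB)).
        rewrite (Derive_n_ext_loc _ (fun _ => 0)).
        - destruct n as [|n]; [reflexivity|]. now rewrite Derive_n_const.
        - refine (filter_imp _ _ _ Hloc). intros t Ht. apply Hser, Ht. }
      assert (HF := INR_fact_lt_0 n).
      rewrite D1. replace (Re (a n) * INR (fact n) / INR (fact n)) with (Re (a n)) by (field; lra).
      assert (Im (a n) = 0) by nra. destruct (a n) as [x y]. simpl in *. now rewrite H. }
    split; [exact Hexp|]. intros z Hz. eapply cconv_ext; [|exact (Ha z Hz)].
    intros n. simpl. now rewrite Hcoef. }
  split.
  - apply (H (rho / 2)). lra.
  - intros z Hz. apply (H ((Cmod (z - RtoC c) + rho) / 2)); [|lra].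
    pose proof (Cmod_ge_0 (z - RtoC c)). lra.
Qed.

(** * Extension to the half-plane *)

(* The k-th derivative of u |-> f (c - u): all signs become nonnegative for k >= 2. *)
Definition refl (f : R -> R) (c : R) (k : nat) (u : R) : R := (-1) ^ k * Derive_n f k (c - u).

(** Taylor remainder of order [n] at [u = 0] for the [k]-th derivative of [u -> f (c - u)]. The
    index [k] is kept because differentiation exchanges one unit of [n] for one of [k]. *)
Fixpoint remainder (f : R -> R) (c : R) (k n : nat) (u : R) : R :=
  match n with
  | O => refl f c k u
  | S m => remainder f c k m u - refl f c (k + m) 0 * (u ^ m / INR (fact m))
  end.

Lemma refl_derive f c k u : smooth f -> u < c ->
  is_derive (refl f c k) u (refl f c (S k) u).
Proof.
  intros Hf Hu. unfold refl.
  replace ((-1) ^ S k * Derive_n f (S k) (c - u)) with ((-1) ^ k * (-1 * Derive_n f (S k) (c - u)))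
    by (simpl; ring).
  apply is_derive_scal.
  apply (is_derive_comp (Derive_n f k) (fun v => c - v)).
  - apply smooth_is_derive; auto. lra.
  - auto_derive; auto; ring.
Qed.

Lemma remainder_0 f c k n : remainder f c k (S n) 0 = 0.
Proof.
  induction n as [|n IH].
  - simpl. rewrite Nat.add_0_r. field.
  - change (remainder f c k (S (S n)) 0) with
      (remainder f c k (S n) 0 - refl f c (k + S n) 0 * (0 ^ S n / INR (fact (S n)))).
    rewrite IH. simpl. unfold Rdiv. ring.
Qed.

Lemma remainder_derive f c k n u : smooth f -> u < c ->
  is_derive (remainder f c k (S n)) u (remainder f c (S k) n u).
Proof.
  intros Hf Hu. induction n as [|n IH].
  - simpl. replace (refl f c (S k) u) with (refl f c (S k) u - 0) by ring.
    apply (is_derive_minus (refl f c k)); [apply refl_derive; auto|].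
    apply is_derive_ext with (fun _ => refl f c (k + 0) 0 * (1 / 1)); [reflexivity|].
    apply @is_derive_const.
  - change (remainder f c k (S (S n))) with (fun u =>
      remainder f c k (S n) u - refl f c (k + S n) 0 * (u ^ S n / INR (fact (S n)))).
    change (remainder f c (S k) (S n) u) with
      (remainder f c (S k) n u - refl f c (S k + n) 0 * (u ^ n / INR (fact n))).
    apply (is_derive_minus (remainder f c k (S n))); auto.
    replace (k + S n)%nat with (S k + n)%nat by lia.
    apply is_derive_scal.
    assert (HF := INR_fact_lt_0 n).
    assert (Hn : INR (S n) <> 0) by (apply not_0_INR; lia).
    replace (u ^ n / INR (fact n)) with (INR (S n) * 1 * u ^ n * / INR (fact (S n))).
    + apply is_derive_ext with (fun v => / INR (fact (S n)) * v ^ S n). { intros v. unfold Rdiv. apply Rmult_comm. }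
      rewrite Rmult_comm. apply is_derive_scal.
      apply (is_derive_pow (fun v => v) (S n) u 1). apply @is_derive_id.
    + rewrite fact_simpl, mult_INR. field. split; auto. lra.
Qed.

Lemma nonneg_of_derive (g dg : R -> R) (b : R) :
  (forall v, 0 <= v <= b -> is_derive g v (dg v)) -> (forall v, 0 <= v <= b -> 0 <= dg v) ->
  0 <= b -> g 0 <= g b.
Proof.
  intros Hd Hp Hb. destruct (mvt_between g dg 0 b) as [x [Hx E]].
  { intros v Hv. rewrite Rmin_left, Rmax_right in Hv by auto. auto. }
  rewrite Rmin_left, Rmax_right in Hx by auto. specialize (Hp x Hx). nra.
Qed.

(** The remainder vanishes at 0 and its derivative is a remainder with the same [k + n]; the
    induction ends at a derivative of order at least 2. *)
Lemma remainder_nonneg f c k n u : alternating f -> (2 <= k + n)%nat -> 0 <= u < c ->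
  0 <= remainder f c k n u.
Proof.
  intros Hf. revert k u. induction n as [|n IH]; intros k u Hk Hu.
  - simpl. apply Hf; [lia|lra].
  - rewrite <- (remainder_0 f c k n).
    apply (nonneg_of_derive _ (remainder f c (S k) n)); try lra.
    + intros v Hv. apply remainder_derive; [apply Hf|lra].
    + intros v Hv. apply IH; [lia|lra].
Qed.

(* remainder_n (u) / u^n is nondecreasing: this forces the remainders to tend to 0. *)
Lemma remainder_scale f c k n u s : alternating f -> (1 <= k + n)%nat -> 0 <= u < c -> 0 <= s <= 1 ->
  remainder f c k n (s * u) <= s ^ n * remainder f c k n u.
Proof.
  intros Hf. revert k u. induction n as [|n IH]; intros k u Hk Hu Hs.
  - simpl. rewrite Rmult_1_l.
    destruct (mvt_between (refl f c k) (refl f c (S k)) (s * u) u) as [x [Hx E]].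
    { intros v Hv. apply refl_derive; [apply Hf|].
      assert (Rmax (s * u) u <= u) by (apply Rmax_lub; nra). lra. }
    assert (Hx' : s * u <= x <= u) by (rewrite Rmin_left, Rmax_right in Hx; nra).
    assert (0 <= refl f c (S k) x).
    { apply Hf; [lia|]. nra. }
    nra.
  - set (g := fun v => s ^ S n * remainder f c k (S n) v - remainder f c k (S n) (s * v)).
    set (dg := fun v => s ^ S n * remainder f c (S k) n v - s * remainder f c (S k) n (s * v)).
    assert (Q : g 0 <= g u).
    { apply (nonneg_of_derive g dg); [| |lra].
      - intros v Hv. unfold g, dg.
        apply (is_derive_minus (fun v => s ^ S n * remainder f c k (S n) v)).
        + apply is_derive_scal. apply remainder_derive; [apply Hf|lra].
        + apply (is_derive_comp (remainder f c k (S n)) (fun v => s * v)).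
          * apply remainder_derive; [apply Hf|nra].
          * auto_derive; auto; ring.
      - intros v Hv. unfold dg. specialize (IH (S k) v ltac:(lia) ltac:(lra) Hs).
        assert (s * remainder f c (S k) n (s * v) <= s * (s ^ n * remainder f c (S k) n v))
          by (apply Rmult_le_compat_l; lra).
        simpl pow. lra. }
    unfold g in Q. rewrite Rmult_0_r, !remainder_0 in Q. lra.
Qed.

Lemma remainder_taylor f c n u :
  remainder f c 0 n u = f (c - u) - Re (csum (fun k => RtoC (taylor_coef f c k) * RtoC (- u) ^ k)%C n).
Proof.
  induction n as [|n IH].
  - simpl. unfold refl. simpl. ring.
  - simpl remainder. rewrite IH. simpl csum.
    rewrite <- RtoC_pow, <- RtoC_mult, re_plus, re_RtoC. unfold refl, taylor_coef. simpl plus.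
    replace (- u) with (-1 * u) by ring. rewrite Rminus_0_r, Rpow_mult_distr. unfold Rdiv. ring.
Qed.

Lemma remainder_le_2 f c n u : alternating f -> 0 <= u < c -> (2 <= n)%nat ->
  remainder f c 0 n u <= remainder f c 0 2 u.
Proof.
  intros Hf Hu Hn. induction Hn as [|n Hn IH]; [lra|].
  change (remainder f c 0 (S n) u) with
    (remainder f c 0 n u - refl f c (0 + n) 0 * (u ^ n / INR (fact n))).
  assert (0 <= refl f c (0 + n) 0 * (u ^ n / INR (fact n))); [|lra].
  apply Rmult_le_pos.
  - apply Hf; [lia|lra].
  - apply Rdiv_le_0_compat; [apply pow_le; lra|apply INR_fact_lt_0].
Qed.

(** Bernstein's theorem on the analyticity of absolutely monotone functions, here with signs from
    order 2 on. Comparing the remainder at [u] with the one at a larger radius [v < c] gives a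
    geometric factor. *)
Lemma alternating_taylor f c y : alternating f -> 0 < y < c ->
  cconv (taylor_sum f c (RtoC y - RtoC c)) (RtoC (f y)).
Proof.
  intros Hf Hy.
  set (u := c - y). set (v := c - y / 2). set (s := u / v).
  assert (Hu : 0 < u) by (unfold u; lra). assert (Hv : 0 < v < c) by (unfold v; lra).
  assert (Hs : 0 <= s <= 1).
  { unfold s. split; [apply Rdiv_le_0_compat; lra|]. apply Rmult_le_reg_r with v; [lra|].
    unfold Rdiv. rewrite Rmult_assoc, Rinv_l by lra. unfold u, v. lra. }
  assert (Hs1 : s < 1).
  { unfold s. apply Rmult_lt_reg_r with v; [lra|].
    unfold Rdiv. rewrite Rmult_assoc, Rinv_l by lra. unfold u, v. lra. }
  assert (Esv : s * v = u) by (unfold s; field; lra).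
  intros eps He.
  set (B := remainder f c 0 2 v).
  assert (HB : 0 <= B) by (apply remainder_nonneg; auto; lra).
  destruct (pow_lt_1_zero s) with (y := eps / (B + 1)) as [N HN].
  { rewrite Rabs_pos_eq; lra. } { apply Rdiv_lt_0_compat; lra. }
  exists (N + 2)%nat. intros n Hn. specialize (HN n ltac:(lia)).
  rewrite Rabs_pos_eq in HN by (apply pow_le; lra).
  assert (R1 := remainder_nonneg f c 0 n u Hf ltac:(lia) ltac:(unfold u in *; lra)).
  assert (R2 := remainder_scale f c 0 n v s Hf ltac:(lia) ltac:(lra) Hs). rewrite Esv in R2.
  assert (R3 := remainder_le_2 f c n v Hf ltac:(lra) ltac:(lia)). fold B in R3.
  assert (R4 : remainder f c 0 n u < eps).
  { assert (0 <= s ^ n) by (apply pow_le; lra).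
    apply Rle_lt_trans with (s ^ n * (B + 1)).
    - eapply Rle_trans; [exact R2|]. apply Rmult_le_compat_l; lra.
    - apply Rlt_le_trans with (eps / (B + 1) * (B + 1)); [|right; field; lra].
      apply Rmult_lt_compat_r; lra. }
  rewrite remainder_taylor in R1, R4. replace (c - u) with y in R1, R4 by (unfold u; ring).
  replace (RtoC y - RtoC c)%C with (RtoC (- u)) by (rewrite <- RtoC_minus; f_equal; unfold u; ring).
  assert (HR : forall m, csum (fun k => RtoC (taylor_coef f c k) * RtoC (- u) ^ k)%C m =
     RtoC (Re (csum (fun k => RtoC (taylor_coef f c k) * RtoC (- u) ^ k)%C m))).
  { clear. induction m as [|m IH]; [reflexivity|]. simpl csum. rewrite IH.
    rewrite <- RtoC_pow, <- RtoC_mult, <- RtoC_plus, re_RtoC. reflexivity. }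
  rewrite HR, <- RtoC_minus, Cmod_R. apply Rabs_def1; lra.
Qed.

(** With the known signs, absolute values of terms telescope as remainders; summability and tail
    bounds both come from this. *)
Lemma taylor_coef_abs f c n u : alternating f -> 0 < c -> (2 <= n)%nat -> 0 <= u ->
  Rabs (taylor_coef f c n) * u ^ n = remainder f c 0 n u - remainder f c 0 (S n) u.
Proof.
  intros Hf Hc Hn Hu. simpl remainder. unfold refl, taylor_coef. rewrite Rminus_0_r.
  assert (HF := INR_fact_lt_0 n). assert (HP := proj2 Hf n c Hn Hc).
  unfold Rdiv. rewrite Rabs_mult, (Rabs_pos_eq (/ _)) by (apply Rlt_le, Rinv_0_lt_compat; auto).
  rewrite <- (Rmult_1_l (Rabs (Derive_n f n c))), <- (pow_1_abs n), <- Rabs_mult.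
  rewrite Rabs_pos_eq by auto. simpl plus. field. lra.
Qed.

(** Terms of order at least [K] shrink by at least [(rho / rho') ^ K] from radius [rho'] to [rho],
    and at [rho'] they telescope. The resulting bound depends on [f] only through two values and one
    slope, so it is uniform along a convergent family. *)
Lemma alternating_tail f c rho rho' w l K : alternating f -> 0 <= rho <= rho' -> 0 < rho' < c ->
  Cmod w <= rho -> (2 <= K)%nat ->
  cconv (taylor_sum f c w) l ->
  Cmod (l - taylor_sum f c w K) <=
    (rho / rho') ^ K * remainder f c 0 2 rho'.
Proof.
  intros Hf Hr Hr' Hw HK Hl.
  set (u := fun n => (RtoC (taylor_coef f c n) * w ^ n)%C) in *.
  set (q := rho / rho').
  assert (Hq : 0 <= q <= 1).
  { unfold q. split; [apply Rdiv_le_0_compat; lra|]. apply Rmult_le_reg_r with rho'; [lra|].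
    unfold Rdiv. rewrite Rmult_assoc, Rinv_l by lra. lra. }
  assert (Hqr : q * rho' = rho) by (unfold q; field; lra).
  assert (HqK : 0 <= q ^ K) by (apply pow_le; lra).
  assert (Hsum : forall N, (K <= N)%nat -> Cmod (csum u N - csum u K) <=
     q ^ K * (remainder f c 0 K rho' - remainder f c 0 N rho')).
  { intros N HN. induction HN as [|N HN IH].
    - replace (csum u K - csum u K)%C with (RtoC 0) by ring. rewrite Cmod_0. lra.
    - simpl csum. replace (csum u N + u N - csum u K)%C with ((csum u N - csum u K) + u N)%C by ring.
      eapply Rle_trans; [apply Cmod_triangle|].
      assert (Cmod (u N) <= q ^ K * (Rabs (taylor_coef f c N) * rho' ^ N)).
      { unfold u. rewrite Cmod_mult, Cmod_R, Cmod_pow.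
        replace (q ^ K * (Rabs (taylor_coef f c N) * rho' ^ N)) with
          (Rabs (taylor_coef f c N) * (q ^ K * rho' ^ N)) by ring.
        apply Rmult_le_compat_l; [apply Rabs_pos|].
        apply Rle_trans with (rho ^ N); [apply pow_incr; split; [apply Cmod_ge_0|auto]|].
        rewrite <- Hqr, Rpow_mult_distr. apply Rmult_le_compat_r; [apply pow_le; lra|].
        replace N with (K + (N - K))%nat by lia. rewrite pow_add.
        assert (q ^ (N - K) <= 1) by (rewrite <- (pow1 (N - K)); apply pow_incr; lra).
        assert (q ^ K * q ^ (N - K) <= q ^ K * 1) by (apply Rmult_le_compat_l; auto). lra. }
      rewrite taylor_coef_abs in H by (auto; try lra; lia).
      rewrite Rmult_minus_distr_l in *. lra. }
  apply Rle_plus_epsilon. intros e He. destruct (Hl e He) as [N HN].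
  specialize (HN (N + K)%nat ltac:(lia)). specialize (Hsum (N + K)%nat ltac:(lia)).
  replace (l - csum u K)%C with (- (csum u (N + K) - l) + (csum u (N + K) - csum u K))%C by ring.
  eapply Rle_trans; [apply Cmod_triangle|]. rewrite Cmod_opp.
  assert (P := remainder_nonneg f c 0 (N + K) rho' Hf ltac:(lia) ltac:(lra)).
  assert (P2 := remainder_le_2 f c K rho' Hf ltac:(lra) HK).
  assert (q ^ K * (remainder f c 0 K rho' - remainder f c 0 (N + K) rho') <= q ^ K * remainder f c 0 2 rho')
    by (apply Rmult_le_compat_l; lra).
  lra.
Qed.

Lemma alternating_summable f c rho : alternating f -> 0 < rho < c ->
  ex_series (fun n => Rabs (taylor_coef f c n) * rho ^ n).
Proof.
  intros Hf Hr. apply (ex_series_incr_n _ 2).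
  assert (Hpos : forall n, 0 <= Rabs (taylor_coef f c n) * rho ^ n).
  { intros n. apply Rmult_le_pos; [apply Rabs_pos|apply pow_le; lra]. }
  assert (Hsum : forall N, sum_n (fun n => Rabs (taylor_coef f c (2 + n)) * rho ^ (2 + n)) N =
    remainder f c 0 2 rho - remainder f c 0 (3 + N) rho).
  { induction N as [|N IH].
    - rewrite sum_O. apply taylor_coef_abs; auto; lra.
    - rewrite sum_Sn, IH. rewrite taylor_coef_abs; auto; try lra; try lia.
      unfold plus. simpl Nat.add. simpl. ring. }
  destruct (ex_finite_lim_seq_incr (sum_n (fun n => Rabs (taylor_coef f c (2 + n)) * rho ^ (2 + n)))
    (remainder f c 0 2 rho)) as [l Hl].
  - intros n. rewrite sum_Sn. unfold plus. simpl. specialize (Hpos (2 + S n)%nat). simpl in Hpos. lra.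
  - intros n. rewrite Hsum.
    assert (P := remainder_nonneg f c 0 (3 + n) rho Hf ltac:(lia) ltac:(lra)). lra.
  - exists l. exact Hl.
Qed.

Definition disc_extension (f : R -> R) (c : R) (z : C) : C := power_series (taylor_coef f c) (z - RtoC c)%C.

Lemma disc_extension_cconv f c z : alternating f -> 0 < c -> Cmod (z - RtoC c) < c ->
  cconv (taylor_sum f c (z - RtoC c)) (disc_extension f c z).
Proof.
  intros Hf Hc Hz. assert (H0 := Cmod_ge_0 (z - RtoC c)).
  apply power_series_cconv with ((Cmod (z - RtoC c) + c) / 2); [|lra].
  apply alternating_summable; auto. lra.
Qed.

Lemma disc_extension_derive f c z : alternating f -> 0 < c -> Cmod (z - RtoC c) < c ->
  ex_Cderive (disc_extension f c) z.
Proof.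
  intros Hf Hc Hz. assert (H0 := Cmod_ge_0 (z - RtoC c)).
  destruct (power_series_ex_derive (taylor_coef f c) ((Cmod (z - RtoC c) + c) / 2) (z - RtoC c)%C) as [l Hl].
  { apply alternating_summable; auto. lra. } { lra. }
  exists (RtoC 1 * l)%C.
  apply (is_derive_C_C_comp (power_series (taylor_coef f c)) (fun w => (w - RtoC c)%C)); auto.
  apply (is_derive_C_minus_const (fun w => w)), is_derive_C_id.
Qed.

Lemma disc_extension_real f c y : alternating f -> 0 < y < c -> disc_extension f c (RtoC y) = RtoC (f y).
Proof.
  intros Hf Hy. eapply cconv_unique; [|apply alternating_taylor; eauto].
  apply disc_extension_cconv; auto; try lra.
  rewrite <- RtoC_minus, Cmod_R. rewrite Rabs_left1; lra.
Qed.

(** The larger disc contains the smaller one. Expanded again at [c], the series from [c'] has the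
    Taylor coefficients of [f], since it equals [f] on the axis near [c]. *)
Lemma disc_extension_consistent f c c' z : alternating f -> 0 < c < c' -> Cmod (z - RtoC c) < c ->
  disc_extension f c' z = disc_extension f c z.
Proof.
  intros Hf Hc Hz.
  destruct (real_axis_taylor (disc_extension f c') (fun x => Re (disc_extension f c' (RtoC x))) c c) as [_ H].
  - lra.
  - intros w Hw. apply disc_extension_derive; auto; try lra.
    replace (w - RtoC c')%C with ((w - RtoC c) + RtoC (c - c'))%C by (rewrite RtoC_minus; ring).
    eapply Rle_lt_trans; [apply Cmod_triangle|]. rewrite Cmod_R, Rabs_left1; lra.
  (* Here [x] ranges up to [2 * c], which may exceed the range [x < c'] of [disc_extension_real];
     reality comes from the real coefficients instead. *)
  - intros x Hx. apply injective_projections; [reflexivity|].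
    change (Series (fun n => Im (RtoC (taylor_coef f c' n) * (RtoC x - RtoC c') ^ n)) = 0).
    (* The zero term is written [0 * 0] so that [Series_scal_l] evaluates the sum. *)
    rewrite (Series_ext _ (fun _ => 0 * 0)).
    + rewrite Series_scal_l. ring.
    + intros n. rewrite <- RtoC_minus, <- RtoC_pow. unfold Im. simpl. ring.
  - specialize (H z Hz). eapply cconv_unique; [exact H|].
    eapply cconv_ext; [|apply disc_extension_cconv; auto; lra].
    intros n.
    assert (E : taylor_coef f c n = taylor_coef (fun x => Re (disc_extension f c' (RtoC x))) c n);
      [|cbv beta; now rewrite E].
    unfold taylor_coef. f_equal. apply Derive_n_ext_loc.
    assert (Hd : 0 < Rmin c (c' - c)) by (apply Rmin_pos; lra).
    exists (mkposreal _ Hd). intros y Hy. change (Rabs (y - c) < Rmin c (c' - c)) in Hy.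
    pose proof (Rmin_l c (c' - c)). pose proof (Rmin_r c (c' - c)). apply Rabs_def2 in Hy.
    rewrite disc_extension_real; auto. lra.
Qed.

Lemma disc_condition z c : 0 < c -> (Cmod (z - RtoC c) < c <-> Re z ^ 2 + Im z ^ 2 < 2 * c * Re z).
Proof.
  intros Hc. destruct z as [x y]. unfold Cmod. simpl.
  replace ((x + - c) * ((x + - c) * 1) + (y + - 0) * ((y + - 0) * 1)) with
    (x * (x * 1) + y * (y * 1) - 2 * c * x + c * c) by ring.
  split; intros H.
  - set (s := x * (x * 1) + y * (y * 1) - 2 * c * x + c * c) in *.
    destruct (Rle_lt_dec s 0) as [Hs|Hs]; [unfold s in Hs; nra|].
    assert (E := sqrt_sqrt s (Rlt_le _ _ Hs)). assert (P := sqrt_pos s).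
    assert (s < c * c) by (rewrite <- E; nra). unfold s in *. nra.
  - apply Rlt_le_trans with (sqrt (c * c)); [|right; apply sqrt_square; lra].
    apply sqrt_lt_1_alt. pose proof (Rle_0_sqr (x - c)). pose proof (Rle_0_sqr y). unfold Rsqr in *. lra.
Qed.

(** The disc [|z - c| < c] contains [z] exactly when [c > |z|^2 / (2 Re z)]; this is twice that
    threshold. *)
Definition center (z : C) : R := (Re z ^ 2 + Im z ^ 2) / Re z.

Lemma center_pos z : HP z -> 0 < center z.
Proof. intros Hz. unfold HP in Hz. unfold center. apply Rdiv_lt_0_compat; auto. nra. Qed.

Lemma center_disc z : HP z -> Cmod (z - RtoC (center z)) < center z.
Proof.
  intros Hz. apply disc_condition; [apply center_pos; auto|]. unfold HP in Hz.
  replace (2 * center z * Re z) with (2 * (Re z ^ 2 + Im z ^ 2)) by (unfold center; field; lra). nra.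
Qed.

Lemma disc_in_HP z c : 0 < c -> Cmod (z - RtoC c) < c -> HP z.
Proof. intros Hc H. apply disc_condition in H; auto. unfold HP. nra. Qed.

Definition extension (f : R -> R) (z : C) : C := disc_extension f (center z) z.

Lemma extension_disc f c z : alternating f -> 0 < c -> Cmod (z - RtoC c) < c ->
  extension f z = disc_extension f c z.
Proof.
  intros Hf Hc Hz. assert (HH := disc_in_HP z c Hc Hz).
  assert (H1 := center_pos z HH). assert (H2 := center_disc z HH). unfold extension.
  destruct (Rtotal_order (center z) c) as [H|[H|H]].
  - symmetry. apply disc_extension_consistent; auto.
  - now rewrite H.
  - apply disc_extension_consistent; auto.
Qed.

Lemma extension_Hol f : alternating f -> Hol HP allC (extension f).
Proof.
  intros Hf. split; [|intros; exact I]. intros z Hz.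
  assert (H1 := center_pos z Hz). assert (H2 := center_disc z Hz).
  set (c := center z) in *.
  destruct (disc_extension_derive f c z Hf H1 H2) as [l Hl].
  exists l. apply is_derive_C_spec. intros eps He.
  destruct (proj1 (is_derive_C_spec _ _ _) Hl eps He) as [d [Hd Hd']].
  exists (Rmin d (c - Cmod (z - RtoC c))). split; [apply Rmin_pos; lra|].
  intros w Hw.
  assert (W1 : Cmod (w - z) < d) by rmin_lt Hw.
  assert (W2 : Cmod (w - z) < c - Cmod (z - RtoC c)) by rmin_lt Hw.
  assert (W3 : Cmod (w - RtoC c) < c).
  { replace (w - RtoC c)%C with ((w - z) + (z - RtoC c))%C by ring.
    eapply Rle_lt_trans; [apply Cmod_triangle|]. lra. }
  rewrite !(extension_disc f c) by auto. auto.
Qed.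

Lemma extension_real f x : alternating f -> 0 < x -> extension f (RtoC x) = RtoC (f x).
Proof.
  intros Hf Hx. rewrite (extension_disc f (2 * x)); auto; try lra.
  - apply disc_extension_real; auto. lra.
  - rewrite <- RtoC_minus, Cmod_R, Rabs_left1; lra.
Qed.

Lemma HP_taylor (F : C -> C) (f : R -> R) : Hol HP allC F ->
  (forall x, 0 < x -> F (RtoC x) = RtoC (f x)) ->
  smooth f /\
  forall c z, 0 < c -> Cmod (z - RtoC c) < c ->
    cconv (taylor_sum f c (z - RtoC c)) (F z).
Proof.
  intros [HF _] Hf.
  assert (H : forall c, 0 < c -> (forall n, ex_derive_n f n c) /\ forall z, Cmod (z - RtoC c) < c ->
    cconv (taylor_sum f c (z - RtoC c)) (F z)).
  { intros c Hc. apply real_axis_taylor; auto.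
    - intros w Hw. apply HF. apply (disc_in_HP w c); auto.
    - intros x Hx. apply Hf. apply Rabs_def2 in Hx. lra. }
  split.
  - intros n x Hx. apply H; auto.
  - intros c z Hc. apply H; auto.
Qed.

(** Identity theorem: at [center z] both functions have the Taylor series of [f], which converges to
    each of them at [z]. *)
Lemma HP_identity (F G : C -> C) (f : R -> R) : Hol HP allC F -> Hol HP allC G ->
  (forall x, 0 < x -> F (RtoC x) = RtoC (f x)) -> (forall x, 0 < x -> G (RtoC x) = RtoC (f x)) ->
  forall z, HP z -> F z = G z.
Proof.
  intros HF HG Ff Gf z Hz.
  destruct (HP_taylor F f HF Ff) as [_ H1]. destruct (HP_taylor G f HG Gf) as [_ H2].
  exact (cconv_unique _ _ _ (H1 _ z (center_pos z Hz) (center_disc z Hz))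
    (H2 _ z (center_pos z Hz) (center_disc z Hz))).
Qed.

(** For [n >= 1] the term of order [n] at [- rho] equals [- |a_n| * rho ^ n], the least real part
    possible for a number of modulus at most [|a_n| * rho ^ n]. Hence the real part at [z] is at
    least the value at [c - rho]. *)
Lemma bernstein_extension_Re (F : C -> C) (v : R -> R) : Hol HP allC F ->
  (forall x, 0 < x -> F (RtoC x) = RtoC (v x)) -> (forall x, 0 < x -> 0 < v x) ->
  (forall n x, (1 <= n)%nat -> 0 < x -> 0 <= (-1) ^ (n + 1) * Derive_n v n x) ->
  forall z, HP z -> HP (F z).
Proof.
  intros HF Fv Hv Hs z Hz.
  destruct (HP_taylor F v HF Fv) as [_ HT].
  assert (Hc := center_pos z Hz). assert (Hzc := center_disc z Hz).
  set (c := center z) in *. set (w := (z - RtoC c)%C) in *.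
  assert (Hw := Cmod_ge_0 w).
  set (rho := (Cmod w + c) / 2). assert (Hrho : Cmod w <= rho < c) by (unfold rho; lra).
  set (y := c - rho). assert (Hy : 0 < y) by (unfold y; lra).
  assert (T1 := HT c z Hc Hzc). fold w in T1.
  assert (Ey : (RtoC y - RtoC c)%C = RtoC (- rho)) by (rewrite <- RtoC_minus; f_equal; unfold y; ring).
  assert (T2 := HT c (RtoC y) Hc). rewrite Ey, Cmod_R, Rabs_Ropp, Rabs_pos_eq, Fv in T2 by lra.
  specialize (T2 ltac:(lra)).
  assert (Hcmp : forall N, Re (csum (fun n => RtoC (taylor_coef v c n) * RtoC (- rho) ^ n)%C N) <=
     Re (taylor_sum v c w N)).
  { induction N as [|N IH]; [apply Rle_refl|]. simpl csum. rewrite !re_plus.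
    apply Rplus_le_compat; auto.
    destruct N as [|N]; [simpl; lra|]. set (n := S N) in *.
    rewrite <- RtoC_pow, <- RtoC_mult, re_RtoC.
    assert (Hsn := Hs n c ltac:(unfold n; lia) Hc).
    assert (HA : taylor_coef v c n * (- rho) ^ n = - (Rabs (taylor_coef v c n) * rho ^ n)).
    { assert (HF' := INR_fact_lt_0 n).
      assert (E : Rabs (taylor_coef v c n) = (-1) ^ (n + 1) * taylor_coef v c n).
      { rewrite <- (Rabs_pos_eq ((-1) ^ (n + 1) * taylor_coef v c n)).
        - rewrite Rabs_mult, pow_1_abs. ring.
        - unfold taylor_coef, Rdiv. rewrite <- Rmult_assoc. apply Rmult_le_pos; auto.
          apply Rlt_le, Rinv_0_lt_compat; auto. }
      rewrite E. replace (- rho) with (-1 * rho) by ring. rewrite Rpow_mult_distr, pow_add. simpl ((-1) ^ 1). ring. }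
    rewrite HA.
    assert (HB : Cmod (RtoC (taylor_coef v c n) * w ^ n) <= Rabs (taylor_coef v c n) * rho ^ n).
    { rewrite Cmod_mult, Cmod_R, Cmod_pow. apply Rmult_le_compat_l; [apply Rabs_pos|]. apply pow_incr. lra. }
    assert (HC := re_le_Cmod (RtoC (taylor_coef v c n) * w ^ n)%C). apply Rabs_le_between in HC. lra. }
  unfold HP. assert (Hvy := Hv y Hy).
  (* Two errors, each strictly below [v y / 2], leave the real part strictly positive. *)
  destruct (T1 (v y / 2) ltac:(lra)) as [N1 H1]. destruct (T2 (v y / 2) ltac:(lra)) as [N2 H2].
  specialize (H1 (N1 + N2)%nat ltac:(lia)). specialize (H2 (N1 + N2)%nat ltac:(lia)).
  specialize (Hcmp (N1 + N2)%nat).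
  assert (G1 := Rle_lt_trans _ _ _ (re_le_Cmod _) H1). assert (G2 := Rle_lt_trans _ _ _ (re_le_Cmod _) H2).
  unfold Cminus in G1, G2. rewrite re_plus, re_opp in G1, G2. rewrite re_RtoC in G2.
  apply Rabs_def2 in G1, G2. lra.
Qed.

Lemma finite_taylor_limit {T : Type} (F : (T -> Prop) -> Prop) {FF : ProperFilter F}
    (g : T -> R -> R) (p : R -> R) (c rho : R) (K : nat) :
  0 <= rho -> (forall n, filterlim (fun t => Derive_n (g t) n c) F (locally (Derive_n p n c))) ->
  forall eps, 0 < eps -> F (fun t => forall w, Cmod w <= rho ->
    Cmod (taylor_sum (g t) c w K -
          taylor_sum p c w K) < eps).
Proof.
  intros Hrho H. induction K as [|K IH]; intros eps He.
  - apply filter_forall. intros t w _. simpl. replace (RtoC 0 - RtoC 0)%C with (RtoC 0) by ring.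
    rewrite Cmod_0. auto.
  - assert (Hp : 0 <= rho ^ K) by (apply pow_le; auto).
    assert (HF := INR_fact_lt_0 K).
    assert (He2 : 0 < eps / 2 / (rho ^ K + 1)) by (apply Rdiv_lt_0_compat; lra).
    assert (He3 : 0 < eps / 2 / (rho ^ K + 1) * INR (fact K)) by (apply Rmult_lt_0_compat; auto).
    assert (HK : F (fun t => Rabs (Derive_n (g t) K c - Derive_n p K c) < eps / 2 / (rho ^ K + 1) * INR (fact K)))
      by exact (H K _ (locally_ball (Derive_n p K c) (mkposreal _ He3))).
    assert (HI := IH (eps / 2) ltac:(lra)).
    refine (filter_imp _ _ _ (filter_and _ _ HI HK)).
    intros t [H1 H2] w Hw. specialize (H1 w Hw). simpl csum.
    set (a := taylor_sum (g t) c w K) in *.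
    set (b := taylor_sum p c w K) in *.
    replace (a + RtoC (taylor_coef (g t) c K) * w ^ K - (b + RtoC (taylor_coef p c K) * w ^ K))%C with
      ((a - b) + RtoC (taylor_coef (g t) c K - taylor_coef p c K) * w ^ K)%C by (rewrite RtoC_minus; ring).
    eapply Rle_lt_trans; [apply Cmod_triangle|]. rewrite Cmod_mult, Cmod_R, Cmod_pow.
    assert (Q : Rabs (taylor_coef (g t) c K - taylor_coef p c K) < eps / 2 / (rho ^ K + 1)).
    { unfold taylor_coef. replace (Derive_n (g t) K c / INR (fact K) - Derive_n p K c / INR (fact K)) with
        ((Derive_n (g t) K c - Derive_n p K c) * / INR (fact K)) by (field; lra).
      rewrite Rabs_mult, (Rabs_pos_eq (/ _)) by (apply Rlt_le, Rinv_0_lt_compat; auto).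
      apply Rmult_lt_reg_r with (INR (fact K)); auto. rewrite Rmult_assoc, Rinv_l by lra. lra. }
    assert (Hw2 : Cmod w ^ K <= rho ^ K) by (apply pow_incr; split; [apply Cmod_ge_0|auto]).
    assert (Hw3 : 0 <= Cmod w ^ K) by (apply pow_le, Cmod_ge_0).
    assert (Rabs (taylor_coef (g t) c K - taylor_coef p c K) * Cmod w ^ K <= eps / 2 / (rho ^ K + 1) * (rho ^ K + 1)).
    { apply Rmult_le_compat; try lra. apply Rabs_pos. }
    replace (eps / 2 / (rho ^ K + 1) * (rho ^ K + 1)) with (eps / 2) in H0 by (field; lra). lra.
Qed.

Lemma remainder_2_bound f c u : 0 <= u -> remainder f c 0 2 u <= Rabs (f (c - u)) + Rabs (f c) + u * Rabs (Derive f c).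
Proof.
  intros Hu. simpl. unfold refl. simpl. rewrite !Rminus_0_r.
  change (Derive (fun x => f x) c) with (Derive f c).
  pose proof (RRle_abs (f (c - u))). pose proof (RRle_abs (- f c)). rewrite Rabs_Ropp in *.
  assert (u * Derive f c <= u * Rabs (Derive f c)) by (apply Rmult_le_compat_l; [auto|apply RRle_abs]).
  lra.
Qed.

(* The Taylor tails at c are dominated, uniformly in t, by the value of the second remainder
   at a slightly larger radius; so pointwise convergence on the axis is enough. *)
Lemma loc_unif_lim_of_axis {T : Type} (F : (T -> Prop) -> Prop) {FF : ProperFilter F}
    (G : T -> C -> C) (g : T -> R -> R) (Phi : C -> C) (p : R -> R) :
  F (fun t => alternating (g t) /\ Hol HP allC (G t) /\
       forall x, 0 < x -> G t (RtoC x) = RtoC (g t x)) ->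
  Hol HP allC Phi -> (forall x, 0 < x -> Phi (RtoC x) = RtoC (p x)) ->
  (forall x, 0 < x -> filterlim (fun t => g t x) F (locally (p x))) ->
  loc_unif_lim F HP G Phi.
Proof.
  intros HG HPhi Phip Hlim.
  destruct (alternating_limit F g p) as [Hp HD]; auto.
  { refine (filter_imp _ _ _ HG). intros t Ht. apply Ht. }
  destruct (HP_taylor Phi p HPhi Phip) as [_ TP].
  intros z Hz.
  assert (Hc := center_pos z Hz). assert (Hzc := center_disc z Hz).
  set (c := center z) in *. assert (Hw0 := Cmod_ge_0 (z - RtoC c)).
  (* Divides the gap to the boundary into three: points within [d] of [z] have distance at most
     [rho] from [c], and [rho < rho' < c] leaves room for a geometric tail. *)
  set (d := (c - Cmod (z - RtoC c)) / 3). assert (Hd : 0 < d) by (unfold d; lra).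
  set (rho := Cmod (z - RtoC c) + d). set (rho' := rho + d).
  assert (Hr : 0 < rho < rho') by (unfold rho', rho; lra).
  assert (Hr' : rho' < c) by (unfold rho', rho, d in *; lra).
  exists (mkposreal d Hd). intros eps. assert (He := cond_pos eps).
  (* Bounds the second remainder at [rho'] both for [p] and, thanks to the added ones, for [g t]
     eventually. *)
  set (B := (Rabs (p (c - rho')) + 1) + (Rabs (p c) + 1) + rho' * (Rabs (Derive_n p 1 c) + 1)).
  assert (HB : 0 < B).
  { unfold B. pose proof (Rabs_pos (p (c - rho'))). pose proof (Rabs_pos (p c)).
    pose proof (Rabs_pos (Derive_n p 1 c)).
    assert (0 <= rho' * (Rabs (Derive_n p 1 c) + 1)) by (apply Rmult_le_pos; lra). lra. }
  set (q := rho / rho').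
  assert (Hq : 0 <= q < 1).
  { unfold q. split; [apply Rdiv_le_0_compat; lra|]. apply Rmult_lt_reg_r with rho'; [lra|].
    unfold Rdiv. rewrite Rmult_assoc, Rinv_l by lra. lra. }
  destruct (pow_lt_1_zero q) with (y := eps / 4 / B) as [K0 HK0].
  { rewrite Rabs_pos_eq; lra. } { apply Rdiv_lt_0_compat; lra. }
  set (K := (K0 + 2)%nat). specialize (HK0 K ltac:(unfold K; lia)).
  rewrite Rabs_pos_eq in HK0 by (apply pow_le; lra).
  assert (HqB : q ^ K * B < eps / 4).
  { apply Rlt_le_trans with (eps / 4 / B * B); [apply Rmult_lt_compat_r; auto|right; field; lra]. }
  assert (HqK : 0 <= q ^ K) by (apply pow_le; lra).
  assert (B1 := filterlim_Rabs_bounded F _ _ (HD 0%nat (c - rho') ltac:(lra))).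
  assert (B2 := filterlim_Rabs_bounded F _ _ (HD 0%nat c Hc)).
  assert (B3 := filterlim_Rabs_bounded F _ _ (HD 1%nat c Hc)).
  assert (HFin := finite_taylor_limit F g p c rho K ltac:(lra) (fun n => HD n c Hc) (eps / 4) ltac:(lra)).
  assert (Htail : forall f l w, alternating f -> Rabs (f (c - rho')) <= Rabs (p (c - rho')) + 1 ->
    Rabs (f c) <= Rabs (p c) + 1 -> Rabs (Derive f c) <= Rabs (Derive_n p 1 c) + 1 -> Cmod w <= rho ->
    cconv (taylor_sum f c w) l ->
    Cmod (l - taylor_sum f c w K) < eps / 4).
  { intros f l w Hf F1 F2 F3 Hw Hl.
    eapply Rle_lt_trans; [apply (alternating_tail f c rho rho' w l K); auto; try lra; unfold K; lia|].
    fold q. eapply Rle_lt_trans; [|exact HqB]. apply Rmult_le_compat_l; auto.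
    eapply Rle_trans; [apply remainder_2_bound; lra|]. unfold B.
    assert (rho' * Rabs (Derive f c) <= rho' * (Rabs (Derive_n p 1 c) + 1)) by (apply Rmult_le_compat_l; lra).
    lra. }
  refine (filter_imp _ _ _ (filter_and _ _ HG (filter_and _ _ HFin (filter_and _ _ B1 (filter_and _ _ B2 B3))))).
  intros t [[Hg [HGt Gg]] [H1 [H2 [H3 H4]]]] w Hw Hwz. simpl in Hwz.
  assert (Hwc : Cmod (w - RtoC c) <= rho).
  { replace (w - RtoC c)%C with ((w - z) + (z - RtoC c))%C by ring.
    eapply Rle_trans; [apply Cmod_triangle|]. unfold rho. lra. }
  destruct (HP_taylor (G t) (g t) HGt Gg) as [_ TG].
  specialize (TG c w Hc ltac:(lra)). specialize (TP c w Hc ltac:(lra)).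
  specialize (H1 _ Hwc).
  assert (T1 := Htail (g t) _ _ Hg H2 H3 H4 Hwc TG).
  assert (T2 := Htail p _ _ Hp ltac:(lra) ltac:(lra) ltac:(change (Derive p c) with (Derive_n p 1 c); lra) Hwc TP).
  set (a := taylor_sum (g t) c (w - RtoC c) K) in *.
  set (b := taylor_sum p c (w - RtoC c) K) in *.
  replace (G t w - Phi w)%C with ((G t w - a) + ((a - b) + - (Phi w - b)))%C by ring.
  eapply Rle_lt_trans; [apply Cmod_triangle|].
  pose proof (Cmod_triangle (a - b) (- (Phi w - b))). rewrite Cmod_opp in H. lra.
Qed.

(** * Bernstein generators *)

(** [w] stands for [- v_t]; the identity contributes to orders 0 and 1 only. *)
Lemma alternating_difference_quotient w t : alternating w -> 0 < t ->
  alternating (fun x => (x + w x) / t).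
Proof.
  intros Hw Ht.
  set (d := fun n x => match n with
    | O => (x + w x) / t | 1%nat => (1 + Derive_n w 1 x) / t | _ => Derive_n w n x / t end).
  assert (Hd : forall n x, 0 < x -> is_derive (d n) x (d (S n) x)).
  { assert (Hk : forall k x, 0 < x -> is_derive (Derive_n w k) x (Derive_n w (S k) x))
      by (intros; apply smooth_is_derive; auto; apply Hw).
    assert (Hdiv : forall (u : R -> R) x l, is_derive u x l -> is_derive (fun y => u y / t) x (l / t)).
    { intros u x l Hu. unfold Rdiv. rewrite Rmult_comm.
      apply is_derive_ext with (fun y => / t * u y); [intros; apply Rmult_comm|].
      apply is_derive_scal. exact Hu. }
    intros [|[|n]] x Hx; simpl; apply Hdiv.
    - apply (is_derive_plus (fun y => y) w); [apply @is_derive_id|apply (Hk 0%nat); auto].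
    - rewrite <- (Rplus_0_l (Derive _ x)).
      apply (is_derive_plus (fun _ => 1) (Derive_n w 1)); [apply @is_derive_const|apply (Hk 1%nat); auto].
    - apply (Hk (S (S n))); auto. }
  destruct (Derive_n_tower d Hd) as [S1 S2]. split; [exact S1|].
  intros n x Hn Hx. change (0 <= (-1) ^ n * Derive_n (d 0%nat) n x). rewrite S2 by auto.
  destruct n as [|[|n]]; try lia. unfold d.
  unfold Rdiv. rewrite <- Rmult_assoc. apply Rmult_le_pos; [|apply Rlt_le, Rinv_0_lt_compat; auto].
  apply Hw; auto.
Qed.

(* [C_lim], hence [C_derive], is a limit along the horizontal line through the point: it only
   sees the real axis here. *)
Lemma C_derive_real_axis (F : C -> C) (q : R -> R) (x l : R) :
  (forall y, 0 < y -> F (RtoC y) = RtoC (q y)) -> 0 < x -> is_derive q x l ->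
  C_derive F (RtoC x) = RtoC l.
Proof.
  intros HF Hx Hq. unfold C_derive, C_lim.
  change (snd (RtoC x)) with 0. change (fst (RtoC x)) with x.
  assert (E : forall y, 0 < y -> y <> x ->
    ((F (y, 0) - F (RtoC x)) / ((y, 0) - RtoC x))%C = RtoC ((q y - q x) / (y - x))).
  { intros y Hy Hyx. change (y, 0) with (RtoC y). rewrite !HF by auto.
    rewrite <- !RtoC_minus, RtoC_div by lra. reflexivity. }
  assert (HL : Rbar_locally' x (fun y => 0 < y)).
  { apply (filter_le_within). apply locally_pos, Hx. }
  assert (HN : Rbar_locally' x (fun y => y <> x)).
  { exists (mkposreal 1 Rlt_0_1). intros y _ Hy. exact Hy. }
  apply injective_projections; cbn [fst snd].
  - rewrite (is_lim_unique _ x l); [reflexivity|].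
    apply is_lim_ext_loc with (fun y => (q y - q x) / (y - x)).
    { refine (filter_imp _ _ _ (filter_and _ _ HL HN)). intros y [H1 H2]. now rewrite E. }
    apply is_lim_spec. intros eps.
    destruct (proj1 (is_derive_Reals q x l) Hq eps (cond_pos eps)) as [d Hd].
    exists d. intros y Hy Hyx. change (Rabs (y - x) < d) in Hy.
    specialize (Hd (y - x) ltac:(lra) Hy). replace (x + (y - x)) with y in Hd by (simpl; lra). exact Hd.
  - rewrite (is_lim_unique _ x 0); [reflexivity|].
    apply is_lim_ext_loc with (fun _ => 0); [|apply is_lim_const].
    refine (filter_imp _ _ _ (filter_and _ _ HL HN)). intros y [H1 H2]. now rewrite E.
Qed.

Lemma completely_monotone_iff (F : C -> C) (p : R -> R) : smooth p ->
  (forall x, 0 < x -> F (RtoC x) = RtoC (p x)) ->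
  (completely_monotone (Finite 0) p_infty (fun x => C_derive (C_derive F) (RtoC x)) <-> alternating p).
Proof.
  intros Hs HF.
  assert (E2 : forall x, 0 < x -> C_derive (C_derive F) (RtoC x) = RtoC (Derive_n p 2 x)).
  { intros x Hx. apply C_derive_real_axis with (Derive_n p 1); auto.
    - intros y Hy. apply C_derive_real_axis with p; auto. apply (smooth_is_derive p 0); auto.
    - apply (smooth_is_derive p 1); auto. }
  set (h := fun x => Re (C_derive (C_derive F) (RtoC x))).
  assert (Eh : forall x, 0 < x -> locally x (fun y => Derive_n p 2 y = h y)).
  { intros x Hx. refine (filter_imp _ _ _ (locally_pos x Hx)). intros y Hy. unfold h. now rewrite E2. }
  assert (Ek : forall k x, 0 < x -> Derive_n h k x = Derive_n p (k + 2) x).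
  { intros k x Hx. rewrite <- Derive_n_comp. symmetry. apply Derive_n_ext_loc. auto. }
  split.
  - intros [_ [_ H3]]. split; auto. intros n x Hn Hx.
    specialize (H3 (n - 2)%nat x (conj Hx I)). fold h in H3. rewrite Ek in H3 by auto.
    replace (n - 2 + 2)%nat with n in H3 by lia.
    replace ((-1) ^ n) with ((-1) ^ (n - 2)); auto.
    replace n with (n - 2 + 2)%nat at 2 by lia. rewrite pow_add. ring.
  - intros Hp. split; [|split].
    + intros x [Hx _]. simpl in Hx. now rewrite E2.
    + intros k x [Hx _]. simpl in Hx. change (ex_derive_n h k x).
      apply ex_derive_n_ext_loc with (Derive_n p 2); auto.
      destruct k as [|k]; [exact I|].
      apply ex_derive_ext with (Derive_n p (k + 2)).
      * intros y. now rewrite <- Derive_n_comp.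
      * exact (Hs (S (k + 2)) x Hx).
    + intros k x [Hx _]. simpl in Hx. change (0 <= (-1) ^ k * Derive_n h k x). rewrite Ek by auto.
      replace ((-1) ^ k) with ((-1) ^ (k + 2)) by (rewrite pow_add; ring). apply Hp; auto. lia.
Qed.

Lemma filterlim_at_right_linear (u : R -> R) (l K : R) : 0 <= K ->
  (forall t, 0 < t < 1 -> Rabs (u t - l) <= K * t) -> filterlim u (at_right 0) (locally l).
Proof.
  intros HK H P [e He].
  assert (Hd : 0 < Rmin 1 (e / (K + 1))).
  { apply Rmin_pos; [lra|]. apply Rdiv_lt_0_compat; [apply cond_pos|lra]. }
  exists (mkposreal _ Hd). intros t Ht Ht0. apply He.
  change (Rabs (t - 0) < Rmin 1 (e / (K + 1))) in Ht. rewrite Rminus_0_r, Rabs_pos_eq in Ht by lra.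
  assert (T1 : t < 1) by rmin_lt Ht.
  assert (T2 : t < e / (K + 1)) by rmin_lt Ht.
  change (Rabs (u t - l) < e). eapply Rle_lt_trans; [apply H; lra|].
  apply Rle_lt_trans with ((K + 1) * t); [nra|].
  apply Rlt_le_trans with ((K + 1) * (e / (K + 1))); [|right; field; lra].
  apply Rmult_lt_compat_l; lra.
Qed.

(** By convexity, [p] minus its tangent at 1 is nonincreasing on [(0, 1]], so its limit at [0+] is a
    supremum. It is finite because [p x <= x * p 1], and the same inequality makes the limit of [p]
    nonpositive. *)
Lemma alternating_limit_at_0 p : alternating p -> (forall x y, 0 < y <= x -> x * p y <= y * p x) ->
  exists l, l <= 0 /\ filterlim p (at_right 0) (locally l).
Proof.
  intros Hp Hst.
  set (psi := fun x => p x - p 1 - Derive p 1 * (x - 1)).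
  assert (Hpsi : forall x y, 0 < x <= y -> y <= 1 -> psi y <= psi x).
  { intros x y Hxy Hy1. unfold psi.
    assert (A := alternating_tangent p y x Hp ltac:(lra) ltac:(lra)).
    assert (B := alternating_derive_nondecreasing p y 1 Hp ltac:(lra)). nra. }
  set (E := fun s => exists x, 0 < x <= 1 /\ s = psi x).
  destruct (completeness E) as [L [HL1 HL2]].
  { exists (2 * Rabs (p 1) + Rabs (Derive p 1)). intros s [x [Hx ->]]. unfold psi.
    assert (Q := Hst 1 x ltac:(lra)).
    assert (x * p 1 <= Rabs (p 1)).
    { pose proof (RRle_abs (p 1)). pose proof (Rabs_pos (p 1)). nra. }
    assert (- Derive p 1 * (x - 1) <= Rabs (Derive p 1)).
    { pose proof (RRle_abs (Derive p 1)). pose proof (Rabs_pos (Derive p 1)). nra. }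
    pose proof (RRle_abs (- p 1)). rewrite Rabs_Ropp in *. lra. }
  { exists (psi 1), 1. split; [lra|auto]. }
  (* Adds back the value at 0 of the tangent at 1. *)
  set (l := L + p 1 - Derive p 1).
  assert (Hlim : forall eps, 0 < eps -> exists d, 0 < d /\ forall x, 0 < x < d -> Rabs (p x - l) < eps).
  { intros eps He.
    assert (Hx0 : exists x0, 0 < x0 <= 1 /\ L - eps / 2 < psi x0).
    { destruct (classic (exists x0, 0 < x0 <= 1 /\ L - eps / 2 < psi x0)) as [|N]; auto. exfalso.
      assert (L <= L - eps / 2); [|lra]. apply HL2. intros s [x [Hx ->]].
      apply Rnot_lt_le. intros H. apply N. exists x. auto. }
    destruct Hx0 as [x0 [Hx0 Hx1]].
    set (D := Rabs (Derive p 1) + 1). assert (HD : 0 < D) by (unfold D; pose proof (Rabs_pos (Derive p 1)); lra).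
    exists (Rmin x0 (eps / (2 * D))). split; [apply Rmin_pos; [lra|apply Rdiv_lt_0_compat; lra]|].
    intros x [Hx Hxd].
    assert (Hx2 : x < x0) by rmin_lt Hxd.
    assert (Hx3 : x < eps / (2 * D)) by rmin_lt Hxd.
    assert (A := Hpsi x x0 ltac:(lra) ltac:(lra)).
    assert (B : psi x <= L) by (apply HL1; exists x; split; [lra|auto]).
    assert (Hm : Rabs (Derive p 1 * x) < eps / 2).
    { rewrite Rabs_mult, (Rabs_pos_eq x) by lra.
      apply Rle_lt_trans with (D * x).
      - apply Rmult_le_compat_r; [lra|unfold D; lra].
      - replace (eps / 2) with (D * (eps / (2 * D))) by (field; lra). apply Rmult_lt_compat_l; auto. }
    unfold psi in A, B, Hx1. apply Rabs_def2 in Hm. apply Rabs_def1; unfold l, psi in *; lra. }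
  assert (Hf : filterlim p (at_right 0) (locally l)).
  { intros P [e HP]. destruct (Hlim e (cond_pos e)) as [d [Hd H]].
    exists (mkposreal d Hd). intros x Hx Hx0. apply HP.
    change (Rabs (x - 0) < d) in Hx. apply Rabs_def2 in Hx. apply H. lra. }
  exists l. split; [|exact Hf].
  apply (filterlim_le (F := at_right 0) p (fun x => x * p 1) l 0).
  - exists (mkposreal 1 Rlt_0_1). intros x Hx Hx0. change (Rabs (x - 0) < 1) in Hx.
    apply Rabs_def2 in Hx. assert (Q := Hst 1 x ltac:(lra)). lra.
  - exact Hf.
  - apply (filterlim_at_right_linear _ _ (Rabs (p 1)) (Rabs_pos _)). intros t Ht.
    rewrite Rminus_0_r, Rabs_mult, (Rabs_pos_eq t) by lra. lra.
Qed.

Lemma at_right_pos : at_right 0 (fun t => 0 < t).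
Proof. exists (mkposreal 1 Rlt_0_1). intros t _ Ht. exact Ht. Qed.

Lemma generator_conditions (phi : C -> C) : Bernstein_generator phi ->
  let p := fun x => Re (phi (RtoC x)) in
  (forall x, 0 < x -> phi (RtoC x) = RtoC (p x)) /\ alternating p /\
  forall x y, 0 < y <= x -> x * p y <= y * p x.
Proof.
  intros [v [[HBF _] Hgen]] p.
  set (g := fun t x => (x + - Re (v t (RtoC x))) / t).
  assert (Hpt : forall x, 0 < x -> forall eps, 0 < eps ->
    at_right 0 (fun t => Cmod (RtoC (g t x) - phi (RtoC x)) < eps)).
  { intros x Hx eps He. destruct (Hgen (RtoC x) Hx) as [d Hd].
    refine (filter_imp _ _ _ (filter_and _ _ at_right_pos (Hd (mkposreal eps He)))).
    intros t [Ht H]. specialize (H (RtoC x) Hx).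
    replace (RtoC x - RtoC x)%C with (RtoC 0) in H by ring. rewrite Cmod_0 in H.
    specialize (H (cond_pos d)). simpl in H.
    replace (RtoC (g t x)) with ((RtoC x - v t (RtoC x)) / RtoC t)%C; auto.
    destruct (HBF t (Rlt_le _ _ Ht)) as [_ [Him _]]. specialize (Him x Hx).
    unfold g. rewrite RtoC_div by lra. f_equal. rewrite RtoC_plus, RtoC_opp.
    destruct (v t (RtoC x)) as [a b]. simpl in *. rewrite Him. reflexivity. }
  assert (Hreal : forall x, 0 < x -> phi (RtoC x) = RtoC (p x)).
  { intros x Hx. apply injective_projections; [reflexivity|].
    change (Im (phi (RtoC x)) = 0). apply cond_eq. intros e He.
    destruct (filter_ex _ (Hpt x Hx e He)) as [t Ht].
    eapply Rle_lt_trans; [|exact Ht]. rewrite Rminus_0_r, <- Rabs_Ropp.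
    eapply Rle_trans; [|apply (Rmax_Cmod (RtoC (g t x) - phi (RtoC x))%C)].
    eapply Rle_trans; [|apply Rmax_r]. right. unfold Im. simpl. f_equal. ring. }
  assert (Hlim : forall x, 0 < x -> filterlim (fun t => g t x) (at_right 0) (locally (p x))).
  { intros x Hx P [e He]. unfold filtermap. refine (filter_imp _ _ _ (Hpt x Hx e (cond_pos e))).
    intros t Ht. apply He. change (Rabs (g t x - p x) < e).
    rewrite Hreal, <- RtoC_minus, Cmod_R in Ht by auto. exact Ht. }
  assert (Halt : at_right 0 (fun t => alternating (g t) /\ nonpos_at_0 (g t))).
  { refine (filter_imp _ _ _ at_right_pos). intros t Ht.
    destruct (HBF t (Rlt_le _ _ Ht)) as [_ [_ [[B1 [B2 B3]] _]]]. split.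
    - apply (alternating_difference_quotient (fun x => - Re (v t (RtoC x)))); auto.
      apply Bernstein_alternating; auto.
    (* As [v_t >= 0], the quotient at [e] is at most [e / t]. *)
    - intros eta He. exists (eta * t). split; [apply Rmult_lt_0_compat; auto|].
      intros e [He1 He2]. unfold g. specialize (B1 e He1).
      apply Rmult_lt_reg_r with t; auto. unfold Rdiv. rewrite Rmult_assoc, Rinv_l by lra. lra. }
  destruct (alternating_limit (at_right 0) g p) as [Hp _]; auto.
  { refine (filter_imp _ _ _ Halt). intros t Ht. apply Ht. }
  split; [exact Hreal|split; [exact Hp|]].
  intros x y Hxy.
  apply (filterlim_le (F := at_right 0) (fun t => x * g t y) (fun t => y * g t x) (x * p y) (y * p x)).
  - refine (filter_imp _ _ _ Halt). intros t [H1 H2]. apply alternating_star; auto.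
  - eapply filterlim_comp; [apply Hlim; lra|]. apply (filterlim_scal_r x (p y)).
  - eapply filterlim_comp; [apply Hlim; lra|]. apply (filterlim_scal_r y (p x)).
Qed.

Lemma generator_exists (phi : C -> C) (p : R -> R) : Hol HP allC phi ->
  (forall x, 0 < x -> phi (RtoC x) = RtoC (p x)) -> alternating p -> nonpos_at_0 p ->
  Bernstein_generator phi.
Proof.
  intros Hphi Hreal Hp H0.
  (* The Taylor extension is built for alternating functions, and it is the negative of the flow
     that is alternating; [V] restores the sign. *)
  set (W := fun t => extension (fun x => - flow p t x)).
  set (V := fun t z => (- W t z)%C).
  assert (HA : forall t, 0 <= t -> alternating (fun x => - flow p t x))
    by (intros t Ht; exact (proj1 (flow_bernstein p t Hp H0 Ht))).
  assert (HW : forall t, 0 <= t -> Hol HP allC (W t)) by (intros t Ht; apply extension_Hol; auto).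
  assert (Hopp : forall F, Hol HP allC F -> Hol HP allC (fun z => - F z)%C).
  { intros F [HF _]. split; [|intros; exact I]. intros z Hz. destruct (HF z Hz) as [l Hl].
    exists (RtoC 0 * F z + RtoC (-1) * l)%C.
    apply (is_derive_ext (fun z => RtoC (-1) * F z)%C).
    - intros u. apply injective_projections; simpl; ring.
    - apply is_derive_C_mult; auto. apply is_derive_C_AbsRing. apply (@is_derive_const C_AbsRing). }
  assert (HV : forall t, 0 <= t -> Hol HP allC (V t)) by (intros t Ht; apply Hopp; auto).
  assert (HVr : forall t x, 0 <= t -> 0 < x -> V t (RtoC x) = RtoC (flow p t x)).
  { intros t x Ht Hx. unfold V, W.
    rewrite (extension_real (fun x => - flow p t x)) by auto. rewrite <- RtoC_opp. f_equal. ring. }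
  assert (HVH : forall t z, 0 <= t -> HP z -> HP (V t z)).
  { intros t z Ht. apply (bernstein_extension_Re (V t) (flow p t)); auto.
    - intros x Hx. apply flow_pos; auto.
    - apply flow_bernstein; auto. }
  assert (Hid : Hol HP allC (fun z => z)).
  { split; [|intros; exact I]. intros z _. exists (RtoC 1). apply is_derive_C_id. }
  exists V. split; [split; [|split; [|split]]|].
  - intros t Ht. split; [auto|]. split; [|split].
    + intros x Hx. rewrite HVr; auto.
    + destruct (flow_bernstein p t Hp H0 Ht) as [_ [S1 S2]].
      assert (E : forall x, 0 < x -> locally x (fun y => flow p t y = Re (V t (RtoC y)))).
      { intros x Hx. refine (filter_imp _ _ _ (locally_pos x Hx)). intros y Hy. now rewrite HVr. }
      split; [|split].
      * intros x Hx. rewrite HVr by auto. rewrite re_RtoC. left. apply flow_pos; auto.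
      * intros n x Hx. apply ex_derive_n_ext_loc with (flow p t); auto.
      * intros n x Hn Hx. rewrite <- (Derive_n_ext_loc (flow p t)); auto.
    + exists 1. split; [lra|]. rewrite HVr by lra. intros E. apply RtoC_inj in E.
      assert (F := flow_pos p t 1 Hp H0 Ht ltac:(lra)). lra.
  - apply (HP_identity _ _ (fun x => x)); auto; [apply HV; lra|].
    intros x Hx. rewrite HVr by lra. now rewrite flow_0.
  - intros s t Hs Ht.
    apply (HP_identity (fun z => V s (V t z)) (V (s + t)) (flow p (s + t))).
    + split; [|intros; exact I]. intros z Hz.
      destruct (proj1 (HV t Ht) z Hz) as [l Hl]. destruct (proj1 (HV s Hs) (V t z) (HVH t z Ht Hz)) as [m Hm].
      eexists. apply (is_derive_C_C_comp (V s) (V t)); eauto.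
    + apply HV. lra.
    + intros x Hx. rewrite !HVr; auto; [|apply flow_pos; auto]. now rewrite flow_add.
    + intros x Hx. apply HVr; lra.
  - assert (HL : loc_unif_lim (at_right 0) HP W (fun z => - z)%C).
    { apply (loc_unif_lim_of_axis (at_right 0) W (fun t x => - flow p t x) _ (fun x => - x)).
      - refine (filter_imp _ _ _ at_right_pos). intros t Ht. split; [apply HA; lra|].
        split; [apply HW; lra|]. intros x Hx.
        exact (extension_real _ x (HA t (Rlt_le _ _ Ht)) Hx).
      - apply Hopp, Hid.
      - intros x Hx. now rewrite RtoC_opp.
      - intros x Hx. destruct (flow_tangent p x Hp H0 Hx) as [K [HK HT]].
        apply (filterlim_at_right_linear _ _ (Rabs (p x) + K)).
        { pose proof (Rabs_pos (p x)). lra. }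
        intros t Ht. specialize (HT t ltac:(lra)).
        replace (- flow p t x - - x) with (t * p x - (flow p t x - x + t * p x)) by ring.
        eapply Rle_trans; [apply Rabs_triang|]. rewrite Rabs_Ropp, Rabs_mult, (Rabs_pos_eq t) by lra.
        assert (K * t² <= K * t) by (apply Rmult_le_compat_l; [auto|unfold Rsqr; nra]). lra. }
    intros z Hz. destruct (HL z Hz) as [d Hd]. exists d. intros eps.
    refine (filter_imp _ _ _ (Hd eps)). intros t Ht w Hw Hwz. specialize (Ht w Hw Hwz).
    unfold V. replace (- W t w - w)%C with (- (W t w - - w))%C by ring. now rewrite Cmod_opp.
  - apply (loc_unif_lim_of_axis (at_right 0) _ (fun t x => (x + - flow p t x) / t) phi p); auto.
    + refine (filter_imp _ _ _ at_right_pos). intros t Ht.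
      assert (Ht0 : 0 <= t) by lra.
      split; [apply (alternating_difference_quotient (fun x => - flow p t x)); auto|]. split.
      * split; [|intros; exact I]. intros z Hz. destruct (proj1 (HV t Ht0) z Hz) as [l Hl].
        eexists. apply is_derive_C_mult.
        -- apply (is_derive_minus (V := C_NormedModule) (fun z => z) (V t)); [apply is_derive_C_id|exact Hl].
        -- apply is_derive_C_AbsRing. apply (@is_derive_const C_AbsRing).
      * intros x Hx. rewrite HVr by auto. rewrite RtoC_div, RtoC_plus, RtoC_opp by lra. reflexivity.
    + intros x Hx. destruct (flow_tangent p x Hp H0 Hx) as [K [HK HT]].
      apply (filterlim_at_right_linear _ _ K HK).
      intros t Ht. specialize (HT t ltac:(lra)).
      replace ((x + - flow p t x) / t - p x) with (- (flow p t x - x + t * p x) * / t) by (field; lra).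
      rewrite Rabs_mult, Rabs_Ropp, (Rabs_pos_eq (/ t)) by (apply Rlt_le, Rinv_0_lt_compat; lra).
      apply Rmult_le_reg_r with t; [lra|]. rewrite Rmult_assoc, Rinv_l by lra. unfold Rsqr in HT. lra.
Qed.

Theorem theorem3 (phi : C -> C) (Hphi : Hol HP allC phi) :
  Bernstein_generator phi <->
  ((forall x : R, 0 < x -> Im (phi (RtoC x)) = 0) /\
   (exists l : R, l <= 0 /\
      filterlim (fun x : R => phi (RtoC x)) (at_right 0) (locally (RtoC l))) /\
   completely_monotone (Finite 0) p_infty
     (fun x : R => C_derive (C_derive phi) (RtoC x))).
Proof.
  set (p := fun x => Re (phi (RtoC x))).
  split.
  - intros H. destruct (generator_conditions phi H) as [Hreal [Hp Hst]]. fold p in Hreal, Hp, Hst.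
    split; [|split].
    + intros x Hx. now rewrite Hreal.
    + destruct (alternating_limit_at_0 p Hp Hst) as [l [Hl Hlim]]. exists l. split; auto.
      intros P [e He].
      assert (Q : at_right 0 (fun x => Rabs (p x - l) < e)) by exact (Hlim _ (locally_ball l e)).
      unfold filtermap. refine (filter_imp _ _ _ (filter_and _ _ at_right_pos Q)).
      intros x [Hx Hx']. apply He. rewrite Hreal by auto. split; [exact Hx'|].
      apply ball_center.
    + apply (completely_monotone_iff phi p); auto. apply Hp.
  - intros [Him [[l [Hl Hlim]] Hcm]].
    assert (Hreal : forall x, 0 < x -> phi (RtoC x) = RtoC (p x)).
    { intros x Hx. apply injective_projections; [reflexivity|]. exact (Him x Hx). }
    apply (generator_exists phi p); auto.
    + apply (completely_monotone_iff phi p); auto. apply (HP_taylor phi p Hphi Hreal).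
    + intros eta He.
      destruct (Hlim _ (locally_ball (RtoC l) (mkposreal eta He))) as [d Hd].
      exists d. split; [apply cond_pos|]. intros x [Hx Hxd].
      assert (B : ball 0 d x) by (change (Rabs (x - 0) < d); rewrite Rminus_0_r, Rabs_pos_eq; lra).
      destruct (Hd x B Hx) as [Hb _]. change (Rabs (p x - l) < eta) in Hb.
      apply Rabs_def2 in Hb. lra.
Qed.
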